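(* Let $T>0$. For every compact set $K\subset P$, $$\frac1k\log\mu_k^{z,t}(K)\le-\inf_{x\in K}I^{z,t}(x)+o(1),\qquad k\to\infty,$$ where $o(1)$ denotes a quantity tending to $0$ as $k\to\infty$ uniformly in $z\in M$ and $t\in[0,T]$. Here, with $F_t(x)=t(R-f(x))$, $$I^{z,t}(x)=[I^z(x)-F_t(x)]+\sup_{y\in P}[F_t(y)-I^z(y)],$$ and $\mu_k^{z,t}$ is the probability measure on $P$ $$\mu_k^{z,t}=\frac1{Z_k^{t,z}}\sum_{\alpha\in kP\cap\mathbb Z^m}e^{kF_t(\frac{\alpha}k)}\frac{|s_\alpha(z)|^2_{h_0^k}}{Q_{h_0^k}(\alpha)}\,\delta_{\frac{\alpha}k},$$ with $Z_k^{t,z}$ the normalizing constant.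
   Context: Toric setup. $M$ is a smooth projective toric manifold of dimension $m$: $(\mathbb C^* )^m$ acts holomorphically with an open orbit $M^o\cong(\mathbb C^* )^m$; $\mathbf T^m=(S^1)^m$. $P\subset\mathbb R^m$ is a Delzant lattice polytope with $0\in P\subset[0,\infty)^m$, and $L\to M$ is the corresponding very ample toric line bundle. For each $k\ge1$, $H^0(M,L^k)$ has the basis of monomial sections $s_\alpha$, $\alpha\in kP\cap\mathbb Z^m$, with $s_\alpha=z^\alpha e^{\otimes k}$ on $M^o$, where $e$ is a $\mathbf T^m$-invariant nowhere vanishing holomorphic frame of $L$ over $M^o$. $h_0$ is a smooth $\mathbf T^m$-invariant Hermitian metric with positive curvature form $\omega_0=-i\partial\bar\partial\log|e|^2_{h_0}$. Put $Q_{h_0^k}(\alpha)=\int_M|s_\alpha|^2_{h_0^k}\,\omega_0^m/m!$. On $M^o$ write $z=e^{\rho/2+i\theta}$, $\rho_j=\log|z_j|^2$; $\varphi_{P^o}=-\log|e|^2_{h_0}$ is a strictly convex function of $\rho\in\mathbb R^m$; $\mu_0:M\to P$ is $\nabla_\rho\varphi_{P^o}$ on $M^o$, extended continuously; $u_0(x)=\sup_\rho(\langle x,\rho\rangle-\varphi_{P^o}(\rho))$, $x\in P$. Faces. For a closed face $F$ of dimension $n$ with relative interior $F^o$, choose a vertex $w$ of $F$; let $w^1,\dots,w^m$ be the $\mathbb Z$-basis of primitive edge vectors of $P$ at $w$, with $w^1,\dots,w^n$ parallel to $F$. Write $x\in F$ as $x=w+\sum_{i\le n}x''_iw^i$. The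 orbit $\mu_0^{-1}(F^o)\cong(\mathbb C^* )^n$ has coordinates $\eta_i$ (the extension of $z^{w^i}$), $\rho''_i=\log|\eta_i|^2$. Put $\varphi_F=-\log|s_w|^2_{h_0}$ on this orbit, a function of $\rho''$, and $u_F(x)=\sup_{\rho''}(\langle x'',\rho''\rangle-\varphi_F(\rho''))$, $x\in F$. Rate functions. $I^z(x)=u_0(x)-\langle x,\rho\rangle+\varphi_{P^o}(\rho)$ for $z\in M^o$; for $z\in\mu_0^{-1}(F^o)$, $I^z(x)=u_F(x)-\langle x'',\rho''\rangle+\varphi_F(\rho'')$ for $x\in F$ and $I^z=+\infty$ on $P\setminus F$. Data. $f=\max\{\lambda_1,\dots,\lambda_p\}$ with $\lambda_j$ affine-linear with rational coefficients; $R$ is an integer with $f\le R$ on $P$. The integer $d$ of the test configuration is taken to be $1$ throughout. Conventions: $\log0=-\infty$, $\inf\emptyset=+\infty$. *)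

(* Defs.v *)
From mathcomp Require Import all_boot all_order all_algebra.
From mathcomp Require Import complex.
From mathcomp Require Import all_classical all_reals all_analysis.

Set Implicit Arguments.
Unset Strict Implicit.
Unset Printing Implicit Defensive.

Import Order.TTheory GRing.Theory Num.Theory.
Import numFieldNormedType.Exports.

Local Open Scope classical_set_scope.
Local Open Scope ring_scope.

Section Toric.
Variable R : realType.
Variable m : nat.

Local Notation C := R[i].
(* C^m as the real vector space R^m x R^m of (real part, imaginary part);
   topology and differential calculus on C^m take place here *)
Local Notation RC := ('rV[R]_m * 'rV[R]_m)%type.

Definition dot (x y : 'rV[R]_m) : R := \sum_(i < m) x 0 i * y 0 i.

Definition realv (a : 'rV[int]_m) : 'rV[R]_m := map_mx intr a.

Definition lattice_polytope (P : set 'rV[R]_m) :=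
  exists (n : nat) (v : 'I_n.+1 -> 'rV[int]_m),
    P = [set x | exists c : 'I_n.+1 -> R,
           [/\ forall i, 0 <= c i, \sum_i c i = 1
             & x = \sum_i c i *: realv (v i)]].

Definition segment (x y : 'rV[R]_m) : set 'rV[R]_m :=
  [set (1 - s) *: x + s *: y | s in [set s : R | 0 <= s <= 1]].

(* faces (P itself included, the empty set excluded) as extreme convex
   subsets; for a polytope these are closed and coincide with the sets where
   a linear form attains its minimum *)
Definition face (P F : set 'rV[R]_m) :=
  [/\ F !=set0, F `<=` P,
      forall x y, F x -> F y -> segment x y `<=` F
    & forall x y (s : R), P x -> P y -> 0 < s -> s < 1 ->
        F ((1 - s) *: x + s *: y) -> F x /\ F y].

Definition affine_hull (F : set 'rV[R]_m) : set 'rV[R]_m :=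
  [set x | exists (n : nat) (c : 'I_n -> R) (p : 'I_n -> 'rV[R]_m),
     [/\ forall i, F (p i), \sum_i c i = 1 & x = \sum_i c i *: p i]].

Definition relint (F : set 'rV[R]_m) : set 'rV[R]_m :=
  [set x | F x /\ \forall y \near x, affine_hull F y -> F y].

Definition vertex (P : set 'rV[R]_m) (w : 'rV[int]_m) := face P [set realv w].

Definition primitive (u : 'rV[int]_m) :=
  u != 0 /\ forall d : int, (forall i : 'I_m, (d %| u 0%R i)%Z) -> `|d| = 1.

Definition primitive_edge_vector (P : set 'rV[R]_m) (w u : 'rV[int]_m) :=
  primitive u /\
  exists2 l : R, 0 < l & face P (segment (realv w) (realv w + l *: realv u)).

(* A vertex w together with an ordering w^1, ..., w^m (the rows of the matrix)
   of the primitive edge vectors at w, required by is_vframe to be a Z-basis of Z^m. *)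
Record vframe := VFrame { fvert : 'rV[int]_m; fedge : 'M[int]_m }.

Definition is_vframe (P : set 'rV[R]_m) (c : vframe) :=
  [/\ vertex P (fvert c), fedge c \in unitmx
    & forall u, primitive_edge_vector P (fvert c) u <->
                exists i, u = row i (fedge c)].

Definition delzant (P : set 'rV[R]_m) :=
  lattice_polytope P /\
  forall w, vertex P w -> exists B, is_vframe P (VFrame w B).

Definition cvec (p : RC) : 'rV[C]_m := \row_i Complex (p.1 0 i) (p.2 0 i).
Definition rvec (z : 'rV[C]_m) : RC :=
  (\row_i complex.Re (z 0 i), \row_i complex.Im (z 0 i)).

Definition abs2 (z : C) : R := complex.Re z ^+ 2 + complex.Im z ^+ 2.

Definition in_torus (z : 'rV[C]_m) := forall i, z 0 i != 0.

(* z^a, with 0^0 = 1; only used with nonnegative exponents where a coordinate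
   of z may vanish *)
Definition monom (z : 'rV[C]_m) (a : 'rV[int]_m) : C :=
  \prod_i (z 0 i) ^ (a 0 i).

(* (z^{B_1}, ..., z^{B_m}) for the rows B_i of B *)
Definition mon_map (B : 'M[int]_m) (z : 'rV[C]_m) : 'rV[C]_m :=
  \row_i monom z (row i B).

(* (e^{x_j + i y_j})_j *)
Definition cexp (p : RC) : 'rV[C]_m :=
  \row_j Complex (expR (p.1 0 j) * cos (p.2 0 j)) (expR (p.1 0 j) * sin (p.2 0 j)).

(* The point of M given by eta in C^m in the affine chart U_w attached to the
   vertex w.  M is covered by these charts; they all contain the open orbit
   M^o = (C \ 0)^m, on which eta_i = z^{w^i}, and since M^o is dense these
   relations determine the gluing.  A point of M usually has several
   representatives of this form; all the functions of z below depend only on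
   the point. *)
Record toric_point (P : set 'rV[R]_m) := ToricPoint {
  pframe : vframe;
  pframeP : is_vframe P pframe;
  pcoord : 'rV[C]_m }.

(* coordinates z in (C \ 0)^m of a point of M^o given in the chart c *)
Definition open_coord (c : vframe) (eta : 'rV[C]_m) : 'rV[C]_m :=
  mon_map (invmx (fedge c)) eta.

Definition logabs2 (z : 'rV[C]_m) : 'rV[R]_m := \row_i ln (abs2 (z 0 i)).

Fixpoint Cn (V : normedModType R) (n : nat) (f : V -> R) : Prop :=
  continuous f /\
  if n is n'.+1 then
    forall v, (forall x, derivable f x v) /\ Cn n' ('D_v f)
  else True.

Definition smooth (V : normedModType R) (f : V -> R) := forall n, Cn n f.

Definition grad (f : 'rV[R]_m -> R) (x : 'rV[R]_m) : 'rV[R]_m :=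
  \row_j 'D_(delta_mx 0 j) f x.

Definition dRe (j : 'I_m) : RC := (delta_mx 0 j, 0).
Definition dIm (j : 'I_m) : RC := (0, delta_mx 0 j).

(* The matrix of d^2 f / dz_j dzbar_k, with d/dz = (d/dx - i d/dy)/2 and
   d/dzbar = (d/dx + i d/dy)/2:  i ddbar f = i sum_jk (levi f)_jk dz_j dzbar_k *)
Definition levi (f : RC -> R) (p : RC) : 'M[C]_m :=
  \matrix_(j, k) Complex
    (('D_(dRe j) ('D_(dRe k) f) p + 'D_(dIm j) ('D_(dIm k) f) p) / 4)
    (('D_(dRe j) ('D_(dIm k) f) p - 'D_(dIm j) ('D_(dRe k) f) p) / 4).

Definition herm_posdef (A : 'M[C]_m) :=
  forall v : 'rV[C]_m, v != 0 ->
    0 < \sum_j \sum_k A j k * v 0 j * conjc (v 0 k).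

(* Smooth T^m-invariant Hermitian metrics on L with positive curvature.
   The section s_w trivializes L over the chart at w, and e = z^{-w} s_w is
   the invariant frame over M^o. *)

Record toric_metric (P : set 'rV[R]_m) := ToricMetric {
  norm_e : 'rV[C]_m -> R;               (* z |-> |e(z)|^2_h on (C \ 0)^m *)
  norm_v : vframe -> 'rV[C]_m -> R;     (* eta |-> |s_w(eta)|^2_h *)
  norm_compat : forall c z, is_vframe P c -> in_torus z ->
    norm_v c (mon_map (fedge c) z) = abs2 (monom z (fvert c)) * norm_e z;
  norm_pos : forall c eta, is_vframe P c -> 0 < norm_v c eta;
  norm_smooth : forall c, is_vframe P c -> smooth (norm_v c \o cvec);
  norm_inv : forall c (tau eta : 'rV[C]_m), is_vframe P c ->
    (forall i, abs2 (tau 0 i) = 1) ->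
    norm_v c (\row_i (mon_map (fedge c) tau 0 i * eta 0 i)) = norm_v c eta;
  norm_curv : forall c p, is_vframe P c ->
    herm_posdef (levi (fun q => - ln (norm_v c (cvec q))) p) }.

(* Lebesgue integral over D^n of a nonnegative function,
   written as an iterated integral (Tonelli) *)

Fixpoint int_pow (D : set R) (n : nat) : ('rV[R]_n -> \bar R) -> \bar R :=
  match n return ('rV[R]_n -> \bar R) -> \bar R with
  | 0%N => fun f => f 0
  | n'.+1 => fun f =>
      (\int[@lebesgue_measure R]_(x in D)
         int_pow D (fun v : 'rV[R]_n' =>
           f (row_mx (const_mx x : 'rV[R]_1) v)))%E
  end.

Section Metric.
Variables (P : set 'rV[R]_m) (h : toric_metric P).

Definition sect2_open (k : nat) (a : 'rV[int]_m) (z : 'rV[C]_m) : R :=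
  abs2 (monom z a) * norm_e h z ^+ k.

(* |s_alpha|^2_{h^k}: in the chart at w, s_alpha = eta^c s_w^k where
   alpha - k w = sum_i c_i w^i *)
Definition sect2 (k : nat) (a : 'rV[int]_m) (z : toric_point P) : R :=
  let c := pframe z in
  abs2 (monom (pcoord z) ((a - fvert c *+ k) *m invmx (fedge c)))
    * norm_v h c (pcoord z) ^+ k.

(* Density of omega^m/m! with respect to d rho d theta at z = e^zeta,
   zeta = rho/2 + i theta.  In the holomorphic coordinates zeta,
   omega = i sum_jk g_jk dzeta_j dzetabar_k with g = levi (- log |e|^2), and
   omega^m/m! = det g prod_j (i dzeta_j dzetabar_j)
              = det g prod_j drho_j dtheta_j. *)
Definition vol_density (zeta : RC) : R :=
  complex.Re (\det (levi (fun q => - ln (norm_e h (cexp q))) zeta)).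

(* Q_{h^k}(alpha); the complement of M^o in M is a null set *)
Definition Qnorm (k : nat) (a : 'rV[int]_m) : R :=
  fine (int_pow setT (fun rho : 'rV[R]_m =>
    int_pow `[0, 2 * pi] (fun theta : 'rV[R]_m =>
      let zeta := (2^-1 *: rho, theta) in
      (sect2_open k a (cexp zeta) * vol_density zeta)%:E))).

(* phi_{P^o}, u_0 *)
Definition phi (rho : 'rV[R]_m) : R := - ln (norm_e h (cexp (2^-1 *: rho, 0))).

Definition u0 (x : 'rV[R]_m) : \bar R :=
  ereal_sup [set (dot x rho - phi rho)%:E | rho in [set: 'rV[R]_m]].

(* mu_0: the gradient of phi on M^o, extended to M by continuity *)
Definition moment (z : toric_point P) : 'rV[R]_m :=
  lim ((fun q : RC => grad phi (logabs2 (open_coord (pframe z) (cvec q))))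
         @ within [set q | in_torus (cvec q)] (nbhs (rvec (pcoord z)))).

(* the face F with z in mu_0^{-1}(F^o) *)
Definition face_at (z : toric_point P) : set 'rV[R]_m :=
  [set x | exists F, [/\ face P F, relint F (moment z) & F x]].

(* w^i is parallel to the face of z.  The vertex w of the chart lies on that
   face, since the orbit of z meets U_w. *)
Definition tangent (z : toric_point P) (i : 'I_m) : bool :=
  `[< exists x y (s : R), [/\ face_at z x, face_at z y, s != 0
        & y - x = s *: realv (row i (fedge (pframe z)))] >].

(* x'' in x = w + sum_i x''_i w^i *)
Definition edge_coord (c : vframe) (x : 'rV[R]_m) : 'rV[R]_m :=
  (x - realv (fvert c)) *m map_mx intr (invmx (fedge c)).

(* The orbit of z has coordinates eta_i with w^i parallel to F (the other
   eta_i vanish); vectors rho'' and x'' are indexed by 'I_m and only the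
   entries with w^i parallel to F matter. *)
Definition dotF (z : toric_point P) (x r : 'rV[R]_m) : R :=
  \sum_(i < m | tangent z i) x 0 i * r 0 i.

Definition phiF (z : toric_point P) (r : 'rV[R]_m) : R :=
  - ln (norm_v h (pframe z)
          (\row_i (if tangent z i then Complex (expR (r 0 i / 2)) 0 else 0))).

Definition uF (z : toric_point P) (x : 'rV[R]_m) : \bar R :=
  ereal_sup [set (dotF z (edge_coord (pframe z) x) r - phiF z r)%:E
            | r in [set: 'rV[R]_m]].

(* I^z on P *)
Definition rate (z : toric_point P) (x : 'rV[R]_m) : \bar R :=
  if `[< in_torus (pcoord z) >] then
    let rho := logabs2 (open_coord (pframe z) (pcoord z)) in
    (u0 x - (dot x rho)%:E + (phi rho)%:E)%E
  else if `[< face_at z x >] then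
    let r := logabs2 (pcoord z) in
    (uF z x - (dotF z (edge_coord (pframe z) x) r)%:E + (phiF z r)%:E)%E
  else +oo%E.

(* in the following, F stands for F_t *)

Definition tilted_rate (F : 'rV[R]_m -> R) (z : toric_point P) (x : 'rV[R]_m) : \bar R :=
  ((rate z x - (F x)%:E) + ereal_sup [set (F y)%:E - rate z y | y in P])%E.

Definition lattice_pts (k : nat) : set 'rV[int]_m :=
  [set a | exists2 x, P x & realv a = k%:R *: x].

Definition scaled (k : nat) (a : 'rV[int]_m) : 'rV[R]_m := k%:R^-1 *: realv a.

Definition weight (F : 'rV[R]_m -> R) (k : nat) (z : toric_point P) (a : 'rV[int]_m) : R :=
  expR (k%:R * F (scaled k a)) * (sect2 k a z / Qnorm k a).

Definition partition_fun (F : 'rV[R]_m -> R) (k : nat) (z : toric_point P) : R :=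
  \sum_(a \in lattice_pts k) weight F k z a.

Definition mu (F : 'rV[R]_m -> R) (k : nat) (z : toric_point P) (A : set 'rV[R]_m) : R :=
  (partition_fun F k z)^-1 *
    \sum_(a \in lattice_pts k) weight F k z a * \1_A (scaled k a).

End Metric.

(* x |-> <a, x> + b with rational a, b *)
Definition affine_rat (l : 'rV[rat]_m * rat) (x : 'rV[R]_m) : R :=
  \sum_(i < m) ratr (l.1 0 i) * x 0 i + ratr l.2.

Definition max_affine (p : nat) (lam : 'I_p.+1 -> 'rV[rat]_m * rat)
    (x : 'rV[R]_m) : R :=
  \big[Num.max/affine_rat (lam ord0) x]_(j < p.+1) affine_rat (lam j) x.

End Toric.

(* Main.v *)
Require Import Defs.
From mathcomp Require Import all_boot all_order all_algebra.
From mathcomp Require Import complex finmap perm.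
From mathcomp Require Import all_classical all_reals all_analysis.
From mathcomp Require Import measurable_realfun ring lra.

Set Implicit Arguments.
Unset Strict Implicit.
Unset Printing Implicit Defensive.

Import Order.TTheory GRing.Theory Num.Theory.
Import numFieldNormedType.Exports.

Local Open Scope classical_set_scope.
Local Open Scope ring_scope.

(* Both |s_alpha(z)|^2 and Q(alpha) have explicit exponential rates.  In the
   chart of z, (1/k) log |s_alpha(z)|^2 at alpha = k y is the affine function
   log_section of y when y lies on the face of z, and s_alpha(z) = 0 otherwise.
   For the norms, Q(alpha) = exp(k (u_0(y) + o(1))) uniformly in y in P: the
   upper bound holds because phi differs from the support function of P by a
   bounded amount and the volume density decays exponentially, the lower bound
   because a near-maximizer rho of <y, rho> - phi(rho) can be moved into a cube
   of fixed size on which the integrand is almost as large; compactness of the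
   closed unit polydiscs, finitely many of which cover M, makes this uniform.
   Up to the boundary, u_F = u_0 on F and the moment map sends the orbit of z
   into the relative interior of F, by strict convexity of the potential along
   the orbit.  Hence each weight is exp(k (F_t(y) - I^z(y) + o(1))).  Since P has
   only polynomially many lattice points, the mass of K is bounded by its largest
   weight, and the normalizing constant is bounded below because u_0, which is
   bounded, convex and lower semicontinuous, is uniformly continuous on P, so
   that every point of a face is approximated by lattice points of that face at
   almost no cost. *)

(** * Differentiability along lines *)

(** The obstacle to uniformity in [z] is that log|eta_i| is unbounded near the boundary orbits, so
    [log_section] has no modulus of continuity uniform in [z]. The lattice approximation therefore
    loses nothing at all in this term: y is a weighted average of nearby points of P whose multiples
    by k are lattice points, those of positive weight lie on the face of y, and one of them has at
    least as large a value of the affine function [log_section]. Only u_0 and F_t contribute errors,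
    and neither involves [z].

    The manifold is seen only through its charts. There r = rho B^T is the vector of the
    log|eta_i|^2, and [Psi a r] is the potential at the moduli a_i e^(r_i/2): a = 1 gives the open
    orbit and a 0/1 vector a boundary orbit, so a single convexity computation serves all orbits.
    Rotation invariance of the metric is what turns the complex Hessian, known to be positive, into
    the real Hessian in r. *)

Section Calculus.
Context {R : realType} {V : normedModType R}.
Implicit Types (f : V -> R) (x p q v : V).

Lemma scaleRE (a b : R) : a *: b = a * b :> R. Proof. by []. Qed.

(** A division-free form of the limit that also covers h = 0; the error estimates of the chain rule
    below compose in this form. *)
Lemma is_derive_epsP f x v (df : R) :
  is_derive x v f df <->
  forall e : R, 0 < e -> exists2 d : R, 0 < d &
    forall h : R, `|h| < d -> `|f (h *: v + x) - f x - h * df| <= e * `|h|.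
Proof.
split.
- move=> Df e e0.
  have Dv := @ex_derive _ _ _ _ _ _ _ Df.
  have := @derive_val _ _ _ _ _ _ _ Df; rewrite /derive => E.
  have Cv : h^-1 *: (f (h *: v + x) - f x) @[h --> 0^'] --> df.
    by rewrite -E; exact: Dv.
  move/cvgrPdist_le : Cv => /(_ e e0)[/= d d0 dP].
  exists d => // h hd.
  have [->|h0] := eqVneq h 0.
    by rewrite scale0r add0r subrr mul0r subr0 normr0 mulr0.
  have := dP h; rewrite /ball_/= sub0r normrN => /(_ hd h0).
  rewrite -(ler_pM2l (x:=`|h|)) ?normr_gt0// [in leRHS]mulrC => /(le_trans _); apply.
  rewrite -normrM -normrN le_eqVlt; apply/orP; left; apply/eqP; congr `|_|.
  by rewrite scaleRE; field.
- move=> H.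
  have Cv : h^-1 *: (f (h *: v + x) - f x) @[h --> 0^'] --> df.
    apply/cvgrPdist_le => e e0; have [d d0 dP] := H e e0.
    exists d => //= h; rewrite /ball_/= sub0r normrN => hd h0.
    rewrite -(ler_pM2l (x:=`|h|)) ?normr_gt0// [in leRHS]mulrC.
    apply: le_trans (dP h hd).
    rewrite -normrM -normrN le_eqVlt; apply/orP; left; apply/eqP; congr `|_|.
    by rewrite scaleRE; field.
  apply: DeriveDef; last exact/cvg_lim.
  by apply/cvg_ex; exists df.
Qed.

Lemma is_derive_lineP f x v (df : R) :
  is_derive x v f df <-> is_derive (0 : R) 1 (fun s : R => f (s *: v + x)) df.
Proof.
have E : 'D_v f x = 'D_1 (fun s : R => f (s *: v + x)) 0.
  rewrite /derive; do 2 f_equal.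
  by apply/funext => h /=; rewrite addr0 scale0r add0r [h *: 1]mulr1.
split=> Df; apply: DeriveDef.
- by apply/(derivable1P f x v).1; exact: ex_derive.
- by rewrite -E; exact: derive_val.
- by apply/(derivable1P f x v).2; exact: ex_derive.
- by rewrite E; exact: derive_val.
Qed.

End Calculus.

Section LineDerivatives.
Context {R : realType} {V : normedModType R}.
Implicit Types (f : V -> R) (x p q v : V).

Lemma is_derive_shift_line f x v (s : R) (df : R) :
  is_derive (s *: v + x) v f df ->
  is_derive s 1 (fun s : R => f (s *: v + x)) df.
Proof.
move=> /is_derive_lineP Df; apply/is_derive_lineP.
apply: is_derive_eq.
  have -> : (fun h : R => f ((h *: (1:R) + s) *: v + x)) =
            (fun h : R => f (h *: v + (s *: v + x))).
    by apply/funext => h; rewrite scaleRE mulr1 scalerDl addrA.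
  exact: Df.
by [].
Qed.

Lemma is_derive_mulfun f g x v (df dg : R) :
  is_derive x v f df -> is_derive x v g dg ->
  is_derive x v (fun y => f y * g y) (f x * dg + g x * df).
Proof.
move=> Df Dg; apply: DeriveDef.
  by apply: (@derivableM _ _ f g); exact: ex_derive.
have Df' : derivable f x v by exact: ex_derive.
have Dg' : derivable g x v by exact: ex_derive.
rewrite (@deriveM _ _ f g)//.
have -> : 'D_v f x = df by exact: derive_val.
have -> : 'D_v g x = dg by exact: derive_val.
by rewrite !scaleRE.
Qed.

Lemma is_derive_invfun f x v (df : R) : f x != 0 ->
  is_derive x v f df -> is_derive x v (fun y => (f y)^-1) (- df / f x ^+ 2).
Proof.
move=> fx0 Df; apply: DeriveDef.
  by apply: (@derivableV _ _ f) => //; exact: ex_derive.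
have Df' : derivable f x v by exact: ex_derive.
rewrite (@deriveV _ _ f)//.
have -> : 'D_v f x = df by exact: derive_val.
by rewrite scaleRE !mulNr mulrC.
Qed.

Lemma is_derive_oppfun f x v (df : R) :
  is_derive x v f df -> is_derive x v (fun y => - f y) (- df).
Proof. by move=> Df; exact: (@is_deriveN _ _ _ f). Qed.

Lemma is_derive_addfun f g x v (df dg : R) :
  is_derive x v f df -> is_derive x v g dg ->
  is_derive x v (fun y => f y + g y) (df + dg).
Proof. by move=> Df Dg; exact: (@is_deriveD _ _ _ f g). Qed.

Lemma is_derive_cstfun (k : R) x v : is_derive x v (fun=> k) 0.
Proof. exact: (@is_derive_cst _ _ _ k). Qed.

Lemma is_derive_sumfun (I : Type) (s : seq I) (F : I -> V -> R) x v (dF : I -> R) :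
  (forall i, is_derive x v (F i) (dF i)) ->
  is_derive x v (fun y => \sum_(i <- s) F i y) (\sum_(i <- s) dF i).
Proof.
move=> DF; elim: s => [|i s IH].
  rewrite big_nil; under eq_fun do rewrite big_nil; exact: is_derive_cstfun.
rewrite big_cons; under eq_fun do rewrite big_cons.
exact: is_derive_addfun.
Qed.

(** Stated with directional derivatives only, because that is what [Cn] provides. *)
Definition C1 f := forall v, (forall x, derivable f x v) /\ continuous ('D_v f).

(** Mean value theorem on the segment from q to q + tv. The base point q may differ from p, so that
    increments in several directions can be made one after the other. *)
Lemma incr_approx f v p : (forall x, derivable f x v) ->
  {for p, continuous ('D_v f)} -> forall e : R, 0 < e ->
  exists2 d : R, 0 < d & forall q (t : R), `|q - p| < d -> `|t| < d ->
    `|f (t *: v + q) - f q - t * 'D_v f p| <= e * `|t|.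
Proof.
move=> Df /cvgrPdist_le Dc e e0.
have /nbhs_ballP[/= r r0 rP] := Dc e e0.
have nv0 : 0 < `|v| + 1 by rewrite ltr_wpDl.
(* Half of the radius r is spent on q - p and half on the displacement along v. *)
pose d := Num.min (r / 2) (r / 2 / (`|v| + 1)).
have d0 : 0 < d by rewrite lt_min !divr_gt0.
exists d => // q t qd td.
have Dg (s : R) : is_derive s 1 (fun s : R => f (s *: v + q)) ('D_v f (s *: v + q)).
  by apply: is_derive_shift_line; exact: derivableP.
have cg : continuous (fun s : R => f (s *: v + q)).
  move=> s; apply: differentiable_continuous; apply/derivable1_diffP.
  by have := Dg s => ?; exact: ex_derive.
have est c : `|c| <= `|t| -> `|'D_v f (c *: v + q) - 'D_v f p| <= e.
  move=> ct; rewrite distrC; apply: rP; rewrite -ball_normE/=.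
  rewrite opprD addrCA (le_lt_trans (ler_normD _ _))// normrN normrZ distrC.
  rewrite [ltRHS]splitr ltr_leD//.
    apply: le_lt_trans (_ : `|t| * (`|v| + 1) < _).
      by rewrite ler_pM// lerDl.
    by rewrite -ltr_pdivlMr// (lt_le_trans td)// ge_min lexx orbT.
  by rewrite (le_trans (ltW qd))// ge_min lexx.
have [t0|t0|->] := ltrgtP t 0.
- have [|c] := @MVT R (fun s : R => f (s *: v + q)) _ t 0 t0 (fun s _ => Dg s).
    exact: continuous_subspaceT.
  rewrite in_itv/= => /andP[tc c0]; rewrite scale0r add0r sub0r => E.
  have -> : f (t *: v + q) - f q = 'D_v f (c *: v + q) * t.
    by apply/eqP; rewrite -eqr_opp opprB E mulrN.
  rewrite mulrC -mulrBr normrM mulrC ler_wpM2r// est//.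
  by rewrite ltr0_norm// ltr0_norm// lerN2 ltW.
- have [|c] := @MVT R (fun s : R => f (s *: v + q)) _ 0 t t0 (fun s _ => Dg s).
    exact: continuous_subspaceT.
  rewrite in_itv/= => /andP[c0 ct]; rewrite scale0r add0r subr0 => E.
  rewrite E mulrC -mulrBr normrM mulrC ler_wpM2r// est//.
  by rewrite gtr0_norm// gtr0_norm// ltW.
- by rewrite scale0r add0r subrr mul0r subr0 normr0 mulr0.
Qed.

(** One direction at a time: the increments already made only move the base point, and [incr_approx]
    is uniform in it. *)
Lemma C1_approx (I : eqType) (s : seq I) (b : I -> V) f p : C1 f ->
  forall e : R, 0 < e -> exists2 d : R, 0 < d & forall t : I -> R,
    (forall i, `|t i| < d) ->
    `|f (\sum_(i <- s) t i *: b i + p) - f p - \sum_(i <- s) t i * 'D_(b i) f p|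
      <= e * \sum_(i <- s) `|t i|.
Proof.
move=> Cf; elim: s => [|i s IH] e e0.
  by exists 1 => // t _; rewrite !big_nil add0r subrr subr0 normr0 mulr0.
have [d1 d10 d1P] := IH e e0.
have [d2 d20 d2P] := incr_approx (Cf (b i)).1 ((Cf (b i)).2 p) e0.
pose M := \sum_(j <- s) `|b j| + 1.
have M0 : 0 < M by rewrite ltr_wpDl// sumr_ge0.
pose d := Num.min (Num.min d1 d2) (d2 / M).
exists d; first by rewrite !lt_min d10 d20 divr_gt0.
move=> t td; rewrite !big_cons.
set q := \sum_(j <- s) t j *: b j + p.
have tdi j : [/\ `|t j| < d1, `|t j| < d2 & `|t j| < d2 / M].
  by have := td j; rewrite !lt_min => /andP[/andP[]].
have qp : `|q - p| < d2.
  rewrite /q addrK (le_lt_trans (ler_norm_sum _ _ _))//.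
  apply: le_lt_trans (_ : \sum_(j <- s) d2 / M * `|b j| < _).
    apply: ler_sum => j _; rewrite normrZ ler_wpM2r//.
    by case: (tdi j) => _ _ /ltW.
  rewrite -mulr_sumr -mulrA gtr_pMr// mulrC ltr_pdivrMr// mul1r /M.
  by rewrite ltrDl.
rewrite -(addrA (t i *: b i)) -/q.
have -> : f (t i *: b i + q) - f p - (t i * 'D_(b i) f p + \sum_(j <- s) t j * 'D_(b j) f p)
  = (f (t i *: b i + q) - f q - t i * 'D_(b i) f p)
    + (f q - f p - \sum_(j <- s) t j * 'D_(b j) f p) by ring.
rewrite (le_trans (ler_normD _ _))// mulrDr lerD//.
  by apply: d2P => //; case: (tdi i).
by apply: d1P => j; case: (tdi j).
Qed.

(** Half of the error comes from the expansion of [f] (controlled through A), half from the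
    expansions of the coordinate functions [a i] (controlled through D). *)
Lemma C1_chain (I : finType) (b : I -> V) f (a : I -> R -> R) (a' : I -> R) (s0 : R) :
  C1 f -> (forall i, is_derive s0 1 (a i) (a' i)) ->
  is_derive s0 1 (fun s => f (\sum_i a i s *: b i))
    (\sum_i a' i * 'D_(b i) f (\sum_j a j s0 *: b j)).
Proof.
move=> Cf Da; set p := \sum_j a j s0 *: b j.
apply/is_derive_epsP => e e0.
pose A := \sum_i (`|a' i| + 1).
have A0 : 0 <= A by apply: sumr_ge0 => i _; rewrite addr_ge0.
pose D := \sum_i `|'D_(b i) f p|.
have D0 : 0 <= D by apply: sumr_ge0.
have e1 : 0 < e / 2 / (A + 1) by rewrite !divr_gt0// ltr_wpDl.
have e2 : 0 < Num.min 1 (e / 2 / (D + 1)).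
  by rewrite lt_min ltr01/= !divr_gt0// ltr_wpDl.
have [d1 d10 d1P] := C1_approx (index_enum I) b p Cf e1.
have /fin_all_exists2[d d0 dP] := fun i => (is_derive_epsP _ _ _ _).1 (Da i) _ e2.
pose dm := \big[Num.min/1]_i d i.
have dm0 : 0 < dm by apply: lt_bigmin.
pose dd := Num.min dm (d1 / (A + 1)).
have dd0 : 0 < dd by rewrite lt_min dm0 divr_gt0// ltr_wpDl.
exists dd => // h hd.
pose t i := a i (h *: 1 + s0) - a i s0.
have tE i : `|t i - h * a' i| <= Num.min 1 (e / 2 / (D + 1)) * `|h|.
  apply: dP; apply: (lt_le_trans hd); rewrite ge_min; apply/orP; left.
  exact: bigmin_le_cond.
have tb i : `|t i| <= (`|a' i| + 1) * `|h|.
  have -> : t i = h * a' i + (t i - h * a' i) by ring.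
  rewrite (le_trans (ler_normD _ _))// mulrDl normrM mulrC lerD//.
  by rewrite (le_trans (tE i))// ler_wpM2r// ge_min lexx.
have AiA i : `|a' i| + 1 <= A.
  by rewrite /A (bigD1 i)//= lerDl sumr_ge0// => j _; rewrite addr_ge0.
have td i : `|t i| < d1.
  rewrite (le_lt_trans (tb i))//.
  apply: le_lt_trans (_ : (A + 1) * `|h| < _).
    by rewrite ler_wpM2r// (le_trans (AiA i))// lerDl.
  by rewrite mulrC -ltr_pdivlMr ?ltr_wpDl// (lt_le_trans hd)// ge_min lexx orbT.
have := d1P t td.
have -> : \sum_i t i *: b i + p = \sum_i a i (h *: 1 + s0) *: b i.
  rewrite /p -big_split/=; apply: eq_bigr => i _.
  by rewrite -scalerDl subrK.
rewrite -/p => est.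
have -> : f (\sum_i a i (h *: 1 + s0) *: b i) - f p - h * (\sum_i a' i * 'D_(b i) f p)
  = (f (\sum_i a i (h *: 1 + s0) *: b i) - f p - \sum_i t i * 'D_(b i) f p)
   + \sum_i (t i - h * a' i) * 'D_(b i) f p.
  have -> : \sum_i (t i - h * a' i) * 'D_(b i) f p
      = \sum_i t i * 'D_(b i) f p - h * (\sum_i a' i * 'D_(b i) f p).
    rewrite mulr_sumr -sumrB; apply: eq_bigr => i _; by rewrite mulrBl mulrA.
  by ring.
rewrite (le_trans (ler_normD _ _))// [e]splitr mulrDl lerD//.
  rewrite (le_trans est)//.
  apply: le_trans (_ : e / 2 / (A + 1) * (A * `|h|) <= _).
    rewrite ler_pM2l// /A mulr_suml; apply: ler_sum => i _; exact: tb.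
  rewrite mulrA ler_wpM2r// -mulrA ler_piMr ?divr_ge0 ?ltW//.
  by rewrite mulrC ltr_pdivrMr ?ltr_wpDl// mul1r ltrDl.
rewrite (le_trans (ler_norm_sum _ _ _))//.
apply: le_trans (_ : \sum_i (e / 2 / (D + 1) * `|h|) * `|'D_(b i) f p| <= _).
  apply: ler_sum => i _; rewrite normrM ler_wpM2r// (le_trans (tE i))//.
  by rewrite ler_wpM2r// ge_min lexx orbT.
rewrite -mulr_sumr -/D mulrAC ler_wpM2r// -(mulrA (e / 2)) ler_piMr ?divr_ge0 ?ltW//.
by rewrite mulrC ltr_pdivrMr ?ltr_wpDl// mul1r ltrDl.
Qed.

End LineDerivatives.

Lemma continuous_bigsum (R : realType) (T : topologicalType) (I : Type) (s : seq I)
    (f : I -> T -> R) : (forall i, continuous (f i)) ->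
  continuous (fun x => \sum_(i <- s) f i x).
Proof.
move=> cf; elim: s => [|i s IH].
  rewrite (_ : (fun _ => _) = fun=> 0); first exact: cst_continuous.
  by apply/funext => x; rewrite big_nil.
rewrite (_ : (fun _ => _) = fun x => f i x + \sum_(j <- s) f j x).
  by move=> x; exact: cvgD (cf i x) (IH x).
by apply/funext => x; rewrite big_cons.
Qed.

Lemma continuous_bigprod (R : realType) (T : topologicalType) (I : Type) (s : seq I)
    (f : I -> T -> R) : (forall i, continuous (f i)) ->
  continuous (fun x => \prod_(i <- s) f i x).
Proof.
move=> cf; elim: s => [|i s IH].
  rewrite (_ : (fun _ => _) = fun=> 1); first exact: cst_continuous.
  by apply/funext => x; rewrite big_nil.
rewrite (_ : (fun _ => _) = fun x => f i x * \prod_(j <- s) f j x).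
  by move=> x; exact: cvgM (cf i x) (IH x).
by apply/funext => x; rewrite big_cons.
Qed.

(** * Vertices and edges of Delzant polytopes *)

Section Cone.
Context {R : realFieldType} {V : lmodType R} {I : finType}.
Variable g : I -> V.

Definition cone (J : {set I}) (x : V) : Prop :=
  exists c : I -> R, (forall i, 0 <= c i) /\ x = \sum_(i in J) c i *: g i.

Lemma coneD J x y : cone J x -> cone J y -> cone J (x + y).
Proof.
move=> [c [c0 ->]] [d [d0 ->]]; exists (fun i => c i + d i); split.
  by move=> i; rewrite addr_ge0.
by rewrite -big_split; apply: eq_bigr => i _; rewrite scalerDl.
Qed.

Lemma coneZ J x (a : R) : 0 <= a -> cone J x -> cone J (a *: x).
Proof.
move=> a0 [c [c0 ->]]; exists (fun i => a * c i); split.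
  by move=> i; rewrite mulr_ge0.
by rewrite scaler_sumr; apply: eq_bigr => i _; rewrite scalerA.
Qed.

Lemma cone0 J : cone J 0.
Proof.
exists (fun=> 0); split=> //; rewrite big1// => i _; exact: scale0r.
Qed.

Lemma cone_sum (K : finType) (Q : pred K) J (f : K -> V) :
  (forall k, Q k -> cone J (f k)) -> cone J (\sum_(k | Q k) f k).
Proof. by move=> H; apply: big_ind => //; [exact: cone0|exact: coneD]. Qed.

Lemma cone_gen (J : {set I}) i : i \in J -> cone J (g i).
Proof.
move=> iJ; exists (fun j => (j == i)%:R); split=> [j|]; first exact: ler0n.
rewrite (bigD1 i)//= eqxx scale1r big1 ?addr0// => j /andP[_ /negbTE->].
exact: scale0r.
Qed.

Lemma cone_trans (J J' : {set I}) x :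
  (forall i, i \in J -> cone J' (g i)) -> cone J x -> cone J' x.
Proof.
move=> H [c [c0 ->]]; apply: cone_sum => i iJ; apply: coneZ => //; exact: H.
Qed.

Lemma cone_min_gen : exists J : {set I},
  (forall i, cone J (g i)) /\ forall j, j \in J -> ~ cone (J :\ j) (g j).
Proof.
pose Q (J : {set I}) := `[< forall i, cone J (g i) >].
have QT : Q [set: I]%SET by apply/asboolP => i; apply: cone_gen; rewrite inE.
have [J /minsetP[/asboolP QJ Jmin]] := @ex_minset _ Q (ex_intro Q _ QT).
exists J; split=> // j jJ Hj.
have := Jmin (J :\ j); rewrite subD1set => /(_ _ isT) E.
have : j \in J :\ j.
  rewrite E//; apply/asboolP => i; apply: cone_trans (QJ i) => k kJ.
  have [->//|kj] := eqVneq k j.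
  by apply: cone_gen; rewrite !inE kj.
by rewrite !inE eqxx.
Qed.

(** An irredundant generator of a pointed cone spans an extreme ray. Let ga be what remains of t
    after removing the g_j-parts of a and b: if ga > 0, then g_j is generated by the others; if ga
    <= 0, the remainders and -ga g_j sum to zero and pointedness kills them. *)
Lemma cone_extremal (J : {set I}) j (t : R) a b :
  (forall a b, cone J a -> cone J b -> a + b = 0 -> a = 0) ->
  j \in J -> ~ cone (J :\ j) (g j) ->
  cone J a -> cone J b -> a + b = t *: g j ->
  exists2 al : R, 0 <= al & a = al *: g j.
Proof.
move=> pt jJ nj [c [c0 aE]] [d [d0 bE]].
pose a' := \sum_(i in J :\ j) c i *: g i.
pose b' := \sum_(i in J :\ j) d i *: g i.
have Ca' : cone (J :\ j) a' by exists c.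
have Cb' : cone (J :\ j) b' by exists d.
have aE' : a = c j *: g j + a' by rewrite aE (big_setD1 j).
have bE' : b = d j *: g j + b' by rewrite bE (big_setD1 j).
have sub x : cone (J :\ j) x -> cone J x.
  by apply: cone_trans => i; rewrite !inE => /andP[_ iJ]; apply: cone_gen.
pose ga := t - c j - d j.
move=> E.
have E' : a' + b' = ga *: g j.
  rewrite /ga !scalerBl -E aE' bE'.
  by rewrite addrACA (addrC (c j *: g j + _)) -addrA -opprD addrK.
have [ga0|ga0] := ltP 0 ga.
  exfalso; apply: nj.
  have -> : g j = ga^-1 *: (a' + b') by rewrite E' scalerA mulVf ?scale1r ?gt_eqF.
  by apply: coneZ; [rewrite invr_ge0 ltW|exact: coneD].
exists (c j) => //; rewrite aE'.
rewrite (pt a' (b' + (- ga) *: g j)) ?addr0//.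
- exact: sub.
- by apply: coneD; [exact: sub|apply: coneZ; [rewrite oppr_ge0|exact: cone_gen]].
- by rewrite addrA E' scaleNr subrr.
Qed.

End Cone.

(** * Maxima of linear forms on a polytope *)

Section Polytope.
Context {R : realType} {m : nat}.
Local Notation vec := 'rV[R]_m.

Lemma dotD (x y r : vec) : dot (x + y) r = dot x r + dot y r.
Proof. by rewrite /dot -big_split; apply: eq_bigr => i _; rewrite !mxE mulrDl. Qed.

Lemma dotZ (a : R) (x r : vec) : dot (a *: x) r = a * dot x r.
Proof. by rewrite /dot mulr_sumr; apply: eq_bigr => i _; rewrite !mxE mulrA. Qed.

Lemma dotC (x y : vec) : dot x y = dot y x.
Proof. by apply: eq_bigr => i _; rewrite mulrC. Qed.

Lemma dotN (x r : vec) : dot (- x) r = - dot x r.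
Proof. by rewrite -scaleN1r dotZ mulN1r. Qed.

Lemma dotB (x y r : vec) : dot (x - y) r = dot x r - dot y r.
Proof. by rewrite dotD dotN. Qed.

Lemma dot0 (r : vec) : dot 0 r = 0.
Proof. by rewrite /dot big1// => i _; rewrite mxE mul0r. Qed.

Lemma dot_sum (I : Type) (s : seq I) (Q : pred I) (f : I -> vec) r :
  dot (\sum_(i <- s | Q i) f i) r = \sum_(i <- s | Q i) dot (f i) r.
Proof.
elim/big_rec2: _ => [|i y x _ <-]; by rewrite ?dot0 ?dotD.
Qed.

Lemma dot_mulmx (x r : vec) (B : 'M[R]_m) : dot (x *m B) r = dot x (r *m B^T).
Proof.
rewrite /dot.
under eq_bigr do rewrite mxE mulr_suml.
under [RHS]eq_bigr do rewrite mxE mulr_sumr.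
rewrite exchange_big; apply: eq_bigr => i _; apply: eq_bigr => j _.
by rewrite mxE mulrA mulrAC.
Qed.

Variables (n : nat) (v : 'I_n.+1 -> 'rV[int]_m).
Let P : set vec := [set x | exists c : 'I_n.+1 -> R,
           [/\ forall i, 0 <= c i, \sum_i c i = 1
             & x = \sum_i c i *: realv R (v i)]].

Lemma polytope_pt i : P (realv R (v i)).
Proof.
exists (fun j => (j == i)%:R); split=> [j||]; first exact: ler0n.
  by rewrite (bigD1 i)//= eqxx big1 ?addr0// => j /negbTE->.
by rewrite (bigD1 i)//= eqxx scale1r big1 ?addr0// => j /negbTE->; rewrite scale0r.
Qed.

Lemma polytope_convex x y (s : R) : P x -> P y -> 0 <= s -> s <= 1 ->
  P ((1 - s) *: x + s *: y).
Proof.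
move=> [c [c0 c1 ->]] [d [d0 d1 ->]] s0 s1.
exists (fun i => (1 - s) * c i + s * d i); split=> [i||].
- by rewrite addr_ge0 ?mulr_ge0 ?subr_ge0.
- by rewrite big_split/= -!mulr_sumr c1 d1; ring.
- rewrite !scaler_sumr -big_split/=; apply: eq_bigr => i _.
  by rewrite !scalerA -scalerDl.
Qed.

(** Homogenization: the points (v_i, 1) generate a pointed cone. A minimal generating subset
    consists of vertices, since a convex decomposition of such a v_j lifts to the cone and is
    trivial there by extremality. All other v_i are convex combinations of these, so the maximum is
    reached on the subset. *)
Lemma polytope_max_vertex (r : vec) :
  exists2 j, vertex P (v j) & forall y, P y -> dot y r <= dot (realv R (v j)) r.
Proof.
pose g (i : 'I_n.+1) : vec * R^o := (realv R (v i), 1).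
have [J [gen irr]] := cone_min_gen g.
have sumE (Q : pred 'I_n.+1) (c : 'I_n.+1 -> R) : \sum_(i | Q i) c i *: g i =
    (\sum_(i | Q i) c i *: realv R (v i), \sum_(i | Q i) c i).
  elim/big_rec3: _ => //= i y1 y2 y3 _ ->; congr pair => /=.
  by rewrite scaleRE mulr1.
have pt (a b : vec * R^o) : cone g J a -> cone g J b -> a + b = 0 -> a = 0.
  move=> [c [c0 ->]] [d [d0 ->]]; rewrite !sumE => -[_ E].
  have c00 : forall i, i \in J -> c i = 0.
    apply/psumr_eq0P; first by move=> i _.
    have Es : \sum_(i in J) c i + \sum_(i in J) d i = 0 :> R := E.
    have c1 : 0 <= \sum_(i in J) c i by apply: sumr_ge0.
    have d1 : 0 <= \sum_(i in J) d i by apply: sumr_ge0.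
    by lra.
  by congr pair; rewrite big1// => i /c00 ->; rewrite ?scale0r.
have vert j : j \in J -> vertex P (v j).
  move=> jJ; split.
  - by exists (realv R (v j)).
  - by move=> _ ->; exact: polytope_pt.
  - move=> x y -> -> _ [s _ <-] /=.
    by rewrite -scalerDl subrK scale1r.
  - move=> x y s Px Py s0 s1 E.
    have Cg z : P z -> cone g J (z, 1).
      move=> [c [c0 c1 ->]].
      have -> : (\sum_i c i *: realv R (v i), 1) = \sum_i c i *: g i :> vec * R^o.
        by rewrite sumE c1.
      by apply: cone_sum => i _; exact: coneZ.
    have s1' : 0 < 1 - s by rewrite subr_gt0.
    have key (z z' : vec) (t : R) : P z -> P z' -> 0 < t -> t < 1 ->
        t *: z + (1 - t) *: z' = realv R (v j) -> z = realv R (v j).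
      move=> Pz Pz' t0 t1 Ez.
      have t1' : 0 < 1 - t by rewrite subr_gt0.
      have [|al al0] := @cone_extremal _ _ _ g J j 1 (t *: ((z, 1) : vec * R^o)) ((1 - t) *: ((z', 1) : vec * R^o))
        pt jJ (irr j jJ) (coneZ (ltW t0) (Cg _ Pz)) (coneZ (ltW t1') (Cg _ Pz')).
        by rewrite scale1r; congr pair; rewrite //= !scaleRE !mulr1; ring.
      move=> /= [E1]; rewrite !scaleRE !mulr1 => E2.
      apply: (scalerI (lt0r_neq0 t0)).
      by rewrite E1 -E2.
    split; first apply: (key x y (1 - s)) => //.
    + by rewrite gtrBl.
    + by rewrite opprB addrCA subrr addr0.
    + by apply: (key y x s) => //; rewrite addrC.
have [j jJ] : exists j, j \in J.
  have [c [c0]] := gen ord0; rewrite sumE => -[_].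
  have [->|[j jJ] _] := set_0Vmem J; last by exists j.
  by rewrite big_set0 => /eqP; rewrite oner_eq0.
pose q i := dot (realv R (v i)) r.
have [k kJ kmax] : exists2 k, k \in J & forall i, i \in J -> q i <= q k.
  case: (Order.TotalTheory.arg_maxP q jJ) => k kJ km; by exists k.
exists k; first exact: vert.
have qk i : q i <= q k.
  have [c [c0]] := gen i; rewrite sumE => -[E1 E2].
  rewrite /q E1 dot_sum -[leRHS]mul1r E2 mulr_suml.
  apply: ler_sum => l lJ; rewrite dotZ; apply: ler_wpM2l => //; exact: kmax.
move=> _ [c [c0 c1 ->]]; rewrite dot_sum -[leRHS]mul1r -c1 mulr_suml.
by apply: ler_sum => l _; rewrite dotZ; apply: ler_wpM2l => //; exact: qk.
Qed.

End Polytope.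

(** * Edge coordinates at a vertex and the covering by polydiscs *)

Section Edges.
Context {R : realType} {m : nat}.
Local Notation vec := 'rV[R]_m.
Implicit Types (P : set vec) (c : vframe m) (x y : vec).

Definition realmx (B : 'M[int]_m) : 'M[R]_m := map_mx intr B.

Lemma realmxM (A B : 'M[int]_m) : realmx (A *m B) = realmx A *m realmx B.
Proof. exact: map_mxM. Qed.

Lemma realmxV P c : is_vframe P c -> realmx (fedge c) *m realmx (invmx (fedge c)) = 1%:M.
Proof. by move=> [_ Bu _]; rewrite -realmxM mulmxV// /realmx map_mx1. Qed.

Lemma realmxVl P c : is_vframe P c -> realmx (invmx (fedge c)) *m realmx (fedge c) = 1%:M.
Proof. by move=> [_ Bu _]; rewrite -realmxM mulVmx// /realmx map_mx1. Qed.

Lemma edge_coordK P c x : is_vframe P c ->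
  realv R (fvert c) + edge_coord c x *m realmx (fedge c) = x.
Proof.
move=> Pc; rewrite /edge_coord -mulmxA (realmxVl Pc) mulmx1 addrC subrK//.
Qed.

Lemma edge_coord_add P c (t : vec) : is_vframe P c ->
  edge_coord c (realv R (fvert c) + t *m realmx (fedge c)) = t.
Proof.
move=> Pc; rewrite /edge_coord addrC addKr -mulmxA.
by rewrite (realmxV Pc) mulmx1.
Qed.

Lemma edge_coord_comb c x y (s : R) :
  edge_coord c ((1 - s) *: x + s *: y) = (1 - s) *: edge_coord c x + s *: edge_coord c y.
Proof.
rewrite /edge_coord !scalemxAl -mulmxDl; congr (_ *m _).
by apply/rowP => i; rewrite !mxE; ring.
Qed.

Lemma realv_row (B : 'M[int]_m) i : realv R (row i B) = row i (realmx B).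
Proof. by rewrite /realv map_row. Qed.

Lemma vertex_in P c : is_vframe P c -> P (realv R (fvert c)).
Proof. by move=> [[_ sub _ _] _ _]; apply: sub. Qed.

Lemma edge_in P c i : is_vframe P c -> exists2 l : R, 0 < l &
  P (realv R (fvert c) + l *: realv R (row i (fedge c))).
Proof.
move=> [_ _ E]; have [_ [l l0 [_ sub _ _]]] := (E (row i (fedge c))).2 (ex_intro _ i erefl).
exists l => //; apply: sub; exists 1; first by rewrite /= ler01 lexx.
by rewrite subrr scale0r add0r scale1r.
Qed.

Lemma dvdz_mulA_gcd (u : 'rV[int]_m) : u != 0 ->
  exists (d : nat) (u' : 'rV[int]_m), [/\ (0 < d)%N, u = d%:Z *: u' & primitive u'].
Proof.
move=> u0; pose d := \big[gcdn/0%N]_(i < m) `|u 0%R i|%N.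
have dd i : (d%:Z %| u 0%R i)%Z.
  by rewrite /dvdz /=; apply: (biggcdn_inf i).
have d0 : (0 < d)%N.
  rewrite lt0n; apply: contraNneq u0 => d0; apply/eqP/rowP => i.
  by have := dd i; rewrite d0 dvd0z mxE => /eqP.
pose u' : 'rV[int]_m := \row_i (u 0%R i %/ d)%Z.
have uE : u = d%:Z *: u' by apply/rowP => i; rewrite !mxE mulrC divzK.
exists d, u'; split=> //; split.
  by apply: contraNneq u0 => u'0; rewrite uE u'0 scaler0.
move=> e ed.
have : (d * `|e| %| d)%N.
  rewrite {2}/d; apply/dvdn_biggcdP => i _.
  have : (d%:Z * e %| u 0%R i)%Z by rewrite uE mxE dvdz_mul.
  by rewrite /dvdz abszM.
rewrite -{2}[d]muln1 dvdn_pmul2l// dvdn1 => /eqP e1.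
by apply/eqP; rewrite -abszE e1.
Qed.

(** P lies in the cone at w spanned by its edges. That cone is pointed because w is a vertex, and
    each irredundant generator spans an extreme ray which meets P in an edge; the primitive vector
    of this edge is some w^i by the definition of a frame. *)
Lemma edge_coord_ge0 P c y : lattice_polytope P -> is_vframe P c -> P y ->
  forall i, 0 <= edge_coord c y 0 i.
Proof.
move=> [n [v PE]] Pc Py i0.
set w := realv R (fvert c).
have conv x z s : P x -> P z -> 0 <= s -> s <= 1 -> P ((1 - s) *: x + s *: z).
  by rewrite PE; exact: polytope_convex.
have Pv i : P (realv R (v i)) by rewrite PE; exact: polytope_pt.
have Pw : P w := vertex_in Pc.
have [[_ _ _ ext] Bu edges] := Pc.
pose g i : vec := realv R (v i) - w.
have PC (K : {set 'I_n.+1}) x : P x -> (forall i, cone g K (g i)) -> cone g K (x - w).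
  rewrite PE => -[d [d0 d1 ->]] HK.
  have -> : \sum_i d i *: realv R (v i) - w = \sum_i d i *: g i.
    under [RHS]eq_bigr do rewrite scalerBr.
    by rewrite sumrB -scaler_suml d1 scale1r.
  by apply: cone_sum => i _; exact: coneZ.
(* A short step from w in a cone direction stays in P: with D the sum of the coefficients, w + a /
   (1 + D) is a convex combination of the v_i. *)
have CP (K : {set 'I_n.+1}) a : cone g K a -> exists2 t : R, 0 < t &
    forall s, 0 <= s -> s <= t -> P (w + s *: a).
  move=> [d [d0 ->]]; pose D := \sum_(i in K) d i.
  have D0 : 0 <= D by apply: sumr_ge0.
  have D1 : 0 < 1 + D by rewrite ltr_wpDr.
  have Pz : P (w + (1 + D)^-1 *: \sum_(i in K) d i *: g i).
    move: Pw; rewrite PE => -[e [e0 e1 wE]].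
    exists (fun i => (1 + D)^-1 * (e i + (if i \in K then d i else 0))).
    split=> [i||].
    - by rewrite mulr_ge0 ?invr_ge0 ?(ltW D1)// addr_ge0//; case: ifP.
    - rewrite -mulr_sumr big_split/= e1 -big_mkcond/= -/D mulVf//.
      by rewrite gt_eqF.
    - under eq_bigr do rewrite scalerBr.
      rewrite sumrB -scaler_suml -/D.
      under [RHS]eq_bigr do rewrite -scalerA scalerDl.
      rewrite -scaler_sumr big_split/= -wE.
      rewrite [in RHS](eq_bigr (fun i => if i \in K then d i *: realv R (v i) else 0));
        last by move=> i _; case: ifP => // _; rewrite scale0r.
      rewrite -big_mkcond/=; set S := \sum_(i in K) _.
      by apply/rowP => i; rewrite !mxE; field; rewrite gt_eqF.
  exists (1 + D)^-1; first by rewrite invr_gt0.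
  move=> s s0 st.
  have := conv _ _ (s * (1 + D)) Pw Pz.
  rewrite mulr_ge0 ?(ltW D1)// -ler_pdivlMr// div1r => /(_ isT st).
  rewrite scalerDr addrA -scalerDl subrK scale1r scalerA.
  by rewrite mulfK ?gt_eqF.
(* If both a and -a are cone directions, w is the midpoint of two points of P, hence equal to
   both. *)
have pt (K : {set 'I_n.+1}) a b : cone g K a -> cone g K b -> a + b = 0 -> a = 0.
  move=> /CP[s s0 sP] /CP[t t0 tP] /eqP; rewrite addrC addr_eq0 => /eqP ba.
  pose q := Num.min s t; have q0 : 0 < q by rewrite lt_min s0 t0.
  have P1 : P (w + q *: a) by apply: sP; [exact: ltW|rewrite ge_min lexx].
  have P2 : P (w + q *: b) by apply: tP; [exact: ltW|rewrite ge_min lexx orbT].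
  have h0 : 0 < 2^-1 :> R by lra.
  have h1 : 2^-1 < 1 :> R by lra.
  have [|/eqP] := ext _ _ 2^-1 P1 P2 h0 h1.
    by rewrite /= -/w ba; apply/rowP => k; rewrite !mxE; field.
  rewrite -/w -subr_eq0 addrAC subrr add0r scaler_eq0 gt_eqF//= => /eqP.
  by [].
have [J [gen irr]] := cone_min_gen g.
suff edge j : j \in J -> exists i, exists2 d : R, 0 <= d & g j = d *: row i (realmx (fedge c)).
  have [d [d0 dE]] := PC J y Py gen.
  rewrite /edge_coord -/w dE mulmx_suml summxE; apply: sumr_ge0 => j /edge[i [e e0 ->]].
  rewrite scalerA -scalemxAl mxE -row_mul (realmxV Pc) row1 mxE.
  by rewrite !mulr_ge0// ler0n.
move=> jJ; have gj0 : g j != 0.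
  by apply: contra_notN (irr j jJ) => /eqP->; exact: cone0.
have gjE : g j = realv R (v j - fvert c).
  by apply/rowP => k; rewrite !mxE rmorphB.
have u0 : v j - fvert c != 0.
  by apply: contraNneq gj0 => u0; rewrite gjE u0; apply/eqP/rowP => k; rewrite !mxE.
have [d [u [d0 uE pu]]] := dvdz_mulA_gcd u0.
have {}gjE : g j = d%:R *: realv R u.
  by rewrite gjE uE; apply/rowP => k; rewrite !mxE rmorphM.
have dR0 : 0 < d%:R :> R by rewrite ltr0n.
(* [be i] is the position of v_i on the ray of g_j, with 0 for the v_i off the ray; the largest
   position L is where the edge ends. *)
have /fin_all_exists[be beP] : forall i, exists be : R, 0 <= be /\
    (g i = be *: g j \/ (be = 0 /\ ~ exists2 be' : R, 0 <= be' & g i = be' *: g j)).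
  move=> i; have [[be be0 E]|nE] := pselect (exists2 be' : R, 0 <= be' & g i = be' *: g j).
    by exists be; split=> //; left.
  by exists 0; split=> //; right.
have be1 : be j = 1.
  have [_ [E|[_ []]]] := beP j; last by exists 1; rewrite ?scale1r.
  have : (be j - 1) *: g j = 0 by rewrite scalerBl scale1r -E subrr.
  by move/eqP; rewrite scaler_eq0 (negbTE gj0) orbF subr_eq0 => /eqP.
have [k _ kmax] := Order.TotalTheory.arg_maxP be (isT : xpredT j).
pose L := be k; have L0 : 0 < L by rewrite (lt_le_trans ltr01)// -be1; exact: kmax.
(* By extremality every term e_i g_i of x - w lies on the ray, so al is an average of the [be i]. *)
have ray x al : P x -> x - w = al *: g j -> al <= L.
  rewrite PE => -[e [e0 e1 xE]].
  have {}xE : x - w = \sum_i e i *: g i.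
    under [RHS]eq_bigr do rewrite scalerBr.
    by rewrite sumrB -scaler_suml e1 scale1r xE.
  rewrite xE => E.
  have eE i : e i *: g i = (e i * be i) *: g j.
    have [ei0|ei0] := eqVneq (e i) 0; first by rewrite ei0 mul0r !scale0r.
    have [|||a a0 aE] := @cone_extremal _ _ _ g J j al (e i *: g i) (\sum_(l | l != i) e l *: g l)
      (@pt J) jJ (irr j jJ).
    - by apply: coneZ.
    - by apply: cone_sum => l _; apply: coneZ.
    - by rewrite -E [RHS](bigD1 i).
    have [_ [->|[_ []]]] := beP i; first by rewrite scalerA.
    exists ((e i)^-1 * a); first by rewrite mulr_ge0// invr_ge0.
    by rewrite -scalerA -aE scalerA mulVf// scale1r.
  have alE : al = \sum_i e i * be i.
    apply/eqP; rewrite -subr_eq0; apply: contraNT gj0 => ne.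
    apply/eqP/(scalerI ne).
    by rewrite scaler0 scalerBl -E scaler_suml; under eq_bigr do rewrite eE; rewrite subrr.
  rewrite alE -[L]mul1r -e1 mulr_suml; apply: ler_sum => i _.
  by rewrite ler_wpM2l//; exact: kmax.
have PL : P (w + L *: g j).
  have [_ [<-|[bk0 _]]] := beP k; first by rewrite /g addrC subrK.
  by move: L0; rewrite /L bk0 ltxx.
have [i ui] : exists i, u = row i (fedge c).
  apply/edges; split=> //; exists (L * d%:R); first by rewrite mulr_gt0.
  rewrite -/w -scalerA -gjE; split.
  - exists w; exists 0; first by rewrite /= lexx ler01.
    by rewrite subr0 scale1r scale0r addr0.
  - by move=> _ [s /= /andP[s0 s1] <-]; exact: conv.
  - move=> _ _ [s /= /andP[s0 s1] <-] [t /= /andP[t0 t1] <-] _ [q /= /andP[q0 q1] <-].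
    exists ((1 - q) * s + q * t).
      by apply/andP; split; nra.
    by apply/rowP => l; rewrite !mxE; ring.
  - move=> x z s Px Pz s0 s1 [t /= /andP[t0 t1] tE].
    have s1' : 0 < 1 - s by rewrite subr_gt0.
    have sumE : (1 - s) *: (x - w) + s *: (z - w) = (t * L) *: g j.
      have : (1 - s) *: x + s *: z - w = (t * L) *: g j.
        by rewrite -tE; apply/rowP => l; rewrite !mxE; ring.
      by move=> <-; apply/rowP => l; rewrite !mxE; ring.
    have key x' z' s' t' : P x' -> P z' -> 0 < s' -> 0 < 1 - s' ->
        s' *: (x' - w) + (1 - s') *: (z' - w) = t' *: g j -> segment w (w + L *: g j) x'.
      move=> Px' Pz' s'0 s'1 E.
      have [|||a a0 aE] := @cone_extremal _ _ _ g J j t' (s' *: (x' - w)) ((1 - s') *: (z' - w))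
        (@pt J) jJ (irr j jJ).
      - by apply: coneZ; [exact: ltW|exact: PC].
      - by apply: coneZ; [exact: ltW|exact: PC].
      - exact: E.
      have xE : x' - w = (s'^-1 * a) *: g j.
        by rewrite -scalerA -aE scalerA mulVf ?scale1r// gt_eqF.
      have aL := ray _ _ Px' xE.
      exists (s'^-1 * a / L).
        rewrite /= divr_ge0 ?mulr_ge0 ?invr_ge0 ?(ltW L0) ?(ltW s'0)//=.
        by rewrite ler_pdivrMr// mul1r.
      rewrite scalerDr addrA -scalerDl subrK scale1r scalerA divfK ?gt_eqF//.
      by rewrite -xE addrC subrK.
    split; first apply: (key x z (1 - s) (t * L)) => //.
    + by rewrite opprB addrCA subrr addr0.
    + by rewrite opprB addrCA subrr addr0.
    + by apply: (key z x s (t * L)) => //; rewrite addrC.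
exists i, d%:R; first exact: ltW.
by rewrite gjE ui realv_row.
Qed.

Lemma rowdot (r : vec) (A : 'M[R]_m) l : (r *m A^T) 0 l = dot (row l A) r.
Proof. by rewrite mxE; apply: eq_bigr => i _; rewrite !mxE mulrC. Qed.

Lemma dot_edge P c x (r : vec) : is_vframe P c ->
  dot x r = dot (realv R (fvert c)) r + dot (edge_coord c x) (r *m (realmx (fedge c))^T).
Proof. by move=> Pc; rewrite -dot_mulmx -dotD (edge_coordK _ Pc). Qed.

(** Choose the vertex maximizing y -> <y, rho>: moving along an edge does not increase this form, so
    log|eta_l|^2 <= 0 for every l. This is the covering of the open orbit by the closed unit
    polydiscs of the charts. *)
Lemma chart_cover P : delzant P -> exists (N : nat) (c : 'I_N -> vframe m),
  (forall i, is_vframe P (c i)) /\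
  forall r : vec, exists i, (forall y, P y -> dot y r <= dot (realv R (fvert (c i))) r) /\
    (forall l, (r *m (realmx (fedge (c i)))^T) 0 l <= 0).
Proof.
move=> [[n [v PE]] del].
have mv (r : vec) : exists2 j, vertex P (v j) & forall y, P y -> dot y r <= dot (realv R (v j)) r.
  by rewrite PE; exact: polytope_max_vertex.
have [j0 Vj0 _] := mv 0; have [B0 FB0] := del _ Vj0.
(* The index j runs over all the spanning points v_j; those that are not vertices receive the frame
   of v_j0 as a dummy. *)
have /fin_all_exists[c cP] : forall j, exists c : vframe m,
    is_vframe P c /\ (vertex P (v j) -> fvert c = v j).
  move=> j; have [Vj|nVj] := pselect (vertex P (v j)).
    by have [B FB] := del _ Vj; exists (VFrame (v j) B).
  by exists (VFrame (v j0) B0).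
exists n.+1, c; split=> [i|r]; first by case: (cP i).
have [j Vj jmax] := mv r; exists j.
have [Pc /(_ Vj) cE] := cP j.
split=> [y Py|l]; first by rewrite cE; exact: jmax.
have [s s0 Ps] := edge_in l Pc.
have := jmax _ Ps; rewrite -cE dotD dotZ gerDl pmulr_rle0//.
by rewrite rowdot realv_row.
Qed.

Lemma polytope_bounded P : lattice_polytope P ->
  exists A : nat, forall y, P y -> forall i, `|y 0 i| <= A%:R.
Proof.
move=> [n [v ->]].
exists (\max_(j < n.+1) \max_(i < m) `|v j 0%R i|%N) => _ [c [c0 c1 ->]] i.
rewrite summxE (le_trans (ler_norm_sum _ _ _))// -[leRHS]mul1r -[X in X * _]c1 mulr_suml.
apply: ler_sum => j _; rewrite !mxE normrM ger0_norm// ler_wpM2l//.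
rewrite -intr_norm -natr_absz ler_nat.
by apply: (bigop.bigmax_sup j) => //; apply: (bigop.bigmax_sup i).
Qed.

End Edges.

(** * Torus coordinates and the metric *)

Section Torus.
Context {R : realType} {m : nat}.
Local Notation C := R[i].
Local Notation vec := 'rV[R]_m.
Implicit Types (a : 'rV[int]_m) (A B : 'M[int]_m) (z : 'rV[C]_m).

Lemma abs2M (x y : C) : abs2 (x * y) = abs2 x * abs2 y.
Proof. by case: x y => [a b] [c d]; rewrite /abs2 /=; ring. Qed.

Lemma abs2_1 : abs2 (1 : C) = 1.
Proof. by rewrite /abs2 /= expr0n addr0 expr1n. Qed.

Lemma abs2_ge0 (x : C) : 0 <= abs2 x.
Proof. by rewrite addr_ge0 ?sqr_ge0. Qed.

Lemma abs2_eq0 (x : C) : (abs2 x == 0) = (x == 0).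
Proof.
by case: x => a b; rewrite /abs2 /= paddr_eq0 ?sqr_ge0// !sqrf_eq0 eq_complex.
Qed.

Lemma abs2_gt0 (x : C) : (0 < abs2 x) = (x != 0).
Proof. by rewrite lt_neqAle eq_sym abs2_eq0 abs2_ge0 andbT. Qed.

Lemma abs2_real (x : R) : abs2 (Complex x 0) = x ^+ 2.
Proof. by rewrite /abs2 /= expr0n addr0. Qed.

Lemma abs2V (x : C) : abs2 x^-1 = (abs2 x)^-1.
Proof.
have [->|x0] := eqVneq x 0.
  by rewrite invr0 (_ : abs2 0 = 0) ?invr0//; apply/eqP; rewrite abs2_eq0.
apply: (mulfI (x := abs2 x)); first by rewrite abs2_eq0.
by rewrite -abs2M !divff ?abs2_eq0// abs2_1.
Qed.

Lemma abs2Xn (x : C) n : abs2 (x ^+ n) = abs2 x ^+ n.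
Proof. by elim: n => [|n IH]; rewrite ?expr0 ?abs2_1// !exprS abs2M IH. Qed.

Lemma abs2Xz (x : C) (n : int) : abs2 (x ^ n) = abs2 x ^ n.
Proof.
case: n => n; first by rewrite -!exprnP abs2Xn.
by rewrite NegzE -!exprnN abs2V abs2Xn.
Qed.

Lemma abs2_monom z a : abs2 (monom z a) = \prod_i abs2 (z 0 i) ^ a 0 i.
Proof.
rewrite /monom; elim/big_rec2: _ => [|i y x _ <-]; first exact: abs2_1.
by rewrite abs2M abs2Xz.
Qed.

Lemma expR_intM (n : int) (x : R) : expR (n%:~R * x) = expR x ^ n.
Proof.
case: n => n; first by rewrite -exprnP -expRM_natl.
by rewrite NegzE -exprnN -expRM_natl -expRN mulrNz mulNr.
Qed.

Lemma abs2_monom_torus z a : in_torus z ->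
  abs2 (monom z a) = expR (dot (realv R a) (logabs2 z)).
Proof.
move=> tz; rewrite abs2_monom /dot expR_sum; apply: eq_bigr => i _.
by rewrite !mxE expR_intM lnK// posrE abs2_gt0.
Qed.

Lemma monom_neq0 z a : in_torus z -> monom z a != 0.
Proof. by move=> tz; apply/prodf_neq0 => i _; rewrite expfz_neq0. Qed.

Lemma in_torus_mon_map A z : in_torus z -> in_torus (mon_map A z).
Proof. by move=> tz i; rewrite mxE monom_neq0. Qed.

Lemma prod_exprz (I : finType) (x : I -> C) (n : int) :
  (\prod_i x i) ^ n = \prod_i x i ^ n.
Proof. by elim/big_rec2: _ => [|i y u _ <-]; rewrite ?exp1rz ?expfzMl. Qed.

Lemma monom_mon_map A z a : in_torus z -> monom (mon_map A z) a = monom z (a *m A).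
Proof.
move=> tz; rewrite /monom.
have zu i : z 0 i \is a GRing.unit by rewrite unitfE.
under eq_bigr => i _.
  rewrite mxE /monom prod_exprz.
  under eq_bigr do rewrite exprz_exp.
  over.
rewrite exchange_big; apply: eq_bigr => j _ /=.
rewrite mxE; elim/big_rec2: _ => [|i y x _ ->]; first by rewrite expr0z.
by rewrite mxE exprzDr// mulrC (mulrC (A i j)) mulrC.
Qed.

Lemma mon_map_comp A B z : in_torus z -> mon_map B (mon_map A z) = mon_map (B *m A) z.
Proof. by move=> tz; apply/rowP => i; rewrite !mxE monom_mon_map// row_mul. Qed.

Lemma mon_map1 z : mon_map 1%:M z = z.
Proof.
apply/rowP => i; rewrite mxE /monom (bigD1 i)//= big1 => [|j ji].
  by rewrite !mxE eqxx mulr1 -exprnP expr1.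
by rewrite !mxE eq_sym (negbTE ji) expr0z.
Qed.

Lemma logabs2_mon_map B z : in_torus z ->
  logabs2 (mon_map B z) = logabs2 z *m (realmx B)^T :> vec.
Proof.
move=> tz; apply/rowP => i; rewrite rowdot mxE mxE abs2_monom_torus// expRK.
by rewrite -realv_row.
Qed.

(** The moduli |eta_i| when r_i = log|eta_i|^2. *)
Definition exph (r : vec) : vec := \row_i expR (r 0 i / 2).
Definition cabs z : vec := \row_i Num.sqrt (abs2 (z 0 i)).

Lemma cabs_torus z : in_torus z -> cabs z = exph (logabs2 z).
Proof.
move=> tz; apply/rowP => i; rewrite !mxE.
rewrite [X in Num.sqrt X](_ : _ = expR (ln (abs2 (z 0 i)) / 2) ^+ 2).
  by rewrite sqrtr_sqr ger0_norm ?expR_ge0.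
by rewrite -expRM_natl mulrC divfK// lnK// posrE abs2_gt0.
Qed.

Lemma in_torus_cexp (p : vec * vec) : in_torus (cexp p).
Proof.
move=> i; rewrite mxE -abs2_gt0 /abs2 /= !exprMn -mulrDr cos2Dsin2 mulr1.
by rewrite exprn_gt0// expR_gt0.
Qed.

Lemma logabs2_cexp (p : vec * vec) : logabs2 (cexp p) = 2 *: p.1.
Proof.
apply/rowP => i; rewrite !mxE /abs2 /= !exprMn -mulrDr cos2Dsin2 mulr1.
by rewrite -expRM_natl expRK.
Qed.

Section Metric.
Variables (P : set vec) (h : toric_metric P).
Implicit Types c : vframe m.

(** In the chart the torus acts by [mon_map (fedge c) tau]. As the edge matrix is invertible over
    the integers, every coordinatewise rotation s arises in this way, from tau = s^(B^-1). *)
Lemma norm_v_abs c (z z' : 'rV[C]_m) : is_vframe P c ->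
  (forall i, abs2 (z 0 i) = abs2 (z' 0 i)) -> norm_v h c z = norm_v h c z'.
Proof.
move=> Pc E.
pose s : 'rV[C]_m := \row_i (if z 0 i == 0 then 1 else z' 0 i / z 0 i).
have s1 i : abs2 (s 0 i) = 1.
  rewrite mxE; case: ifPn => [_|z0]; first exact: abs2_1.
  by rewrite abs2M abs2V -E divff// abs2_eq0.
have ts : in_torus s by move=> i; rewrite -abs2_gt0 s1.
pose t := mon_map (invmx (fedge c)) s.
have t1 i : abs2 (t 0 i) = 1.
  by rewrite mxE abs2_monom big1// => j _; rewrite s1 exp1rz.
rewrite -(@norm_inv _ _ _ h c t z Pc t1); congr norm_v; apply/rowP => i.
have [_ Bu _] := Pc.
rewrite mon_map_comp// mulmxV// mon_map1 !mxE; case: ifPn => [/eqP z0|z0].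
  rewrite z0 mulr0; apply/esym/eqP; rewrite -abs2_eq0 -E z0; apply/eqP.
  by apply/eqP; rewrite abs2_eq0.
by rewrite divfK.
Qed.

Lemma norm_v_cabs c z : is_vframe P c -> norm_v h c z = norm_v h c (cvec (cabs z, 0)).
Proof.
by move=> Pc; apply: norm_v_abs => // i; rewrite !mxE abs2_real sqr_sqrtr ?abs2_ge0.
Qed.

(** The local potential -log|s_w|^2. In contrast to [phi] it is smooth across the vanishing of
    coordinates, which gives control up to the boundary. *)
Definition chart_potential c (q : vec * vec) : R := - ln (norm_v h c (cvec q)).

Lemma norm_e_torus c z : is_vframe P c -> in_torus z ->
  norm_e h z = norm_v h c (mon_map (fedge c) z) * expR (- dot (realv R (fvert c)) (logabs2 z)).
Proof.
move=> Pc tz; rewrite norm_compat// abs2_monom_torus// mulrAC -expRD subrr expR0.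
by rewrite mul1r.
Qed.

Lemma ln_norm_e c z : is_vframe P c -> in_torus z ->
  - ln (norm_e h z) = chart_potential c (exph (logabs2 z *m (realmx (fedge c))^T), 0)
     + dot (realv R (fvert c)) (logabs2 z).
Proof.
move=> Pc tz; rewrite (norm_e_torus Pc tz) lnM ?posrE ?expR_gt0 ?norm_pos//.
rewrite expRK opprD opprK /chart_potential; congr (- ln _ + _).
rewrite norm_v_cabs// cabs_torus ?logabs2_mon_map//; exact: in_torus_mon_map.
Qed.

Lemma phiE c (r : vec) : is_vframe P c ->
  phi h r = chart_potential c (exph (r *m (realmx (fedge c))^T), 0) + dot (realv R (fvert c)) r.
Proof.
move=> Pc; rewrite /phi (ln_norm_e Pc (in_torus_cexp _)) logabs2_cexp /=.
by rewrite scalerA divff// scale1r.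
Qed.

Lemma ln_norm_e_phi c z : is_vframe P c -> in_torus z ->
  - ln (norm_e h z) = phi h (logabs2 z).
Proof. by move=> Pc tz; rewrite (ln_norm_e Pc tz) (phiE _ Pc). Qed.

Lemma norm_e_gt0 c z : is_vframe P c -> in_torus z -> 0 < norm_e h z.
Proof.
by move=> Pc tz; rewrite (norm_e_torus Pc tz) mulr_gt0 ?expR_gt0 ?norm_pos.
Qed.

Lemma norm_eE c z : is_vframe P c -> in_torus z ->
  norm_e h z = expR (- phi h (logabs2 z)).
Proof.
by move=> Pc tz; rewrite -(ln_norm_e_phi Pc tz) opprK lnK// posrE (norm_e_gt0 Pc).
Qed.

End Metric.
End Torus.

Lemma continuous_pair0 (R : realType) (m : nat) (f : 'rV[R]_m * 'rV[R]_m -> R) :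
  continuous f -> continuous (fun x : 'rV[R]_m => f (x, 0)).
Proof.
move=> cf x; apply: (@cvg_comp _ _ _ (fun x : 'rV[R]_m => (x, 0 : 'rV[R]_m)) f) (cf (x, 0)).
exact: (@cvg_pair _ _ _ (nbhs x) (nbhs x) (nbhs (0 : 'rV[R]_m)) _ _ _ id (fun=> 0)
    (@cvg_id _ _) (cvg_cst _)).
Qed.

(** * Hessian of the potential in a chart *)

Section Smooth.
Context {R : realType} {m : nat}.
Local Notation vec := 'rV[R]_m.
Variables (P : set vec) (h : toric_metric P).
Variables (c : vframe m) (Pc : is_vframe P c).
Local Notation G := (chart_potential h c).
Local Notation N := (fun q => norm_v h c (cvec q)).

Lemma norm_smooth_chart : smooth N.
Proof. exact: norm_smooth. Qed.

Lemma norm_gt0_chart q : 0 < N q.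
Proof. exact: norm_pos. Qed.

Lemma N_cont : continuous N.
Proof. by have [] := norm_smooth_chart 0. Qed.

Lemma N_C1 : C1 N.
Proof.
move=> v; have [_ /(_ v)[Dv [cDv _]]] := norm_smooth_chart 1.
by split.
Qed.

Lemma N_C2 v : C1 ('D_v N).
Proof.
move=> u; have [_ /(_ v)[Dv [cDv /(_ u)[Du [cDu _]]]]] := norm_smooth_chart 2.
by split.
Qed.

Lemma is_derive_G q v : is_derive q v G (- ('D_v N q / N q)).
Proof.
apply/is_derive_lineP; rewrite /chart_potential.
have Df : is_derive (0 : R) 1 (fun s : R => N (s *: v + q)) ('D_v N q).
  by apply/(is_derive_lineP N q v _).1; apply: derivableP; case: (N_C1 v).
have Dl : is_derive (N (0 *: v + q)) 1 (@ln R) (N q)^-1.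
  by rewrite scale0r add0r; apply: is_derive1_ln; exact: norm_gt0_chart.
apply: (is_derive_eq (is_derive_oppfun (is_derive1_comp Dl Df))).
by rewrite mulrC.
Qed.

Lemma derive_G v : 'D_v G = fun q => - ('D_v N q / N q).
Proof. by apply/funext => q; have Dq := is_derive_G q v; exact: derive_val. Qed.

Lemma G_C1 : C1 G.
Proof.
move=> v; split=> [q|]; first by have := is_derive_G q v => ?; exact: ex_derive.
rewrite derive_G => q; apply: cvgN; apply: cvgM; first exact: (N_C1 v).2.
by apply: cvgV; [rewrite gt_eqF ?norm_gt0_chart|exact: N_cont].
Qed.

Lemma G_C2 v : C1 ('D_v G).
Proof.
move=> u.
have D q : is_derive q u ('D_v G)
    (- ('D_u ('D_v N) q / N q - 'D_v N q * 'D_u N q / N q ^+ 2)).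
  rewrite derive_G.
  have D1 : is_derive q u ('D_v N) ('D_u ('D_v N) q).
    by apply: derivableP; case: (N_C2 v u).
  have D2 : is_derive q u N ('D_u N q) by apply: derivableP; case: (N_C1 u).
  have Nq : N q != 0 by rewrite gt_eqF ?norm_gt0_chart.
  have D3 := is_derive_invfun Nq D2.
  have D4 := is_derive_mulfun D1 D3.
  apply: (is_derive_eq (is_derive_oppfun D4)).
  move: ('D_u ('D_v N) q) ('D_v N q) ('D_u N q) (N q) Nq => x1 x2 x3 x4 x40.
  by field.
split=> [q|]; first by have := D q => ?; exact: ex_derive.
have -> : 'D_u ('D_v G) = fun q => - ('D_u ('D_v N) q / N q - 'D_v N q * 'D_u N q / N q ^+ 2).
  by apply/funext => q; have Dq := D q; exact: derive_val.
move=> q; have Nq : N q != 0 by rewrite gt_eqF ?norm_gt0_chart.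
have cV : (N q)^-1 @[q --> q] --> (N q)^-1 by apply: cvgV => //; exact: N_cont.
apply: cvgN; apply: cvgB.
  by apply: cvgM => //; exact: (N_C2 v u).2.
apply: cvgM; first by apply: cvgM; [exact: (N_C1 v).2|exact: (N_C1 u).2].
apply: cvgV; first by rewrite sqrf_eq0.
by under eq_fun do rewrite expr2; rewrite expr2; apply: cvgM; exact: N_cont.
Qed.

Lemma G_cont : continuous G.
Proof.
move=> q; apply: cvgN; apply: (@cvg_comp _ _ _ N (@ln R)); first exact: N_cont.
by apply: continuous_ln; exact: norm_gt0_chart.
Qed.

Lemma G_abs (q q' : vec * vec) : (forall i, q.1 0 i ^+ 2 + q.2 0 i ^+ 2 = q'.1 0 i ^+ 2 + q'.2 0 i ^+ 2) ->
  G q = G q'.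
Proof.
move=> E; rewrite /chart_potential; congr (- ln _); apply: norm_v_abs => // i.
by rewrite !mxE /abs2 /= E.
Qed.

Definition cplx_basis (k : 'I_m + 'I_m) : vec * vec :=
  match k with inl j => dRe R j | inr j => dIm R j end.

Lemma cplx_basis_sum (f : 'I_m + 'I_m -> R) :
  \sum_k f k *: cplx_basis k = (\row_j f (inl j), \row_j f (inr j)).
Proof.
rewrite big_sumType/=.
have dec (g : 'I_m -> R) : \sum_j g j *: delta_mx 0 j = \row_j g j.
  by rewrite [RHS]row_sum_delta; apply: eq_bigr => j _; rewrite mxE.
rewrite -(dec (fun j => f (inl j))) -(dec (fun j => f (inr j))).
have sumL : \sum_j f (inl j) *: dRe R j = (\sum_j f (inl j) *: delta_mx 0 j, 0).
  elim/big_rec2: _ => [//|j y x _ ->]; congr pair => /=.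
  by rewrite scaler0 addr0.
have sumR : \sum_j f (inr j) *: dIm R j = (0, \sum_j f (inr j) *: delta_mx 0 j).
  elim/big_rec2: _ => [//|j y x _ ->]; congr pair => /=.
  by rewrite scaler0 addr0.
by rewrite sumL sumR; congr pair; rewrite /= ?addr0 ?add0r.
Qed.

Lemma sum_pick (k : 'I_m) (y : R) (f : 'I_m -> R) :
  \sum_j (if j == k then y else 0) * f j = y * f k.
Proof.
by rewrite (bigD1 k)//= eqxx big1 ?addr0// => i /negbTE ->; rewrite mul0r.
Qed.

(** G is constant when the k-th coordinate is rotated; this is its derivative at angle 0. *)
Lemma G_rot (q : vec * vec) k :
  q.1 0 k * 'D_(dIm R k) G q = q.2 0 k * 'D_(dRe R k) G q.
Proof.
pose a (i : 'I_m + 'I_m) (t : R) := match i with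
  | inl j => if j == k then q.1 0 k * cos t - q.2 0 k * sin t else q.1 0 j
  | inr j => if j == k then q.1 0 k * sin t + q.2 0 k * cos t else q.2 0 j end.
pose a' (i : 'I_m + 'I_m) := match i with
  | inl j => if j == k then - q.2 0 k else 0
  | inr j => if j == k then q.1 0 k else 0 end.
have Da i : is_derive (0 : R) 1 (a i) (a' i).
  have Ds := is_derive_sin (0 : R); have Dc := is_derive_cos (0 : R).
  have K (u : R) := is_derive_cstfun u (0 : R) (1 : R).
  case: i => j /=; rewrite /a /a'; case: (j == k); try exact: is_derive_cstfun.
    apply: (is_derive_eq (is_derive_addfun (is_derive_mulfun (K _) Dc)
       (is_derive_oppfun (is_derive_mulfun (K _) Ds)))).
    by rewrite sin0 cos0; ring.
  apply: (is_derive_eq (is_derive_addfun (is_derive_mulfun (K _) Ds)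
       (is_derive_mulfun (K _) Dc))).
  by rewrite sin0 cos0; ring.
have DG := C1_chain cplx_basis G_C1 Da.
have cstE : (fun s => G (\sum_i a i s *: cplx_basis i)) = cst (G q).
  apply/funext => s /=; rewrite cplx_basis_sum; apply: G_abs => i.
  rewrite /= !mxE /a; case: eqP => // ->.
  have := cos2Dsin2 s; nra.
have pE : \sum_j a j 0 *: cplx_basis j = q.
  rewrite cplx_basis_sum; case: q @a @a' Da DG cstE => x y a a' _ _ _; congr pair.
    by apply/rowP => i; rewrite mxE /a /= cos0 sin0; case: eqP => // ->; ring.
  by apply/rowP => i; rewrite mxE /a /= cos0 sin0; case: eqP => // ->; ring.
rewrite cstE pE in DG.
have E0 : \sum_i a' i * 'D_(cplx_basis i) G q = 0.
  by rewrite -(@derive_val _ _ _ _ _ _ _ DG) derive_cst.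
rewrite big_sumType in E0.
have E1 := sum_pick k (- q.2 0 k) (fun j => 'D_(dRe R j) G q).
have E2 := sum_pick k (q.1 0 k) (fun j => 'D_(dIm R j) G q).
have {E0 E1 E2} : - q.2 0 k * 'D_(dRe R k) G q + q.1 0 k * 'D_(dIm R k) G q = 0.
  by rewrite -E1 -E2.
by rewrite mulNr addrC => /eqP; rewrite subr_eq0 => /eqP.
Qed.

(** Derivative of [G_rot] in the j-th imaginary direction at a real point. It expresses second
    angular derivatives through first radial ones. *)
Lemma G_rot2 (x : vec) j k :
  x 0 k * 'D_(dIm R j) ('D_(dIm R k) G) (x, 0) = (j == k)%:R * 'D_(dRe R k) G (x, 0).
Proof.
have D1 : is_derive (0 : R) 1 (fun s => x 0 k * 'D_(dIm R k) G (s *: dIm R j + (x, 0)))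
   (x 0 k * 'D_(dIm R j) ('D_(dIm R k) G) (x, 0)).
  have D : is_derive (0 : R) 1 (fun s => 'D_(dIm R k) G (s *: dIm R j + (x, 0)))
       ('D_(dIm R j) ('D_(dIm R k) G) (x, 0)).
    have Dj := (G_C2 (dIm R k) (dIm R j)).1 (x, 0).
    exact: (is_derive_lineP ('D_(dIm R k) G) (x, 0) (dIm R j) _).1 (derivableP Dj).
  apply: (is_derive_eq (is_derive_mulfun (is_derive_cstfun (x 0 k) (0 : R) 1) D)).
  by rewrite mulr0 addr0.
have D2 : is_derive (0 : R) 1
   (fun s => (s * (j == k)%:R) * 'D_(dRe R k) G (s *: dIm R j + (x, 0)))
   ((j == k)%:R * 'D_(dRe R k) G (x, 0)).
  have D : is_derive (0 : R) 1 (fun s => 'D_(dRe R k) G (s *: dIm R j + (x, 0)))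
       ('D_(dIm R j) ('D_(dRe R k) G) (x, 0)).
    have Dj := (G_C2 (dRe R k) (dIm R j)).1 (x, 0).
    exact: (is_derive_lineP ('D_(dRe R k) G) (x, 0) (dIm R j) _).1 (derivableP Dj).
  have Did := is_derive_mulfun (is_derive_id (0 : R) (1 : R)) (is_derive_cstfun (j == k)%:R (0 : R) 1).
  apply: (is_derive_eq (is_derive_mulfun Did D)).
  by rewrite scale0r add0r !(mul0r, add0r) mulr1 mulrC.
have E : (fun s => x 0 k * 'D_(dIm R k) G (s *: dIm R j + (x, 0))) =
         (fun s => (s * (j == k)%:R) * 'D_(dRe R k) G (s *: dIm R j + (x, 0))).
  apply/funext => s; have := G_rot (s *: dIm R j + (x, 0)) k.
  by rewrite /= scaler0 add0r addr0 !mxE eqxx/= (eq_sym k j).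
rewrite E in D1.
by rewrite -(@derive_val _ _ _ _ _ _ _ D1) (@derive_val _ _ _ _ _ _ _ D2).
Qed.

(** Four times the real part of the Levi matrix of G at the real point x. *)
Definition hessM (x : vec) : 'M[R]_m := \matrix_(j, k)
  ('D_(dRe R j) ('D_(dRe R k) G) (x, 0) + 'D_(dIm R j) ('D_(dIm R k) G) (x, 0)).

Lemma re_herm (a b x y : R) :
  complex.Re (Complex (x / 4) y * real_complex R a * conjc (real_complex R b)) =
  4^-1 * (a * b * x).
Proof. by rewrite /=; field. Qed.

Lemma hessM_pos (x u : vec) : u != 0 ->
  0 < \sum_j \sum_k u 0 j * u 0 k * hessM x j k.
Proof.
move=> u0; have := @norm_curv _ _ _ h c (x, 0) Pc (map_mx (real_complex R) u).
rewrite map_mx_eq0 => /(_ u0).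
set S := \sum_j _; move=> S0.
have : 0 < complex.Re S by move: S0; rewrite ltcE => /andP[].
have -> : complex.Re S = 4^-1 * \sum_j \sum_k u 0 j * u 0 k * hessM x j k.
  rewrite /S mulr_sumr raddf_sum; apply: eq_bigr => j _.
  rewrite mulr_sumr raddf_sum; apply: eq_bigr => k _.
  rewrite !mxE; exact: re_herm.
by rewrite pmulr_rgt0.
Qed.

Definition expscale (a r : vec) : vec := \row_i (a 0 i * expR (r 0 i / 2)).

Lemma is_derive_expaff (A v r : R) :
  is_derive (0 : R) 1 (fun s => A * expR ((s * v + r) / 2)) (2^-1 * (v * (A * expR (r / 2)))).
Proof.
have K (u : R) := is_derive_cstfun u (0 : R) (1 : R).
have Di := is_derive_mulfun (is_derive_addfun (is_derive_mulfun (is_derive_id (0 : R) (1 : R)) (K v)) (K r)) (K 2^-1).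
have De := is_derive_expR ((0 * v + r) / 2).
have D : is_derive (0 : R) 1 (fun s => A * expR ((s * v + r) / 2)) _ :=
  is_derive_mulfun (K A) (is_derive1_comp (f := expR) (g := fun y : R => (y * v + r) / 2) De Di).
by apply: (is_derive_eq D); rewrite mul0r add0r; ring.
Qed.

Lemma is_derive_expscale (f : vec * vec -> R) (a r v : vec) : C1 f ->
  is_derive r v (fun r => f (expscale a r, 0))
    (2^-1 * \sum_i v 0 i * expscale a r 0 i * 'D_(dRe R i) f (expscale a r, 0)).
Proof.
move=> Cf; apply/is_derive_lineP.
pose b (k : 'I_m + 'I_m) (s : R) := if k is inl j then a 0 j * expR ((s * v 0 j + r 0 j) / 2) else 0.
pose b' (k : 'I_m + 'I_m) := if k is inl j then 2^-1 * (v 0 j * expscale a r 0 j) else 0.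
have Db k : is_derive (0 : R) 1 (b k) (b' k).
  case: k => j /=; last exact: is_derive_cstfun.
  by rewrite mxE; exact: is_derive_expaff.
have := C1_chain cplx_basis Cf Db.
have E s : \sum_i b i s *: cplx_basis i = (expscale a (s *: v + r), 0).
  rewrite cplx_basis_sum; congr pair; apply/rowP => i; rewrite !mxE//.
under eq_fun do rewrite E.
rewrite E scale0r add0r => D; apply: (is_derive_eq D).
rewrite big_sumType/= [X in _ + X]big1 ?addr0; last by move=> i _; rewrite mul0r.
by rewrite mulr_sumr; apply: eq_bigr => i _; rewrite -(mulrA 2^-1).
Qed.

(** The potential in logarithmic coordinates. Zero entries of [a] switch coordinates off and so
    restrict it to a boundary orbit, the formal value r_i = -oo. *)
Definition Psi (a r : vec) : R := G (expscale a r, 0).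

Definition dPsi (a v r : vec) : R :=
  2^-1 * \sum_i v 0 i * expscale a r 0 i * 'D_(dRe R i) G (expscale a r, 0).

Definition ddPsi (a u v r : vec) : R :=
  4^-1 * \sum_l \sum_i (u 0 l * expscale a r 0 l) * (v 0 i * expscale a r 0 i) * hessM (expscale a r) l i.

Lemma is_derive_Psi a v r : is_derive r v (Psi a) (dPsi a v r).
Proof. exact: (is_derive_expscale a r v G_C1). Qed.

(** Differentiating through e^(r/2) twice produces a first-order term beside the radial second
    derivatives A. By [rot], an instance of [G_rot2], that term is the contribution of the angular
    second derivatives B, and A + B is the matrix known to be positive. *)
Lemma hess_sum (v u s g : 'I_m -> R) (A B : 'I_m -> 'I_m -> R) :
  (forall l i, s i * B l i = (l == i)%:R * g i) ->
  2^-1 * \sum_i ((v i * s i) * (2^-1 * \sum_l u l * s l * A l i) +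
                 g i * (2^-1 * (v i * u i * s i))) =
  4^-1 * \sum_l \sum_i (u l * s l) * (v i * s i) * (A l i + B l i).
Proof.
move=> rot; rewrite exchange_big/= !mulr_sumr; apply: eq_bigr => i _.
have -> : \sum_l u l * s l * (v i * s i) * (A l i + B l i) =
    (v i * s i) * (\sum_l u l * s l * A l i) + g i * (v i * u i * s i).
  rewrite mulr_sumr -[g i * _]mulr1 -(sum_pick i (g i * (v i * u i * s i)) (fun=> 1)) -big_split/=.
  apply: eq_bigr => l _; rewrite mulr1.
  have := rot l i; case: eqP => [->|_]; rewrite ?mul1r ?mul0r => E.
    by rewrite -E; ring.
  by rewrite addr0 -[RHS]addr0 -(mulr0 (u l * s l * v i)) -E; ring.
by field.
Qed.

Lemma is_derive_dPsi a u v r : is_derive r u (dPsi a v) (ddPsi a u v r).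
Proof.
rewrite /dPsi.
have D1 i : is_derive r u (fun r => v 0 i * expscale a r 0 i) (2^-1 * (v 0 i * u 0 i * expscale a r 0 i)).
  apply/is_derive_lineP.
  rewrite (_ : (fun _ => _) = fun s => v 0 i * a 0 i * expR ((s * u 0 i + r 0 i) / 2)); last first.
    by apply/funext => s; rewrite !mxE mulrA.
  apply: (is_derive_eq (is_derive_expaff _ _ _)).
  by rewrite mxE; ring.
have D2 i := is_derive_expscale a r u (G_C2 (dRe R i)).
have D3 i := is_derive_mulfun (D1 i) (D2 i).
have D4 := is_derive_mulfun (is_derive_cstfun 2^-1 r u) (is_derive_sumfun (index_enum 'I_m) D3).
apply: (is_derive_eq D4).
rewrite mulr0 addr0 /ddPsi.
pose S (i : 'I_m) : R := expscale a r 0 i.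
pose A (l i : 'I_m) : R := 'D_(dRe R l) ('D_(dRe R i) G) (expscale a r, 0).
pose B (l i : 'I_m) : R := 'D_(dIm R l) ('D_(dIm R i) G) (expscale a r, 0).
pose g (i : 'I_m) : R := 'D_(dRe R i) G (expscale a r, 0).
have rot l i : S i * B l i = (l == i)%:R * g i by exact: G_rot2.
have := hess_sum (fun i => v 0 i) (fun i => u 0 i) A rot.
rewrite /A /B /g /S => E; rewrite E; congr (_ * _).
by apply: eq_bigr => l _; apply: eq_bigr => i _; rewrite [hessM _ _ _]mxE.
Qed.

End Smooth.

(** * Volume density *)

Section Det.
Context {R : realType} {m : nat}.

Lemma quadE (A : 'M[R]_m) (u : 'rV[R]_m) :
  (u *m A *m u^T) 0 0 = \sum_j \sum_k u 0 j * u 0 k * A j k.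
Proof.
rewrite mxE; under eq_bigr do rewrite mxE mulr_suml.
rewrite exchange_big; apply: eq_bigr => j _; apply: eq_bigr => k _.
by rewrite !mxE mulrAC.
Qed.

(** The form stays positive along (1 - t) I + t A, so the determinant, a polynomial in t equal to 1
    at t = 0, has no zero on [0, 1]. The argument works with the quadratic form alone, whereas
    symmetry of [hessM] would require commuting partial derivatives. *)
Lemma det_pos (A : 'M[R]_m) :
  (forall u : 'rV[R]_m, u != 0 -> 0 < \sum_j \sum_k u 0 j * u 0 k * A j k) ->
  0 < \det A.
Proof.
move=> Apos; pose At (t : R) := (1 - t) *: 1%:M + t *: A.
have At_pos t : 0 <= t -> t <= 1 -> \det (At t) != 0.
  move=> t0 t1; apply/negP => /det0P[u u0 uA].
  have : (u *m At t *m u^T) 0 0 = 0 by rewrite uA mul0mx mxE.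
  rewrite /At mulmxDr mulmxDl -!scalemxAr -!scalemxAl mulmx1 !mxE.
  rewrite -/(dot u u) => E.
  have u2 : 0 < \sum_j u 0 j * u^T j 0.
    rewrite lt_neqAle eq_sym; apply/andP; split; last first.
      by apply: sumr_ge0 => j _; rewrite mxE -expr2 sqr_ge0.
    apply: contra u0 => /eqP/psumr_eq0P H; apply/eqP/rowP => j; rewrite mxE.
    have := H _ j isT; rewrite mxE => {}H; apply/eqP; rewrite -sqrf_eq0 expr2; apply/eqP/H.
    by move=> k _; rewrite mxE -expr2 sqr_ge0.
  have := Apos u u0; rewrite -quadE => uAu.
  have : 0 < (1 - t) * (\sum_j u 0 j * u^T j 0) + t * (u *m A *m u^T) 0 0.
    have [->|tn0] := eqVneq t 0; first by rewrite mul0r addr0 subr0 mul1r.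
    by rewrite ltr_wpDl ?mulr_ge0 ?mulr_gt0 ?subr_ge0 ?(ltW u2)// lt_neqAle eq_sym tn0.
  by rewrite [X in _ + t * X]mxE E ltxx.
pose p : {poly R} := \det (\matrix_(i, j) ((1%:M i j)%:P + (A i j - 1%:M i j)%:P * 'X)).
have pE t : p.[t] = \det (At t).
  rewrite /p -[_.[t]]/(horner_eval t _) -det_map_mx; congr (\det _).
  apply/matrixP => i j; rewrite !mxE /= /horner_eval !(hornerE, hornerMX).
  by ring.
rewrite ltNge; apply/negP => A0.
have [|t] := @poly_ivt _ (- p) 0 1 ler01.
  rewrite !hornerN !pE /At subr0 !scale1r scale0r addr0 subrr scale0r add0r det1.
  by rewrite lerN10 oppr_ge0.
move=> /andP[t0 t1]; rewrite rootE hornerN pE oppr_eq0.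
by apply/negP; exact: At_pos.
Qed.

End Det.

Section Vol.
Context {R : realType} {m : nat}.
Local Notation vec := 'rV[R]_m.
Variables (P : set vec) (h : toric_metric P).
Variables (c : vframe m) (Pc : is_vframe P c).
Local Notation G := (chart_potential h c).
Local Notation B := (realmx (fedge c) : 'M[R]_m).
Local Notation w := (realv R (fvert c)).

Lemma expscale1 r : expscale (const_mx 1) r = exph r :> vec.
Proof. by apply/rowP => i; rewrite !mxE mul1r. Qed.

Lemma phi_Psi (r : vec) : phi h r = Psi h c (const_mx 1) (r *m B^T) + dot w r.
Proof. by rewrite (phiE h r Pc) /Psi expscale1. Qed.

Definition dphi (v r : vec) : R := dPsi h c (const_mx 1) (v *m B^T) (r *m B^T) + dot w v.

Lemma is_derive_dot (x r v : vec) : is_derive r v (dot x) (dot x v).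
Proof.
rewrite /dot; apply: is_derive_sumfun => i.
apply: (is_derive_eq (is_derive_mulfun (is_derive_cstfun (x 0 i) r v) (df := 0) (dg := v 0 i) _)).
  apply/is_derive_lineP; under eq_fun do rewrite !mxE.
  apply: (is_derive_eq (is_derive_addfun (is_derive_mulfun (is_derive_id (0 : R) (1 : R))
    (is_derive_cstfun (v 0 i) (0 : R) (1 : R))) (is_derive_cstfun (r 0 i) (0 : R) (1 : R)))).
  by rewrite mulr0 add0r mulr1 addr0.
by rewrite mulr0 addr0.
Qed.

Lemma is_derive_comp_lin (f : vec -> R) (A : 'M[R]_m) r v df :
  is_derive (r *m A) (v *m A) f df -> is_derive r v (fun r => f (r *m A)) df.
Proof.
move=> /is_derive_lineP D; apply/is_derive_lineP.
by under eq_fun do rewrite mulmxDl -scalemxAl.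
Qed.

Lemma is_derive_phi r v : is_derive r v (phi h) (dphi v r).
Proof.
have -> : phi h = fun r => Psi h c (const_mx 1) (r *m B^T) + dot w r.
  by apply/funext => x; exact: phi_Psi.
apply: is_derive_addfun; last exact: is_derive_dot.
by apply: (is_derive_comp_lin (f := Psi h c (const_mx 1))); exact: is_derive_Psi.
Qed.

Definition ddphi (u v r : vec) : R :=
  ddPsi h c (const_mx 1) (u *m B^T) (v *m B^T) (r *m B^T).

Lemma is_derive_dphi u v r : is_derive r u (dphi v) (ddphi u v r).
Proof.
apply: (is_derive_eq (is_derive_addfun (df := ddphi u v r) (dg := 0) _ _)); last by rewrite addr0.
  by apply: (is_derive_comp_lin (f := dPsi h c (const_mx 1) (v *m B^T))); exact: is_derive_dPsi.
Qed.

Local Notation ne := (fun q : vec * vec => - ln (norm_e h (cexp q))).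

Lemma neE : ne = fun q => phi h (2 *: q.1).
Proof.
by apply/funext => q; rewrite (ln_norm_e_phi h Pc) ?logabs2_cexp//; exact: in_torus_cexp.
Qed.

Lemma derive_fst (f : vec -> R) (q u : vec * vec) (df : R) :
  is_derive (2 *: q.1) (2 *: u.1) f df -> is_derive q u (fun q => f (2 *: q.1)) df.
Proof.
move=> /is_derive_lineP D; apply/is_derive_lineP.
rewrite (_ : (fun _ => _) = fun s : R => f (s *: (2 *: u.1) + 2 *: q.1))//.
by apply/funext => s /=; rewrite scalerDr scalerA mulrC -scalerA.
Qed.

Lemma derive_ne u : 'D_u ne = fun q => dphi (2 *: u.1) (2 *: q.1).
Proof.
apply/funext => q; rewrite neE.
have D := derive_fst (is_derive_phi (2 *: q.1) (2 *: u.1)).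
exact: derive_val.
Qed.

Lemma derive_ne2 u v q :
  'D_u ('D_v ne) q = ddphi (2 *: u.1) (2 *: v.1) (2 *: q.1).
Proof.
rewrite derive_ne.
have D := derive_fst (is_derive_dphi (2 *: u.1) (2 *: v.1) (2 *: q.1)).
exact: derive_val.
Qed.

Lemma ddphi_l0 v r : ddphi 0 v r = 0.
Proof.
rewrite /ddphi mul0mx /ddPsi big1 ?mulr0// => l _; rewrite big1// => i _.
by rewrite mxE !mul0r.
Qed.

Lemma ddphi_r0 v r : ddphi v 0 r = 0.
Proof.
rewrite /ddphi mul0mx /ddPsi big1 ?mulr0// => l _; rewrite big1// => i _.
by rewrite [in X in _ * X * _]mxE mul0r mulr0 mul0r.
Qed.

(** The chain rule for r = rho B^T: the Levi matrix of -log|e|^2 in the coordinates zeta, written in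
    terms of the chart. *)
Definition volmx (r : vec) : 'M[R]_m :=
  4^-1 *: (B^T *m diag_mx (exph r) *m hessM h c (exph r) *m diag_mx (exph r) *m B).

Lemma ddphi_delta j k r :
  ddphi (2 *: delta_mx 0 j) (2 *: delta_mx 0 k) r / 4 = volmx (r *m B^T) j k.
Proof.
rewrite /ddphi /volmx /ddPsi expscale1.
move: (hessM h c _) => M; move: (exph _) => x.
have rowE l j' : ((2 *: delta_mx 0 j' : vec) *m B^T) 0 l = 2 * B l j'.
  by rewrite -scalemxAl -rowE !mxE.
under eq_bigr => l _ do under eq_bigr => i _ do rewrite !rowE.
move: (B) => A; rewrite !mul_mx_diag [RHS]mxE [X in _ = _ * X]mxE.
rewrite mulrAC [4^-1 * 4^-1 * _]mulrC -[X in X * _]mulr1.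
rewrite exchange_big/= !mulr_suml mulr_sumr; apply: eq_bigr => i _.
rewrite mxE [(_ *m M) j i]mxE mulr_suml mulr_suml !mulr_sumr mulr_suml mulr_suml.
apply: eq_bigr => l _; rewrite !mxE.
by field.
Qed.

Lemma Complex_quarter (a b d e f : R) : a = f -> b = 0 -> d = 0 -> e = 0 ->
  Complex ((a + b) / 4) ((d - e) / 4) = real_complex R (f / 4).
Proof. by move=> -> -> -> ->; rewrite addr0 subrr mul0r. Qed.

(** -log|e|^2 does not depend on the angles, so all derivatives involving a direction [dIm] vanish
    and the Levi matrix is real. *)
Lemma levi_ne q : levi ne q = map_mx (real_complex R) (volmx ((2 *: q.1) *m B^T)).
Proof.
apply/matrixP => j k; rewrite [LHS]mxE [RHS]mxE -ddphi_delta.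
have z0 k' : 2 *: (dIm R k').1 = 0 :> vec by exact: scaler0.
have E1 := derive_ne2 (dRe R j) (dRe R k) q.
have E2 : 'D_(dIm R j) ('D_(dIm R k) ne) q = 0.
  by rewrite derive_ne2 [X in ddphi X _ _](z0 j) ddphi_l0.
have E3 : 'D_(dRe R j) ('D_(dIm R k) ne) q = 0.
  rewrite derive_ne2.
  move: (2 *: (dIm R k).1) (z0 k) => x0.
  move=> x00.
  rewrite x00.
  exact: ddphi_r0.
have E4 : 'D_(dIm R j) ('D_(dRe R k) ne) q = 0.
  by rewrite derive_ne2 [X in ddphi X _ _](z0 j) ddphi_l0.
exact: Complex_quarter E1 E2 E3 E4.
Qed.

Lemma vol_densityE q : vol_density h q =
  4^-1 ^+ m * \det B ^+ 2 * (\prod_i exph ((2 *: q.1) *m B^T) 0 i ^+ 2)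
    * \det (hessM h c (exph ((2 *: q.1) *m B^T))).
Proof.
rewrite /vol_density levi_ne det_map_mx /=.
rewrite /volmx detZ !det_mulmx det_tr det_diag prodrXl.
by move: (\prod_i _) (\det B) (\det _) => x y z; ring.
Qed.

Lemma detB_neq0 : \det B != 0.
Proof.
have : B \in unitmx by have /mulmx1_unit[] := realmxV Pc.
by rewrite unitmxE unitfE.
Qed.

Definition volc : R := 4^-1 ^+ m * \det B ^+ 2.

Lemma volc_gt0 : 0 < volc.
Proof.
apply: mulr_gt0; first by rewrite exprn_gt0.
by rewrite exprn_even_gt0//= detB_neq0.
Qed.

Lemma det_hessM_gt0 x : 0 < \det (hessM h c x).
Proof. by apply: det_pos => u u0; exact: hessM_pos. Qed.

Lemma prod_exph (r : vec) : \prod_i exph r 0 i ^+ 2 = expR (\sum_i r 0 i).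
Proof.
rewrite expR_sum; apply: eq_bigr => i _; rewrite mxE -expRM_natl.
by congr expR; field.
Qed.

(** The exponential is the product of the |eta_i|^2. On a closed polydisc the determinant is bounded
    above and away from zero, so this factor alone governs the decay at infinity. *)
Lemma vol_density_rho (rho theta : vec) : vol_density h (2^-1 *: rho, theta) =
  volc * expR (\sum_i (rho *m B^T) 0 i) * \det (hessM h c (exph (rho *m B^T))).
Proof.
rewrite vol_densityE.
have -> : 2 *: ((2^-1 *: rho, theta) : vec * vec).1 = rho.
  by rewrite /= scalerA divff// scale1r.
by rewrite prod_exph.
Qed.

Lemma det_hessM_cont : continuous (fun x => \det (hessM h c x)).
Proof.
have cent j k : continuous (fun x => hessM h c x j k).
  rewrite (_ : (fun _ => _) = fun x : vec => 'D_(dRe R j) ('D_(dRe R k) G) (x, 0)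
                            + 'D_(dIm R j) ('D_(dIm R k) G) (x, 0)); last first.
    by apply/funext => x; rewrite mxE.
  move=> x.
  have c1 := continuous_pair0 (f := 'D_(dRe R j) ('D_(dRe R k) G)) (G_C2 h Pc (dRe R k) (dRe R j)).2 (x := x).
  have c2 := continuous_pair0 (f := 'D_(dIm R j) ('D_(dIm R k) G)) (G_C2 h Pc (dIm R k) (dIm R j)).2 (x := x).
  exact: cvgD c1 c2.
rewrite /determinant; apply: continuous_bigsum => s x.
have cp := continuous_bigprod (s := index_enum 'I_m) (f := (fun i x => hessM h c x i (s i))) (fun i => cent i (s i)) (x := x).
exact: (cvgM (cvg_cst _) cp).
Qed.

End Vol.

(** * Uniform bounds in charts *)

Section Bounds.
Context {R : realType} {m : nat}.
Local Notation vec := 'rV[R]_m.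

(** One constant for all charts. The estimates below use a single [C] both as a bound and, inverted,
    as a rate or a size, so that they are monotone in [C]. *)
Lemma fin_bound (I : finType) (Q : I -> R -> Prop) :
  (forall i C C', 0 < C -> C <= C' -> Q i C -> Q i C') ->
  (forall i, exists2 C, 0 < C & Q i C) -> exists2 C, 0 < C & forall i, Q i C.
Proof.
move=> mono /fin_all_exists2[C C0 CQ].
exists (\big[Num.max/1]_i C i); first by rewrite (lt_le_trans ltr01)// bigmax_ge_id.
by move=> i; apply: mono (CQ i) => //; exact: le_bigmax.
Qed.

(** The moduli in a unit polydisc, enlarged beyond 1 because [chart_cell] moves points slightly out
    of the polydisc. *)
Definition cube : set vec := [set x | forall i, 0 <= x 0 i <= 2].

Lemma cube_compact : compact cube.
Proof.
have := @rV_compact R m (fun=> `[0, 2]%classic) (fun=> @segment_compact R 0 2).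
rewrite (_ : [set v | _] = cube)//; apply/seteqP; split=> x /= H i;
  by have := H i; rewrite ?in_itv.
Qed.

Lemma compact_unif (A : set vec) (f : vec -> R) : compact A -> continuous f ->
  forall e, 0 < e -> exists2 d, 0 < d &
    forall x y, A x -> A y -> (forall i, `|x 0 i - y 0 i| <= d) -> `|f x - f y| <= e.
Proof.
move=> cA cf e e0.
have norm_lt (x y : vec) (d : R) : 0 < d -> (forall i, `|x 0 i - y 0 i| <= d) -> `|x - y| <= d.
  move=> d0 H; rewrite [leLHS]/Num.Def.normr/= mx_normrE (bigmax_le _ (ltW d0))// => -[i j] _ /=.
  by rewrite !mxE !(ord1 i).
move/compact_near_coveringP : (cA) => /(_ R (0 : R)^'+
  (fun d x => forall y, A y -> (forall i, `|x 0 i - y 0 i| <= d) -> `|f x - f y| <= e)) H.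
have {H} [|d /= d0 dP] := H _.
  move=> x Ax; have e2 : 0 < e / 2 by rewrite divr_gt0.
  move/cvgrPdist_lt : (cf x) => /(_ _ e2) /nbhs_ballP[r /= r0 rP].
  exists (ball x (r / 2), [set d | 0 < d < r / 2]).
    split; first by apply: nbhsx_ballx; rewrite divr_gt0.
    exists (r / 2); first by rewrite /= divr_gt0.
    by move=> d /=; rewrite sub0r normrN => dr d0; rewrite d0/= (le_lt_trans (ler_norm _) dr).
  move=> [x' d] /= [xx' /andP[d0 dr]] y Ay yd.
  have r2 : r / 2 <= r by rewrite ler_pdivrMr// ler_peMr ?ltW// ltr1n.
  have h1 : `|f x - f x'| < e / 2 by apply: rP; exact: le_ball xx'.
  have h2 : `|f x - f y| < e / 2.
    apply: rP; move: xx'; rewrite -!ball_normE /= => xx'.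
    rewrite (_ : x - y = (x - x') + (x' - y)); last by rewrite addrA subrK.
    rewrite (le_lt_trans (ler_normD _ _))// [ltRHS]splitr ltr_leD//.
    exact: le_trans (norm_lt _ _ _ d0 yd) (ltW dr).
  rewrite (_ : f x' - f y = - (f x - f x') + (f x - f y)); last by ring.
  by rewrite (le_trans (ler_normD _ _))// normrN [leRHS]splitr lerD ?ltW.
exists (d / 2); first by rewrite divr_gt0.
move=> x y Ax Ay xy; apply: (dP (d / 2) _ _ x) => //=.
- by rewrite sub0r normrN gtr0_norm ?divr_gt0// ltr_pdivrMr// ltr_pMr// ltr1n.
- by rewrite divr_gt0.
Qed.

Section Chart.
Variables (P : set vec) (h : toric_metric P).
Variables (c : vframe m) (Pc : is_vframe P c).
Local Notation G := (chart_potential h c).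
Local Notation B := (realmx (fedge c) : 'M[R]_m).

Lemma G0_cont : continuous (fun x : vec => G (x, 0)).
Proof. by have H : continuous G := G_cont (h := h) Pc; exact: (continuous_pair0 H). Qed.

Lemma cube_bounded (f : vec -> R) : continuous f ->
  exists2 C, 0 < C & forall x, cube x -> `|f x| <= C.
Proof.
move=> cf; have cn : {within cube, continuous (fun x => `|f x|)}.
  by apply: continuous_subspaceT => x; exact: cvg_norm (cf x).
have c0 : cube !=set0 by exists 0 => i; rewrite mxE lexx ler0n.
have [x0 _ x0P] := EVT_max_rV c0 cube_compact cn.
exists (`|f x0| + 1); first by rewrite ltr_wpDl.
by move=> x Cx; rewrite (le_trans (x0P x _)) ?inE// lerDl.
Qed.

Lemma cube_lb (f : vec -> R) : continuous f -> (forall x, 0 < f x) ->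
  exists2 C, 0 < C & forall x, cube x -> C <= f x.
Proof.
move=> cf f0; have cn : {within cube, continuous f} by exact: continuous_subspaceT.
have c0 : cube !=set0 by exists 0 => i; rewrite mxE lexx ler0n.
have [x0 _ x0P] := EVT_min_rV c0 cube_compact cn.
by exists (f x0) => // x Cx; apply: x0P; rewrite inE.
Qed.

Lemma exph_cube (r : vec) : (forall i, r 0 i <= 0) -> cube (exph r).
Proof.
move=> r0 i; rewrite mxE expR_ge0/= (@le_trans _ _ 1) ?ler1n//.
by rewrite -[leRHS]expR0 ler_expR pmulr_lle0// invr_gt0.
Qed.

Lemma exphE (r : vec) i : exph r 0 i = expR (r 0 i / 2).
Proof. by rewrite mxE. Qed.

Lemma rho_r (r : vec) : (r *m B^T) *m (realmx (invmx (fedge c)))^T = r.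
Proof. by rewrite -mulmxA -trmx_mul (realmxVl Pc) trmx1 mulmx1. Qed.

Lemma r_rho (r : vec) : (r *m (realmx (invmx (fedge c)))^T) *m B^T = r.
Proof. by rewrite -mulmxA -trmx_mul (realmxV Pc) trmx1 mulmx1. Qed.

Lemma mulmx_bound (A : 'M[R]_m) (x : vec) (s : R) : (forall j, `|x 0 j| <= s) ->
  forall i, `|(x *m A) 0 i| <= s * \sum_i \sum_j `|A j i|.
Proof.
move=> xs i.
have s0 : forall j : 'I_m, 0 <= s by move=> j; rewrite (le_trans _ (xs j)).
rewrite mxE (le_trans (ler_norm_sum _ _ _))// [X in _ <= _ * X](bigD1 i)//= mulrDr ler_wpDr//.
  by rewrite mulr_ge0 ?(s0 i)// sumr_ge0// => j _; exact: sumr_ge0.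
by rewrite mulr_sumr; apply: ler_sum => j _; rewrite normrM ler_wpM2r.
Qed.

Lemma sum_norm_mulmx (A : 'M[R]_m) (x : vec) :
  \sum_i `|(x *m A) 0 i| <= (\sum_i \sum_j `|A j i|) * \sum_j `|x 0 j|.
Proof.
rewrite mulr_suml; apply: ler_sum => i _.
rewrite mxE (le_trans (ler_norm_sum _ _ _))// mulr_suml; apply: ler_sum => j _.
rewrite normrM mulrC ler_wpM2l// (bigD1 j)//= lerDl sumr_ge0//.
Qed.

Lemma chart_growth : exists2 C, 0 < C & forall rho : vec,
  (forall l, (rho *m B^T) 0 l <= 0) ->
  `|phi h rho - dot (realv R (fvert c)) rho| <= C.
Proof.
have [C C0 CP] := cube_bounded G0_cont; exists C => // rho r0.
by rewrite (phiE _ _ Pc) addrK; apply: CP; exact: exph_cube.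
Qed.

(** Where r <= 0, the factor exp(sum r_i) equals exp(-sum |r_i|), and the l^1 norm of rho is at most
    b times that of r, so the decay passes to rho. *)
Lemma chart_density : exists2 C, 0 < C & forall rho theta : vec,
  (forall l, (rho *m B^T) 0 l <= 0) ->
  vol_density h (2^-1 *: rho, theta) <= C * \prod_j expR (- C^-1 * `|rho 0 j|).
Proof.
have [C C0 CP] := cube_bounded (det_hessM_cont (h := h) Pc).
pose A := (realmx (invmx (fedge c)))^T : 'M[R]_m.
pose b := \sum_i \sum_j `|A j i|.
have b0 : 0 <= b by apply: sumr_ge0 => i _; exact: sumr_ge0.
pose K := Num.max (volc c * C) (b + 1).
have K0 : 0 < K by rewrite lt_max orbC ltr_wpDl.
exists K => // rho theta r0; rewrite (vol_density_rho h Pc).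
set r := rho *m B^T in r0 *.
have h1 : \det (hessM h c (exph r)) <= C.
  by rewrite (le_trans (ler_norm _))// CP//; exact: exph_cube.
have h2 : \sum_i r 0 i <= \sum_j - K^-1 * `|rho 0 j|.
  rewrite -mulr_sumr mulNr lerNr.
  have -> : - \sum_i r 0 i = \sum_i `|r 0 i|.
    by rewrite -sumrN; apply: eq_bigr => i _; rewrite ler0_norm.
  rewrite mulrC ler_pdivrMr// -(rho_r rho) -/r -/A.
  rewrite (le_trans (sum_norm_mulmx _ _))// -/b mulrC ler_wpM2l ?sumr_ge0//.
  by rewrite le_max (_ : b <= b + 1) ?orbT// lerDl.
rewrite -expR_sum mulrAC.
apply: ler_pM.
- by apply: mulr_ge0; apply: ltW; [exact: (volc_gt0 Pc)|exact: (det_hessM_gt0 h Pc)].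
- exact: expR_ge0.
- rewrite (@le_trans _ _ (volc c * C))// ?le_max ?lexx//.
  by rewrite ler_wpM2l// ltW// (volc_gt0 Pc).
- by rewrite ler_expR.
Qed.

Lemma density_gt0 rho theta : 0 < vol_density h (2^-1 *: rho, theta).
Proof.
rewrite (vol_density_rho h Pc) mulr_gt0 ?det_hessM_gt0//.
by rewrite mulr_gt0 ?expR_gt0// (volc_gt0 Pc).
Qed.

Lemma dot_sub_phi (y rho : vec) : dot y rho - phi h rho =
  dot (edge_coord c y) (rho *m B^T) - G (exph (rho *m B^T), 0).
Proof.
by rewrite (phiE _ _ Pc) (dot_edge _ _ Pc) [X in _ - X]addrC opprD addrACA subrr add0r.
Qed.

Lemma lerB_slack (a b g k e : R) : a <= b -> k - g <= e -> a - g - e <= b - k.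
Proof. by move=> *; lra. Qed.

(** Very negative coordinates of r are raised to 2 ln d, which keeps the density away from zero, and
    a small box is placed above the result. All coordinates only go up, so <y'', r> does not
    decrease because the edge coordinates of y are nonnegative; the moduli change by at most 2d, so
    G changes by at most e. *)
Lemma chart_cell (e : R) : 0 < e -> lattice_polytope P -> exists2 C, 0 < C &
  forall (y rho : vec), P y -> (forall l, (rho *m B^T) 0 l <= 0) ->
  exists rho' : vec, forall q : vec, (forall j, `|q 0 j - rho' 0 j| <= C^-1) ->
    dot y rho - phi h rho - e <= dot y q - phi h q /\
    forall theta, C^-1 <= vol_density h (2^-1 *: q, theta).
Proof.
move=> e0 Plat.
have [d0 d00 d0P] := compact_unif cube_compact G0_cont e0.
pose d := Num.min d0 1 / 2.
have dd : 0 < d by rewrite divr_gt0// lt_min d00 ltr01.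
have d1 : 2 * d <= d0 by rewrite /d mulrC divfK// ge_min lexx.
have d2 : 2 * d <= 1 by rewrite /d mulrC divfK// ge_min lexx orbT.
have [D D0 DP] := cube_lb (det_hessM_cont (h := h) Pc) (det_hessM_gt0 h Pc).
pose t := ln (1 + d); have t0 : 0 < t by rewrite ln_gt0// ltrDl.
have et : expR t = 1 + d by rewrite lnK// posrE ltr_wpDl.
pose b := \sum_i \sum_j `|B^T j i|.
have b0 : 0 <= b by apply: sumr_ge0 => i _; exact: sumr_ge0.
pose vl := volc c * expR (\sum_(i < m) (2 * ln d)) * D.
have vl0 : 0 < vl.
  by apply: mulr_gt0 => //; apply: mulr_gt0; [exact: (volc_gt0 Pc)|exact: expR_gt0].
pose C := Num.max ((b + 1) / t) vl^-1.
have C0 : 0 < C by rewrite lt_max invr_gt0 vl0 orbT.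
have Ct : C^-1 * b <= t.
  rewrite mulrC ler_pdivrMr//.
  apply: le_trans (_ : t * ((b + 1) / t) <= _); first by rewrite mulrC divfK ?gt_eqF// lerDl.
  by rewrite ler_wpM2l ?(ltW t0)// le_max lexx.
have Cv : C^-1 <= vl by rewrite invf_ple ?posrE// le_max lexx orbT.
(* The first entry of [C] makes the image in r-space of a box of half-side 1/C have half-side at
   most t; the second bounds the density from below. *)
exists C => // y rho Py r0; set r := rho *m B^T in r0.
pose M i := Num.max (r 0 i) (2 * ln d).
have ld0 : ln d < 0 by rewrite ln_lt0// dd/=; lra.
have M0 i : M i <= 0 by rewrite ge_max r0/=; lra.
pose r' : vec := \row_i (M i + t).
exists (r' *m (realmx (invmx (fedge c)))^T) => q qP.
set s := q *m B^T.
have sr i : M i <= s 0 i <= M i + 2 * t.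
  have : `|s 0 i - r' 0 i| <= t.
    have := @mulmx_bound B^T (q - r' *m (realmx (invmx (fedge c)))^T) C^-1 _ i.
    rewrite mulmxBl r_rho [X in `|X|]mxE [X in `|_ + X|]mxE -/s -/b => H.
    by apply: le_trans Ct; apply: H => j; rewrite !mxE; have := qP j; rewrite !mxE.
  by rewrite [r' 0 i]mxE ler_norml => /andP[H1 H2]; apply/andP; split; lra.
have lnd i : ln d <= s 0 i / 2.
  have /andP[H _] := sr i; have : 2 * ln d <= M i by rewrite le_max lexx orbT.
  by lra.
have rs i : r 0 i <= s 0 i.
  have /andP[H _] := sr i; apply: le_trans H; by rewrite le_max lexx.
have eM i : expR (M i / 2) <= 1 by rewrite -[leRHS]expR0 ler_expR; have := M0 i; lra.
have eMt i : expR (s 0 i / 2) <= expR (M i / 2) * (1 + d).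
  rewrite -et -expRD ler_expR; have /andP[_ H] := sr i; lra.
have eMr i : expR (M i / 2) <= expR (r 0 i / 2) + d.
  rewrite /M; case: (leP (r 0 i) (2 * ln d)) => _.
    by rewrite mulrC mulKf// lnK ?posrE// lerDr expR_ge0.
  by rewrite lerDl ltW.
have cs : cube (exph s).
  move=> i; rewrite exphE expR_ge0/= (le_trans (eMt i))//.
  have := eM i; have := expR_gt0 (M i / 2); nra.
have cr : cube (exph r) by exact: exph_cube.
split.
  have Gd : `|G (exph s, 0) - G (exph r, 0)| <= e.
    apply: d0P => // i; rewrite !exphE ger0_norm; last first.
      by rewrite subr_ge0 ler_expR ler_pM2r ?invr_gt0.
    have := eMt i; have := eM i; have := eMr i; have := expR_gt0 (M i / 2); nra.
  have xs : dot (edge_coord c y) r <= dot (edge_coord c y) s.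
    apply: ler_sum => i _; rewrite ler_wpM2l//.
    exact: edge_coord_ge0 Plat Pc Py i.
  move: Gd; rewrite ler_norml => /andP[_ Gd].
  rewrite (dot_sub_phi y rho) (dot_sub_phi y q).
  exact: lerB_slack xs Gd.
move=> theta; apply: le_trans Cv _; rewrite (vol_density_rho h Pc) /vl -/s.
have v0 := volc_gt0 Pc.
apply: ler_pM.
- by rewrite mulr_ge0// ?expR_ge0// ltW.
- exact: ltW.
- rewrite ler_pM2l// ler_expR; apply: ler_sum => i _.
  have := lnd i; lra.
- exact: DP.
Qed.

End Chart.
End Bounds.

(** * Bounds for the norms of monomial sections *)

Section IntPow.
Context {R : realType}.
Local Notation leb := (@lebesgue_measure R).

(** The integral of a nonnegative function is a supremum over simple functions below it, hence
    monotone without any measurability. This spares a proof that the slices of the iterated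
    integrals are measurable. *)
Lemma le_integral_nonneg (D : set R) (f g : R -> \bar R) :
  (forall x, D x -> (0 <= f x)%E) -> (forall x, D x -> (f x <= g x)%E) ->
  (\int[leb]_(x in D) f x <= \int[leb]_(x in D) g x)%E.
Proof.
move=> f0 fg.
have g0 x : D x -> (0 <= g x)%E by move=> Dx; exact: le_trans (f0 _ Dx) (fg _ Dx).
rewrite !ge0_integralE//; apply: ereal_sup_le => _ [k kf <-]; exists k => // x.
apply: le_trans (kf x) _; rewrite /patch; case: ifP => // xD.
by apply: fg; rewrite inE in xD.
Qed.

Lemma row_mx_entry n (x : R) (v : 'rV[R]_n) (i : 'I_n.+1) :
  (row_mx (const_mx x : 'rV[R]_1) v : 'rV[R]_(1 + n)) 0 i =
  if unlift ord0 i is Some j then v 0 j else x.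
Proof.
case: unliftP => [j|] ->.
  by rewrite (_ : lift ord0 j = rshift 1 j) ?row_mxEr//; exact: val_inj.
have -> : (ord0 : 'I_n.+1) = lshift n (ord0 : 'I_1) by exact: val_inj.
by rewrite row_mxEl mxE.
Qed.

(** Domination is checked slice by slice with [le_integral_nonneg]; measurability is asked only of
    the domain and of the one-variable majorant. *)
Lemma int_pow_ub (D : set R) (h : R -> R) (I : R) : measurable D ->
  measurable_fun D h -> (forall x, 0 <= h x) -> 0 <= I ->
  (\int[leb]_(x in D) (h x)%:E <= I%:E)%E ->
  forall n (f : 'rV[R]_n -> \bar R) (C : R), 0 <= C ->
  (forall v : 'rV[R]_n, (forall i, D (v 0 i)) ->
     (0 <= f v /\ f v <= (C * \prod_j h (v 0 j))%:E)%E) ->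
  (0 <= int_pow D f /\ int_pow D f <= (C * I ^+ n)%:E)%E.
Proof.
move=> mD mh h0 I0 hI; elim=> [|n IH] f C C0 fC.
  have [|f0 f1] := fC 0; first by case.
  by split=> //; move: f1; rewrite big_ord0 expr0.
have key x : D x -> (0 <= int_pow D (fun v : 'rV[R]_n => f (row_mx (const_mx x : 'rV[R]_1) v)) /\
   int_pow D (fun v : 'rV[R]_n => f (row_mx (const_mx x : 'rV[R]_1) v)) <= (C * h x * I ^+ n)%:E)%E.
  move=> Dx; apply: IH => [|v Dv]; first by rewrite mulr_ge0.
  have [i|f0 f1] := fC (row_mx (const_mx x : 'rV[R]_1) v).
    by rewrite row_mx_entry; case: unliftP.
  split=> //; apply: le_trans f1 _; rewrite lee_fin big_ord_recl row_mx_entry.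
  case: unliftP => // _; rewrite mulrA ler_wpM2l ?mulr_ge0//.
  apply: ler_prod => i _; rewrite h0/= row_mx_entry.
  by rewrite liftK.
rewrite /=; split; first by apply: integral_ge0 => x Dx; have [H _] := key x Dx; exact: H.
apply: (@le_trans _ _ (\int[leb]_(x in D) ((C * I ^+ n)%:E * (h x)%:E))%E).
  apply: le_integral_nonneg => x Dx; have [H1 H2] := key x Dx; first exact: H1.
  by move: H2; rewrite -EFinM mulrAC; exact.
rewrite ge0_integralZl//; last 3 first.
- exact/measurable_EFinP.
- by move=> x _; rewrite lee_fin.
- by rewrite lee_fin mulr_ge0// exprn_ge0.
rewrite exprSr mulrA [leRHS]EFinM lee_wpmul2l// lee_fin mulr_ge0// exprn_ge0//.
Qed.

Lemma int_pow_ge0 (D : set R) n (f : 'rV[R]_n -> \bar R) :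
  (forall v : 'rV[R]_n, (forall i, D (v 0 i)) -> (0 <= f v)%E) -> (0 <= int_pow D f)%E.
Proof.
elim: n f => [|n IH] f f0; first by apply: f0; case.
apply: integral_ge0 => x Dx; apply: IH => v Dv; apply: f0 => i.
by rewrite row_mx_entry; case: unliftP.
Qed.

Lemma int_pow_lb (D : set R) (s : R) : 0 < s ->
  forall n (f : 'rV[R]_n -> \bar R) (a : 'rV[R]_n) (C : R), 0 <= C ->
  (forall i, `[a 0 i - s, a 0 i + s] `<=` D) ->
  (forall v : 'rV[R]_n, (forall i, D (v 0 i)) -> (0 <= f v)%E) ->
  (forall v : 'rV[R]_n, (forall i, `|v 0 i - a 0 i| <= s) -> (C%:E <= f v)%E) ->
  (0 <= int_pow D f /\ (C * (2 * s) ^+ n)%:E <= int_pow D f)%E.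
Proof.
move=> s0; elim=> [|n IH] f a C C0 aD f0 fC.
  by split; [apply: f0; case|rewrite expr0 mulr1; apply: fC; case].
pose a' : 'rV[R]_n := \row_j a 0 (lift ord0 j).
have f0' x : D x -> forall v : 'rV[R]_n, (forall i, D (v 0 i)) ->
    (0 <= f (row_mx (const_mx x : 'rV[R]_1) v))%E.
  by move=> Dx v Dv; apply: f0 => i; rewrite row_mx_entry; case: unliftP.
have aD' i : `[a' 0 i - s, a' 0 i + s] `<=` D by rewrite mxE; exact: aD.
have key0 x : D x -> (0 <= int_pow D (fun v : 'rV[R]_n => f (row_mx (const_mx x : 'rV[R]_1) v)))%E.
  by move=> Dx; apply: int_pow_ge0; exact: f0'.
rewrite /=; split; first exact: integral_ge0.
have key x : `|x - a 0 ord0| <= s -> (((C * (2 * s) ^+ n)%:E <=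
    int_pow D (fun v : 'rV[R]_n => f (row_mx (const_mx x : 'rV[R]_1) v)))%E).
  move=> xa; have Dx : D x.
    apply: (aD ord0); rewrite /= in_itv/=; move: xa; rewrite ler_distl.
    by [].
  have [|_ H] := IH (fun v : 'rV[R]_n => f (row_mx (const_mx x : 'rV[R]_1) v)) a' C C0 aD' (f0' _ Dx); last exact: H.
  move=> v va; apply: fC => i; rewrite row_mx_entry; case: unliftP => [j ->|->//].
  by have := va j; rewrite mxE.
pose J : set R := `[a 0 ord0 - s, a 0 ord0 + s]%classic.
pose g x := (C * (2 * s) ^+ n * \1_J x)%:E.
apply: (@le_trans _ _ (\int[leb]_(x in D) g x)%E); last first.
  apply: le_integral_nonneg => x Dx.
    by rewrite lee_fin mulr_ge0// ?mulr_ge0// ?exprn_ge0// ?mulr_ge0// ltW.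
  rewrite /g indicE; case: (boolP (x \in J)) => [|_]; last by rewrite mulr0; exact: key0.
  rewrite inE mulr1 => Jx; apply: key.
  by move: Jx; rewrite /J /= in_itv/= ler_distl.
rewrite [leRHS](_ : _ = \int[leb]_(x in J) (C * (2 * s) ^+ n)%:E)%E; last first.
  rewrite integral_mkcond [RHS]integral_mkcond; apply: eq_integral => x _.
  rewrite /g /patch indicE; case: (boolP (x \in J)) => xJ; last by rewrite mulr0; case: ifP.
  rewrite mulr1 ifT//; apply/mem_set/(aD ord0); by rewrite inE in xJ.
rewrite integral_cst; last exact: measurable_itv.
have LJ : leb J = (2 * s)%:E.
  have := @lebesgue_measure_itv R `[a 0 ord0 - s, a 0 ord0 + s].
  rewrite /= lte_fin ifT; last by lra.
  by rewrite -EFinB => ->; congr EFin; ring.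
set X := (X in (_ <= _ * X)%E); have -> : X = (2 * s)%:E := LJ.
by rewrite -EFinM lee_fin exprSr mulrA.
Qed.

Lemma integral_exp_abs (k : R) : 0 < k ->
  exists2 I : R, 0 < I & (\int[leb]_x (expR (- k * `|x|))%:E <= I%:E)%E.
Proof.
move=> k0; exists (2 / k); first by rewrite divr_gt0.
rewrite ge0_symfun_integralT; last 3 first.
- by move=> x; exact: expR_ge0.
- move=> x; apply: (@continuous_comp _ _ _ (fun x : R => - k * `|x|) (@expR R)).
    by apply: cvgM; [exact: cvg_cst|exact: norm_continuous].
  exact: continuous_expR.
- by move=> x /=; rewrite normrN.
rewrite (_ : [set x | _] = `[0, +oo[%classic); last first.
  by apply/seteqP; split => x/=; rewrite in_itv/= andbT.
have E := integral_exponential_pdf k0.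
have E2 : (\int[leb]_(x in `[0%R, +oo[) (k * expR (- k * x))%:E = 1)%E.
  rewrite -E [LHS]integral_mkcond; apply: eq_integral => x _.
  by rewrite /exponential_pdf /patch; case: ifP.
rewrite (_ : (\int[leb]_(x in _) _)%E = (k^-1)%:E); first by rewrite -EFinM.
transitivity (\int[leb]_(x in `[0%R, +oo[) (k^-1%:E * (k * expR (- k * x))%:E))%E.
  apply: eq_integral => x; rewrite inE/= in_itv/= andbT => x0.
  by rewrite -EFinM mulrA mulVf ?gt_eqF// mul1r ger0_norm.
rewrite ge0_integralZl//; first by rewrite E2 mule1.
- apply/measurable_EFinP; apply: measurable_funTS.
  apply: continuous_measurable_fun => x; apply: cvgM; first exact: cvg_cst.
  apply: (@continuous_comp _ _ _ (fun x : R => - k * x) (@expR R)).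
    by apply: cvgM; [exact: cvg_cst|exact: cvg_id].
  exact: continuous_expR.
- by move=> x _; rewrite lee_fin mulr_ge0 ?expR_ge0 ?ltW.
- by rewrite lee_fin invr_ge0 ltW.
Qed.

End IntPow.

(** * The exponential rate of the norms *)

Section QBounds.
Context {R : realType} {m : nat}.
Local Notation vec := 'rV[R]_m.
Variables (P : set vec) (h : toric_metric P).
Hypothesis Pdel : delzant P.

Lemma frame_exists : exists c, is_vframe P c.
Proof.
have [N [c [cP /(_ 0)[i _]]]] := chart_cover Pdel.
by exists (c i).
Qed.

(** The maximizing vertex of [chart_cover] computes the support function of P, and in its chart
    [phi] is that linear form up to a bounded error. *)
Lemma phi_growth : exists2 C, 0 < C &
  (forall r y : vec, P y -> dot y r - phi h r <= C) /\
  (forall r : vec, exists2 y, P y & phi h r <= dot y r + C).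
Proof.
have [N [c [cP cover]]] := chart_cover Pdel.
have [C C0 CP] := @fin_bound R 'I_N (fun i C => forall rho : vec,
   (forall l, (rho *m (realmx (fedge (c i)))^T) 0 l <= 0) ->
  `|phi h rho - dot (realv R (fvert (c i))) rho| <= C)
  (fun i C C' _ CC' H rho r0 => le_trans (H rho r0) CC')
  (fun i => chart_growth h (cP i)).
exists C => //; split=> [r y Py|r]; have [i [imax r0]] := cover r;
  have := CP i r r0; rewrite ler_norml => /andP[H1 H2].
  by have := imax _ Py; lra.
by exists (realv R (fvert (c i))); [exact: vertex_in|lra].
Qed.

Lemma density_ub : exists2 C, 0 < C & forall rho theta : vec,
  vol_density h (2^-1 *: rho, theta) <= C * \prod_j expR (- C^-1 * `|rho 0 j|).
Proof.
have [N [c [cP cover]]] := chart_cover Pdel.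
have [||C C0 CP] := @fin_bound R 'I_N (fun i C => forall rho theta : vec,
   (forall l, (rho *m (realmx (fedge (c i)))^T) 0 l <= 0) ->
  vol_density h (2^-1 *: rho, theta) <= C * \prod_j expR (- C^-1 * `|rho 0 j|)).
- move=> i C C' C0 CC' H rho theta r0; apply: le_trans (H rho theta r0) _.
  have C'0 : 0 < C' by exact: lt_le_trans C0 CC'.
  apply: ler_pM => //; first exact: ltW.
    by apply: prodr_ge0 => j _; exact: expR_ge0.
  apply: ler_prod => j _; rewrite expR_ge0/= ler_expR ler_wpM2r// lerN2.
  by rewrite lef_pV2.
- by move=> i; exact: chart_density.
by exists C => // rho theta; have [i [_ r0]] := cover rho; exact: CP i _ _ r0.
Qed.

Lemma uniform_cell (e : R) : 0 < e -> exists2 C, 0 < C &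
  forall (y rho : vec), P y ->
  exists rho' : vec, forall q : vec, (forall j, `|q 0 j - rho' 0 j| <= C^-1) ->
    dot y rho - phi h rho - e <= dot y q - phi h q /\
    forall theta, C^-1 <= vol_density h (2^-1 *: q, theta).
Proof.
move=> e0; have [N [c [cP cover]]] := chart_cover Pdel.
have [||C C0 CP] := @fin_bound R 'I_N (fun i C => forall y rho : vec, P y ->
   (forall l, (rho *m (realmx (fedge (c i)))^T) 0 l <= 0) ->
  exists rho' : vec, forall q : vec, (forall j, `|q 0 j - rho' 0 j| <= C^-1) ->
    dot y rho - phi h rho - e <= dot y q - phi h q /\
    forall theta, C^-1 <= vol_density h (2^-1 *: q, theta)).
- move=> i C C' C0 CC' H y rho Py r0; have [rho' H'] := H y rho Py r0.
  have CC : C'^-1 <= C^-1 by rewrite lef_pV2// posrE (lt_le_trans C0).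
  exists rho' => q qP; have [j|H1 H2] := H' q; first exact: le_trans (qP j) CC.
  by split=> // theta; exact: le_trans CC (H2 theta).
- by move=> i; apply: chart_cell => //; case: Pdel.
by exists C => // y rho Py; have [i [_ r0]] := cover rho; exact: CP i _ _ Py r0.
Qed.

Lemma density_pos rho theta : 0 < vol_density h (2^-1 *: rho, theta).
Proof. by have [c Pc] := frame_exists; exact: density_gt0 Pc _ _. Qed.

Definition u0R (y : vec) : R := sup [set dot y r - phi h r | r in [set: vec]].

Lemma u0R_has_sup y : P y -> has_sup [set dot y r - phi h r | r in [set: vec]].
Proof.
move=> Py; split; first by exists (dot y 0 - phi h 0); exists 0.
have [C _ [H _]] := phi_growth; exists C => _ [r _ <-]; exact: H.
Qed.

Lemma u0R_ub y r : P y -> dot y r - phi h r <= u0R y.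
Proof. by move=> Py; apply: sup_upper_bound; [exact: u0R_has_sup|exists r]. Qed.

Lemma u0R_le y C : (forall r, dot y r - phi h r <= C) -> u0R y <= C.
Proof.
move=> H; apply: ge_sup; first by exists (dot y 0 - phi h 0); exists 0.
by move=> _ [r _ <-].
Qed.

Lemma u0R_adh y e : P y -> 0 < e -> exists r, u0R y - e < dot y r - phi h r.
Proof.
move=> Py e0; have [_ [r _ <-] H] := sup_adherent e0 (u0R_has_sup Py).
by exists r.
Qed.

Lemma u0E y : P y -> u0 h y = (u0R y)%:E.
Proof.
move=> Py; rewrite /u0 /u0R -ereal_sup_EFin.
- congr ereal_sup; apply/seteqP; split=> [_ [r _ <-]|_ [_ [r _ <-] <-]].
    by exists (dot y r - phi h r) => //; exists r.
  by exists r.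
- by case: (u0R_has_sup Py).
- by case: (u0R_has_sup Py).
Qed.

Lemma u0R_bounded : exists2 C, 0 < C & forall y, P y -> `|u0R y| <= C.
Proof.
have [C C0 [H _]] := phi_growth.
exists (Num.max C `|phi h 0|); first by rewrite lt_max C0.
move=> y Py; rewrite ler_norml; apply/andP; split.
  have := u0R_ub 0 Py; rewrite dotC dot0 sub0r; apply: le_trans.
  by rewrite lerN2 le_max ler_norm orbT.
by apply: u0R_le => r; rewrite (le_trans (H r y Py))// le_max lexx.
Qed.

Lemma u0R_convex x y (t : R) : P x -> P y -> 0 <= t -> t <= 1 ->
  u0R ((1 - t) *: x + t *: y) <= (1 - t) * u0R x + t * u0R y.
Proof.
move=> Px Py t0 t1; apply: u0R_le => r; rewrite dotD !dotZ.
have t1' : 0 <= 1 - t by rewrite subr_ge0.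
have H1 := ler_wpM2l t1' (u0R_ub r Px); have H2 := ler_wpM2l t0 (u0R_ub r Py).
apply: le_trans (lerD H1 H2).
by rewrite le_eqVlt; apply/orP; left; apply/eqP; ring.
Qed.

Lemma sect2_openE k (a : 'rV[int]_m) y (rho theta : vec) : realv R a = k%:R *: y ->
  sect2_open h k a (cexp (2^-1 *: rho, theta)) = expR (k%:R * (dot y rho - phi h rho)).
Proof.
move=> aE; have [c Pc] := frame_exists.
have L : logabs2 (cexp (2^-1 *: rho, theta)) = rho.
  by rewrite logabs2_cexp scalerA divff// scale1r.
rewrite /sect2_open abs2_monom_torus; last exact: in_torus_cexp.
rewrite (norm_eE h Pc); last exact: in_torus_cexp.
by rewrite L aE dotZ -expRM_natl -expRD mulrBr mulrN.
Qed.

Definition Qint k (a : 'rV[int]_m) : \bar R :=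
  int_pow setT (fun rho : vec =>
    int_pow `[0, 2 * pi] (fun theta : vec =>
      let zeta := (2^-1 *: rho, theta) in
      (sect2_open h k a (cexp zeta) * vol_density h zeta)%:E)).

(** The section is bounded pointwise by exp(k u_0(y)), by definition of the supremum; what is left
    is the integral of the volume density, which is independent of k and y. *)
Lemma Qint_ub : exists2 C, 0 < C & forall k (a : 'rV[int]_m) y, P y ->
  realv R a = k%:R *: y -> (0 <= Qint k a /\ Qint k a <= (C * expR (k%:R * u0R y))%:E)%E.
Proof.
have [D D0 DP] := density_ub.
have Di : 0 < D^-1 by rewrite invr_gt0.
have [I I0 IP] := integral_exp_abs Di.
have pi2 : 0 <= 2 * pi :> R by rewrite mulr_ge0// pi_ge0.
exists (D * (2 * pi) ^+ m * I ^+ m).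
  by rewrite !mulr_gt0// ?exprn_gt0// ?mulr_gt0// pi_gt0.
move=> k a y Py aE.
have -> : D * (2 * pi) ^+ m * I ^+ m * expR (k%:R * u0R y) =
  expR (k%:R * u0R y) * D * (2 * pi) ^+ m * I ^+ m by ring.
apply: (@int_pow_ub R setT (fun x => expR (- D^-1 * `|x|)) I) => //.
- apply: continuous_measurable_fun => x.
  apply: (@continuous_comp _ _ _ (fun x : R => - D^-1 * `|x|) (@expR R)).
    by apply: cvgM; [exact: cvg_cst|exact: norm_continuous].
  exact: continuous_expR.
- exact: (ltW I0).
- by rewrite mulr_ge0 ?exprn_ge0// mulr_ge0 ?expR_ge0// (ltW D0).
move=> rho _; set Pr := \prod_j _.
have Pr0 : 0 <= Pr by apply: prodr_ge0 => j _; exact: expR_ge0.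
have -> : expR (k%:R * u0R y) * D * (2 * pi) ^+ m * Pr =
  (expR (k%:R * u0R y) * (D * Pr)) * (2 * pi) ^+ m by ring.
apply: (@int_pow_ub R `[0, 2 * pi]%classic (fun=> 1) (2 * pi)) => //.
- rewrite integral_cst//= lebesgue_measure_itv/= lte_fin mulr_gt0 ?pi_gt0//.
  by rewrite mul1e -EFinB subr0.
- by rewrite mulr_ge0 ?expR_ge0// mulr_ge0// (ltW D0).
move=> theta _; rewrite big1 ?mulr1//.
have v0 := density_pos rho theta.
rewrite !lee_fin (sect2_openE _ _ aE); split; first by rewrite mulr_ge0 ?expR_ge0// ltW.
apply: ler_pM; rewrite ?expR_ge0 ?(ltW v0)//.
by rewrite ler_expR ler_wpM2l//; exact: u0R_ub.
Qed.

Lemma Qnorm_upper : exists2 C, 0 < C & forall k (a : 'rV[int]_m) y, P y ->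
  realv R a = k%:R *: y -> Qnorm h k a <= C * expR (k%:R * u0R y).
Proof.
have [C C0 CP] := Qint_ub; exists C => // k a y Py aE.
have [Q0 Q1] := CP k a y Py aE.
have Qf : Qint k a \is a fin_num by rewrite ge0_fin_numE// (le_lt_trans Q1)// ltry.
by rewrite -lee_fin fineK.
Qed.

(** One half of e is lost to a near-maximizer of <y, rho> - phi(rho), the other half to the box of
    [uniform_cell] on which the integrand is bounded below. *)
Lemma Qnorm_lower e : 0 < e -> exists2 c, 0 < c & forall k (a : 'rV[int]_m) y, P y ->
  realv R a = k%:R *: y -> c * expR (k%:R * (u0R y - e)) <= Qnorm h k a.
Proof.
move=> e0; have e2 : 0 < e / 2 by rewrite divr_gt0.
have [D D0 DP] := uniform_cell e2; have [C C0 CP] := Qint_ub.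
have Di : 0 < D^-1 by rewrite invr_gt0.
exists (D^-1 * (2 * pi) ^+ m * (2 * D^-1) ^+ m).
  by rewrite !mulr_gt0// exprn_gt0// mulr_gt0// pi_gt0.
move=> k a y Py aE; have [Q0 Q1] := CP k a y Py aE.
(* [fine] sends +oo to 0, so even a lower bound for [Qnorm] requires finiteness of the integral. *)
have Qf : Qint k a \is a fin_num by rewrite ge0_fin_numE// (le_lt_trans Q1)// ltry.
rewrite -lee_fin fineK//.
have [rs rsP] := u0R_adh Py e2; have [r' r'P] := DP y rs Py.
have E0 := expR_ge0 (k%:R * (u0R y - e)).
have dpos rho theta : 0 <= sect2_open h k a (cexp (2^-1 *: rho, theta)) *
    vol_density h (2^-1 *: rho, theta).
  by rewrite mulr_ge0 ?(ltW (density_pos _ _))// (sect2_openE _ _ aE) expR_ge0.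
have -> : D^-1 * (2 * pi) ^+ m * (2 * D^-1) ^+ m * expR (k%:R * (u0R y - e)) =
  (expR (k%:R * (u0R y - e)) * D^-1 * (2 * pi) ^+ m) * (2 * D^-1) ^+ m by ring.
rewrite /Qint.
apply: (fun a1 a2 a3 a4 => (@int_pow_lb R setT D^-1 Di m _ r'
    (expR (k%:R * (u0R y - e)) * D^-1 * (2 * pi) ^+ m) a1 a2 a3 a4).2).
- by apply: mulr_ge0; [apply: mulr_ge0 => //; exact: ltW|rewrite exprn_ge0// mulr_ge0// pi_ge0].
- by [].
- by move=> rho _; apply: int_pow_ge0 => theta _; rewrite lee_fin; exact: dpos.
move=> rho rhoP; have [H1 H2] := r'P rho rhoP.
have pi0 : 0 < pi :> R := pi_gt0 R.
apply: (fun a1 a2 a3 a4 => (@int_pow_lb R `[0, 2 * pi]%classic pi pi0 m _ (const_mx pi)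
    (expR (k%:R * (u0R y - e)) * D^-1) a1 a2 a3 a4).2).
- by apply: mulr_ge0 => //; exact: ltW.
- move=> i x; rewrite mxE /= !in_itv/= subrr => /andP[-> /=].
  by rewrite mulr_natl mulr2n.
- by move=> theta _; rewrite lee_fin; exact: dpos.
move=> theta _; rewrite lee_fin (sect2_openE _ _ aE); apply: ler_pM => //.
  exact: ltW.
by rewrite ler_expR ler_wpM2l//; lra.
Qed.

End QBounds.

(** * Approximation by lattice points *)

Section Simplex.
Context {R : realType} {N : nat}.
Local Notation vec := 'rV[R]_N.

Definition simplex : set vec := [set c | (forall i, 0 <= c 0 i) /\ \sum_i c 0 i = 1].

Lemma simplex_compact : compact simplex.
Proof.
have -> : simplex = [set c : vec | forall i, `[0, 1]%classic (c 0 i)] `&`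
    (fun c : vec => \sum_i c 0 i) @^-1` [set 1].
  apply/seteqP; split=> c /=.
    move=> [c0 c1]; split=> // i; rewrite in_itv/= c0/= -c1.
    by rewrite (bigD1 i)//= lerDl sumr_ge0.
  by move=> [cc c1]; split=> // i; have := cc i; rewrite in_itv/= => /andP[].
apply: (@subclosed_compact _ _ [set c : vec | forall i, `[0, 1]%classic (c 0 i)]); last by apply: subIsetl.
  apply: closedI.
    apply: compact_closed; first exact: norm_hausdorff.
    exact: (@rV_compact R N (fun=> `[0, 1]%classic) (fun=> @segment_compact R 0 1)).
  apply: (@preimage_closed _ _ (fun c : vec => \sum_i c 0 i)); last exact: closed_eq.
  move=> c _; apply: (continuous_bigsum (f := fun i (c : vec) => c 0 i)) => i.
  exact: coord_continuous.
exact: (@rV_compact R N (fun=> `[0, 1]%classic) (fun=> @segment_compact R 0 1)).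
Qed.

Variables (U : vec -> R) (C : R).
Hypothesis U_bd : forall x, simplex x -> `|U x| <= C.
Hypothesis U_convex : forall x y t, simplex x -> simplex y -> 0 <= t -> t <= 1 ->
  U ((1 - t) *: x + t *: y) <= (1 - t) * U x + t * U y.
Hypothesis U_lsc : forall x e, simplex x -> 0 < e -> exists2 d, 0 < d &
  forall y, simplex y -> (forall i, `|y 0 i - x 0 i| <= d) -> U x - e <= U y.

(* Every direction pointing from x into the simplex can be followed for a
   uniform amount of time, so convexity bounds U near x from above. *)
Lemma simplex_usc x e : simplex x -> 0 < e -> exists2 d, 0 < d &
  forall y, simplex y -> (forall i, `|y 0 i - x 0 i| <= d) -> U y <= U x + e.
Proof.
move=> Sx e0; have C0 : 0 <= C by exact: le_trans (normr_ge0 _) (U_bd Sx).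
(* Convexity gives U y <= U x + t (U p - U x), and the last difference is at most 2C. *)
pose t := Num.min 1 (e / (2 * C + 1)).
have C1 : 0 < 2 * C + 1 by rewrite ltr_wpDl// mulr_ge0.
have t0 : 0 < t by rewrite lt_min ltr01 divr_gt0.
have t1 : t <= 1 by rewrite ge_min lexx.
(* The minimum over the nonzero coordinates of x keeps p = x + (y - x) / t nonnegative; where x_i =
   0, p_i = y_i / t is nonnegative anyway. *)
pose d := t * \big[Num.min/1]_(i | x 0 i != 0) x 0 i.
have d0 : 0 < d.
  rewrite mulr_gt0//; apply: lt_bigmin => // i xi.
  by rewrite lt_neqAle eq_sym xi; case: Sx => ->.
exists d => // y Sy yd.
pose p : vec := x + t^-1 *: (y - x).
have yE : y = (1 - t) *: x + t *: p.
  rewrite /p scalerDr scalerA divff ?gt_eqF// scale1r addrA -scalerDl subrK scale1r.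
  by rewrite addrC subrK.
have Sp : simplex p.
  split=> [i|]; last first.
    under eq_bigr do rewrite !mxE.
    rewrite big_split/= -mulr_sumr sumrB; case: Sx Sy => [_ ->] [_ ->].
    by rewrite subrr mulr0 addr0.
  rewrite !mxE; have [xi0|xi] := eqVneq (x 0 i) 0.
    by rewrite xi0 add0r subr0 mulr_ge0 ?invr_ge0 ?(ltW t0)//; case: Sy.
  have := yd i; rewrite ler_norml => /andP[H _].
  have H2 : d <= t * x 0 i by rewrite ler_pM2l//; exact: bigmin_le_cond.
  rewrite -(ler_pM2l t0) mulr0 mulrDr mulrA divff ?gt_eqF// mul1r; lra.
rewrite yE; apply: le_trans (U_convex Sx Sp (ltW t0) t1) _.
have := U_bd Sx; have := U_bd Sp; rewrite !ler_norml => /andP[_ h1] /andP[h2 _].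
have : t * (2 * C + 1) <= e by rewrite -ler_pdivlMr// ge_min lexx orbT.
nra.
Qed.

(** Near a fixed center x both semicontinuities compare with U x, giving U y <= U x + e/2 <= U x' +
    e; compactness makes the radius independent of the center. *)
Lemma simplex_unif e : 0 < e -> exists2 d, 0 < d &
  forall x y, simplex x -> simplex y -> (forall i, `|y 0 i - x 0 i| <= d) -> U y <= U x + e.
Proof.
move=> e0; have e2 : 0 < e / 2 by rewrite divr_gt0.
have := simplex_compact => /compact_near_coveringP/near_covering_withinP.
move=> /(_ R (0 : R)^'+ (fun d x => forall y, simplex y ->
  (forall i, `|y 0 i - x 0 i| <= d) -> U y <= U x + e)) H.
have {H} [|d /= d0 dP] := H _.
  move=> x Sx; have [d1 d10 d1P] := simplex_usc Sx e2.
  have [d2 d20 d2P] := U_lsc Sx e2.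
  pose r := Num.min d1 d2; have r0 : 0 < r by rewrite lt_min d10.
  exists (ball x (r / 2), [set d | 0 < d < r / 2]).
    split; first by apply: nbhsx_ballx; rewrite divr_gt0.
    exists (r / 2); first by rewrite /= divr_gt0.
    by move=> d /=; rewrite sub0r normrN => dr d0; rewrite d0/= (le_lt_trans (ler_norm _) dr).
  move=> [x' d] /= [xx' /andP[d0 dr]] Sx' y Sy yd.
  have xx i : `|x' 0 i - x 0 i| <= r / 2.
    move: xx'; rewrite mx_norm_ball /ball_ /= => xx'.
    rewrite distrC; apply: le_trans (ltW xx').
    rewrite [leRHS]/Num.Def.normr/= mx_normrE.
    by apply: le_trans (le_bigmax _ _ (0, i)); rewrite /= !mxE.
  have r12 : r <= d1 /\ r <= d2 by rewrite /r !ge_min !lexx orbT.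
  have h1 : U y <= U x + e / 2.
    apply: d1P => // i; rewrite (_ : _ - _ = (y 0 i - x' 0 i) + (x' 0 i - x 0 i)); last by ring.
    rewrite (le_trans (ler_normD _ _))//; have := yd i; have := xx i; lra.
  have h2 : U x - e / 2 <= U x'.
    by apply: d2P => // i; have := xx i; lra.
  lra.
exists (d / 2); first by rewrite divr_gt0.
move=> x y Sx Sy xy; apply: (dP (d / 2) _ _ x) => //=.
- by rewrite sub0r normrN gtr0_norm ?divr_gt0// ltr_pdivrMr// ltr_pMr// ltr1n.
- by rewrite divr_gt0.
Qed.

End Simplex.

(** * Lattice points close to a given point of the polytope *)

Section Lattice.
Context {R : realType} {m : nat}.
Local Notation vec := 'rV[R]_m.
Variables (P : set vec) (h : toric_metric P).
Hypothesis Pdel : delzant P.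
Variables (n : nat) (v : 'I_n.+1 -> 'rV[int]_m).
Hypothesis PE : P = [set x | exists c : 'I_n.+1 -> R,
           [/\ forall i, 0 <= c i, \sum_i c i = 1
             & x = \sum_i c i *: realv R (v i)]].

Definition bary (c : 'rV[R]_n.+1) : vec := \sum_i c 0 i *: realv R (v i).

Lemma bary_in c : simplex c -> P (bary c).
Proof. by move=> [c0 c1]; rewrite PE; exists (c 0). Qed.

Lemma bary_surj y : P y -> exists2 c, simplex c & y = bary c.
Proof.
rewrite PE => -[c [c0 c1 ->]]; exists (\row_i c i).
  by split=> [i|]; [rewrite mxE|under eq_bigr do rewrite mxE].
by apply: eq_bigr => i _; rewrite mxE.
Qed.

Lemma bary_comb c d (t : R) : bary ((1 - t) *: c + t *: d) = (1 - t) *: bary c + t *: bary d.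
Proof.
rewrite /bary !scaler_sumr -big_split/=; apply: eq_bigr => i _.
by rewrite !mxE !scalerA -scalerDl.
Qed.

(** u_0 is pulled back to a simplex, where upper semicontinuity is elementary. Lower semicontinuity
    holds for a supremum of affine functions: test with a near-maximizer r. *)
Lemma u0R_bary_unif e : 0 < e -> exists2 d, 0 < d & forall c c', simplex c -> simplex c' ->
  (forall i, `|c' 0 i - c 0 i| <= d) -> u0R h (bary c') <= u0R h (bary c) + e.
Proof.
move=> e0; have [C C0 CP] := u0R_bounded h Pdel.
apply: (@simplex_unif R n.+1 (fun c => u0R h (bary c)) C) => //.
- by move=> x Sx; apply: CP; exact: bary_in.
- move=> x y t Sx Sy t0 t1; rewrite bary_comb; apply: u0R_convex => //; exact: bary_in.
move=> x {}e Sx {}e0; have e2 : 0 < e / 2 by rewrite divr_gt0.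
have [r rP] := u0R_adh h Pdel (bary_in Sx) e2.
pose A := \sum_i `|dot (realv R (v i)) r| + 1.
have A0 : 0 < A by rewrite ltr_wpDl// sumr_ge0.
exists (e / 2 / A); first by rewrite divr_gt0.
move=> y Sy yx /=; apply: le_trans (u0R_ub h Pdel r (bary_in Sy)).
have dE c : dot (bary c) r = \sum_i c 0 i * dot (realv R (v i)) r.
  by rewrite dot_sum; apply: eq_bigr => i _; rewrite dotZ.
have : `|dot (bary y) r - dot (bary x) r| <= e / 2.
  rewrite !dE -sumrB (le_trans (ler_norm_sum _ _ _))//.
  apply: le_trans (_ : \sum_i e / 2 / A * `|dot (realv R (v i)) r| <= _).
    by apply: ler_sum => i _; rewrite -mulrBl normrM ler_wpM2r.
  rewrite -mulr_sumr -mulrA ler_piMr ?(ltW e2)// mulrC ler_pdivrMr// mul1r /A.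
  by rewrite lerDl.
by rewrite ler_norml => /andP[H _] /=; move: rP H; rewrite /=; move: (dot _ r) (dot _ r) => *; lra.
Qed.

(** Round each k c_i down to nn_i. The s units lost in total are distributed among the vertices with
    the fractional parts, normalized to q, as weights. *)
Lemma lattice_split k (c : 'rV[R]_n.+1) : (0 < k)%N -> simplex c ->
  exists (nn : 'I_n.+1 -> nat) (s : nat) (q : 'I_n.+1 -> R),
   [/\ forall i, 0 <= q i, \sum_i q i = 1,
     (\sum_i nn i + s = k)%N, (s <= n.+1)%N &
     forall i, k%:R * c 0 i = (nn i)%:R + s%:R * q i /\ `|s%:R * q i| <= 1].
Proof.
move=> k0 [c0 c1]; have kR : 0 < k%:R :> R by rewrite ltr0n.
pose nn i := Num.truncn (k%:R * c 0 i).
pose q i := k%:R * c 0 i - (nn i)%:R.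
have q01 i : 0 <= q i <= 1.
  have := truncn_itv (mulr_ge0 (ltW kR) (c0 i)); rewrite -/(nn i) => /andP[h1 h2].
  rewrite /q subr_ge0 h1/= lerBlDl; apply: ltW; by rewrite -natr1 in h2.
have sumq : \sum_i q i = k%:R - (\sum_i nn i)%:R.
  by rewrite sumrB -mulr_sumr c1 mulr1 natr_sum.
have nk : (\sum_i nn i <= k)%N.
  rewrite -(ler_nat R) -subr_ge0 -sumq; apply: sumr_ge0 => i _.
  by have /andP[] := q01 i.
pose s := (k - \sum_i nn i)%N.
have sE : s%:R = \sum_i q i by rewrite sumq natrB.
have sn : (s <= n.+1)%N.
  rewrite -(ler_nat R) sE; apply: le_trans (_ : \sum_(i < n.+1) 1 <= _).
    by apply: ler_sum => i _; have /andP[] := q01 i.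
  by rewrite sumr_const card_ord.
(* Nothing was lost, so the fractional parts cannot be normalized; any probability vector will
   do. *)
have [s0|s0] := eqVneq s 0%N.
  exists nn, 0%N, (fun i => (i == ord0)%:R); split=> //.
  - by rewrite (bigD1 ord0)//= big1 ?addr0// => i /negbTE ->.
  - by rewrite addn0; apply/eqP; rewrite eqn_leq nk/= -subn_eq0 -/s s0.
  - move=> i; rewrite mul0r addr0 normr0 ler01; split=> //.
    have : \sum_i q i = 0 by rewrite -sE s0.
    move/psumr_eq0P => /(_ (fun i _ => proj1 (andP (q01 i))) i isT) /eqP.
    by rewrite subr_eq0 => /eqP.
have sR : 0 < s%:R :> R by rewrite ltr0n lt0n.
exists nn, s, (fun i => q i / s%:R); split=> //.
- by move=> i; rewrite divr_ge0//; have /andP[] := q01 i.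
- by rewrite -mulr_suml -sE divff ?gt_eqF.
- by rewrite /s subnKC.
- move=> i; have -> : s%:R * (q i / s%:R) = q i by rewrite mulrC divfK ?gt_eqF.
  rewrite [X in _ + X]/q addrC subrK; split=> //.
  by rewrite ger0_norm; have /andP[] := q01 i.
Qed.

Lemma edge_coord_sum c (I : finType) (q : I -> R) (y : I -> vec) : \sum_i q i = 1 ->
  edge_coord c (\sum_i q i *: y i) = \sum_i q i *: edge_coord c (y i).
Proof.
move=> q1; rewrite /edge_coord.
under [RHS]eq_bigr do rewrite scalemxAl scalerBr.
by rewrite -mulmx_suml sumrB -scaler_suml q1 scale1r.
Qed.

(** Giving all the s leftover units to one v_j yields points y_j that average to y with weights q_j.
    An edge coordinate vanishing at y vanishes at every y_j of positive weight, being an average of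
    nonnegative numbers, and some such y_j pairs with r at least as well as y does. Since that
    inequality is exact, [k0] does not depend on r. *)
Lemma lattice_approx e : 0 < e -> exists k0 : nat, forall k, (k0 <= k)%N -> (0 < k)%N ->
  forall (y : vec) c (r : vec), P y -> is_vframe P c ->
  exists a y', [/\ P y', realv R a = k%:R *: y', u0R h y' <= u0R h y + e,
    (forall i, `|y' 0 i - y 0 i| <= e) /\ dot (edge_coord c y) r <= dot (edge_coord c y') r
    & forall i, edge_coord c y 0 i = 0 -> edge_coord c y' 0 i = 0].
Proof.
move=> e0; have [d d0 dP] := u0R_bary_unif e0.
pose A := \sum_(i < n.+1) \sum_l `|realv R (v i) 0 l| + 1.
have A0 : 0 < A by rewrite ltr_wpDl// sumr_ge0// => i _; exact: sumr_ge0.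
pose dd := Num.min d (e / A).
have dd0 : 0 < dd by rewrite lt_min d0 divr_gt0.
(* A barycentric coordinate moves by at most (s + 1) / k, and s <= n + 1. *)
exists (Num.truncn ((n.+2)%:R / dd)).+1 => k kk k0 y c r Py Pc.
have kR : 0 < k%:R :> R by rewrite ltr0n.
have kd : (n.+2)%:R / k%:R <= dd.
  rewrite ler_pdivrMr// mulrC -ler_pdivrMr//.
  apply: le_trans (ltW (truncnS_gt _)) _.
  by rewrite ler_nat.
have [b Sb yE] := bary_surj Py.
have [nn [s [q [q0 q1 ns sn bE]]]] := lattice_split k0 Sb.
pose b' j : 'rV[R]_n.+1 := \row_i (((nn i)%:R + s%:R * (i == j)%:R) / k%:R).
have Sb' j : simplex (b' j).
  split=> [i|]; first by rewrite mxE divr_ge0// addr_ge0// mulr_ge0// ler0n.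
  under eq_bigr do rewrite mxE.
  rewrite -mulr_suml big_split/= -mulr_sumr.
  have -> : \sum_(i < n.+1) (i == j)%:R = 1 :> R.
    by rewrite (bigD1 j)//= eqxx big1 ?addr0// => i /negbTE ->.
  by rewrite mulr1 -natr_sum -natrD ns divff ?gt_eqF.
have bb j i : `|b' j 0 i - b 0 i| <= dd.
  apply: le_trans kd; rewrite mxE.
  have -> : b 0 i = ((nn i)%:R + s%:R * q i) / k%:R.
    by have [<- _] := bE i; rewrite mulrC mulKf ?gt_eqF.
  rewrite -mulrBl normrM [X in _ * X]ger0_norm ?invr_ge0 ?ler0n//.
  rewrite ler_pM2r ?invr_gt0// opprD addrACA subrr add0r.
  rewrite (le_trans (ler_normB _ _))// -natr1 lerD//.
    rewrite ger0_norm ?mulr_ge0 ?ler0n//; case: (i == j).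
      by rewrite mulr1 ler_nat.
    by rewrite mulr0 ler0n.
  by have [_] := bE i.
pose yy j := bary (b' j).
have yyE : y = \sum_j q j *: yy j.
  rewrite yE /yy /bary; under [RHS]eq_bigr do rewrite scaler_sumr.
  rewrite exchange_big/=; apply: eq_bigr => i _.
  under eq_bigr do rewrite scalerA.
  rewrite -scaler_suml; congr (_ *: _).
  apply: (mulfI (x := k%:R)); first by rewrite gt_eqF.
  have [-> _] := bE i; rewrite mulr_sumr.
  rewrite (eq_bigr (fun j => q j * (nn i)%:R + s%:R * (q j * (i == j)%:R))); last first.
    by move=> j _; rewrite mxE; field; rewrite gt_eqF.
  rewrite big_split/= -mulr_suml q1 mul1r -mulr_sumr (bigD1 i)//= eqxx big1 ?addr0 ?mulr1//.
  by move=> j /negbTE; rewrite eq_sym => ->; rewrite mulr0.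
have eE := edge_coord_sum c yy q1; rewrite -yyE in eE.
have Pyy j : P (yy j) by exact: bary_in.
have Plat : lattice_polytope P by case: Pdel.
have [j qj jmax] : exists2 j, 0 < q j & dot (edge_coord c y) r <= dot (edge_coord c (yy j)) r.
  apply: contrapT => H.
  have lt j : 0 < q j -> dot (edge_coord c (yy j)) r < dot (edge_coord c y) r.
    by move=> qj; rewrite ltNge; apply/negP => H'; apply: H; exists j.
  have [j qj] : exists j, 0 < q j.
    apply: contrapT => H'; have : \sum_j q j = 0.
      rewrite big1// => i _; apply/eqP; rewrite eq_le q0 andbT leNgt.
      by apply/negP => qi; apply: H'; exists i.
    by rewrite q1 => /eqP; rewrite oner_eq0.
  have : dot (edge_coord c y) r < dot (edge_coord c y) r.
    rewrite {1}eE dot_sum -[ltRHS]mul1r -q1 mulr_suml.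
    rewrite (bigD1 j)//= [ltRHS](bigD1 j)//= ltr_leD//.
      by rewrite dotZ ltr_pM2l// lt.
    apply: ler_sum => i _; rewrite dotZ.
    have := q0 i; rewrite le_eqVlt => /orP[/eqP <-|qi]; first by rewrite !mul0r.
    by rewrite ler_wpM2l// ltW// lt.
  by rewrite ltxx.
exists (\sum_i (v i *+ nn i) + v j *+ s), (yy j); split.
- exact: Pyy.
- rewrite /yy /bary scaler_sumr /realv raddfD/= raddf_sum/=.
  under eq_bigr do rewrite raddfMn/= -scaler_nat.
  rewrite raddfMn/= -scaler_nat.
  rewrite [RHS](eq_bigr (fun i => (nn i)%:R *: realv R (v i) +
     (s%:R * (i == j)%:R) *: realv R (v i))); last first.
    move=> i _; rewrite scalerA mxE -scalerDl; congr (_ *: _).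
    by rewrite mulrCA divff ?mulr1 // gt_eqF.
  rewrite big_split/=; congr (_ + _).
  rewrite (bigD1 j)//= eqxx mulr1 big1 ?addr0// => i /negbTE ->.
  by rewrite mulr0 scale0r.
- rewrite yE; apply: dP => // i; apply: le_trans (bb j i) _.
  by rewrite ge_min lexx.
- split=> // l; rewrite yE /yy /bary !summxE -sumrB.
  rewrite (le_trans (ler_norm_sum _ _ _))//.
  apply: le_trans (_ : \sum_i dd * `|realv R (v i) 0 l| <= _).
    apply: ler_sum => i _; rewrite ![(_ *: realv R (v i)) 0 l]mxE -mulrBl normrM.
    by rewrite ler_wpM2r.
  rewrite -mulr_sumr; apply: le_trans (_ : dd * A <= _).
    rewrite ler_wpM2l ?(ltW dd0)// /A -[leLHS]addr0 lerD// ?ler01//.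
    by apply: ler_sum => i _; rewrite (bigD1 l)//= lerDl sumr_ge0.
  by rewrite -ler_pdivlMr// ge_min lexx orbT.
- move=> l yl; have := congr1 (fun x : vec => x 0 l) eE; rewrite yl summxE => /esym/eqP.
  rewrite psumr_eq0; last first.
    by move=> i _; rewrite mxE mulr_ge0// (edge_coord_ge0 Plat Pc).
  move=> /allP/(_ j); rewrite mem_index_enum => /(_ isT) /=.
  by rewrite mxE mulf_eq0 gt_eqF//= => /eqP.
Qed.

End Lattice.

(** * Moment map and faces *)

Section OneDim.
Context {R : realType}.
Variables (k k' k'' : R -> R).
Hypothesis Dk : forall s : R, is_derive s 1 k (k' s).
Hypothesis Dk' : forall s : R, is_derive s 1 k' (k'' s).

Lemma MVT_R (f f' : R -> R) (a b : R) : (forall s : R, is_derive s 1 f (f' s)) -> a < b ->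
  exists2 c, a < c < b & f b - f a = f' c * (b - a).
Proof.
move=> Df ab; have [|c] := MVT ab (fun s _ => Df s).
  apply: continuous_subspaceT => s; apply: differentiable_continuous.
  by apply/derivable1_diffP; have := Df s => ?; exact: ex_derive.
by rewrite in_itv/= => H E; exists c.
Qed.

Lemma convex_mono s t : (forall s, 0 <= k'' s) -> s <= t -> k' s <= k' t.
Proof.
move=> k0; rewrite le_eqVlt => /orP[/eqP->//|st].
have [c _ E] := MVT_R Dk' st; rewrite -subr_ge0 E mulr_ge0// subr_ge0; exact: ltW.
Qed.

Lemma convex_tangent s t : (forall s, 0 <= k'' s) -> k s + k' s * (t - s) <= k t.
Proof.
move=> k0; have [st|ts|->] := ltgtP s t; last by rewrite subrr mulr0 addr0.
  have [c /andP[sc ct] E] := MVT_R Dk st.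
  have := convex_mono k0 (ltW sc); nra.
have [c /andP[tc cs] E] := MVT_R Dk ts.
have := convex_mono k0 (ltW cs); nra.
Qed.

Lemma convex_strict : (forall s, 0 < k'' s) -> 0 < k 1 - k 0 - k' 0.
Proof.
move=> k0; have [c /andP[c0 c1] E] := MVT_R Dk ltr01.
have [d /andP[d0 dc] E'] := MVT_R Dk' c0.
have := k0 d; rewrite E subr0 mulr1 E' subr0 => ?; exact: mulr_gt0.
Qed.

Lemma convex_scale t : (forall s, 0 <= k'' s) -> 1 <= t ->
  t * (k 1 - k 0 - k' 0) <= k t - k 0 - t * k' 0.
Proof.
move=> k0 t1; have [c /andP[c0 c1] E] := MVT_R Dk ltr01.
have := convex_tangent 1 t k0.
have := convex_mono k0 (ltW c1).
rewrite subr0 mulr1 in E; nra.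
Qed.

End OneDim.

Section Row.
Context {R : realType}.

Lemma row_continuous_at (T : topologicalType) n (f : T -> 'rV[R]_n) x :
  (forall i, {for x, continuous (fun t => f t 0 i)}) -> {for x, continuous f}.
Proof.
move=> cf; apply/cvgrPdist_le => e e0.
have H : \forall t \near x, forall j, `|f x 0 j - f t 0 j| <= e.
  by apply: filter_forall => j; have := cf j => /cvgrPdist_le /(_ _ e0).
apply: filterS H => t tP.
rewrite [leLHS]/Num.Def.normr/= mx_normrE (bigmax_le _ (ltW e0))// => -[i j] _ /=.
by rewrite !mxE !(ord1 i); exact: tP.
Qed.

Lemma norm_row_ge n (x : 'rV[R]_n) i : `|x 0 i| <= `|x|.
Proof.
rewrite [leRHS]/Num.Def.normr/= mx_normrE.
by apply: le_trans (le_bigmax _ _ (0, i)).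
Qed.

Lemma lin_bound_le0 (A B C t0 : R) : (forall t, t0 <= t -> A + t * B <= C) -> B <= 0.
Proof.
move=> H; rewrite leNgt; apply/negP => B0.
have := H (Num.max t0 ((C - A) / B + 1)); rewrite le_max lexx => /(_ isT).
apply/negP; rewrite -ltNge; apply: lt_le_trans (_ : A + ((C - A) / B + 1) * B <= _).
  by rewrite mulrDl divfK ?gt_eqF// mul1r addrA subrKC ltrDl.
by rewrite lerD2l ler_wpM2r ?(ltW B0)// le_max lexx orbT.
Qed.

End Row.

Section Faces.
Context {R : realType} {m : nat}.
Local Notation vec := 'rV[R]_m.
Variable (P : set vec).

(** The segment from y to x can be prolonged slightly beyond x inside F; then x is interior to a
    segment ending at y, and extremality of F' puts y in F'. *)
Lemma face_relint_sub (F F' : set vec) x :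
  face P F -> face P F' -> relint F x -> F' x -> F `<=` F'.
Proof.
move=> [_ FP _ _] [_ F'P _ ext] [Fx nx] F'x y Fy.
have {nx} := nx => /nbhs_ballP[e /= e0 eP].
pose s := e / 2 / (`|x - y| + 1).
have n0 : 0 < `|x - y| + 1 by rewrite ltr_wpDl.
have s0 : 0 < s by rewrite !divr_gt0.
pose y' := x + s *: (x - y).
have Fy' : F y'.
  apply: eP.
    rewrite -ball_normE /= /y' opprD addrA subrr sub0r normrN normrZ gtr0_norm//.
    apply: le_lt_trans (_ : s * (`|x - y| + 1) < _); first by rewrite ler_wpM2l ?lerDl// ltW.
    by rewrite /s divfK ?gt_eqF// ltr_pdivrMr// ltr_pMr// ltr1n.
  exists 2, (fun i : 'I_2 => if i == ord0 then 1 + s else - s),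
    (fun i : 'I_2 => if i == ord0 then x else y); split.
  - by move=> i; case: ifP.
  - by rewrite big_ord_recl big_ord1 /=; ring.
  - rewrite big_ord_recl big_ord1 /= /y' scalerBr scalerDl scale1r scaleNr addrA.
    by [].
have s1 : 0 < 1 + s by rewrite addr_gt0.
have [||_ H] := ext y' y (s / (1 + s)) (FP _ Fy') (FP _ Fy) (divr_gt0 s0 s1); last exact: H.
- by rewrite ltr_pdivrMr// mul1r ltrDr.
- rewrite (_ : _ + _ = x)// /y'; apply/rowP => i; rewrite !mxE; field; rewrite gt_eqF//.
Qed.

Lemma polytope_compact : lattice_polytope P -> compact P.
Proof.
move=> [n [v PE]].
have -> : P = (@bary R m n v) @` @simplex R n.+1.
  apply/seteqP; split=> [y Py|_ [c Sc <-]]; last exact: (bary_in PE).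
  by have [c Sc ->] := bary_surj PE Py; exists c.
apply: continuous_compact; last exact: simplex_compact.
apply: continuous_subspaceT => c; apply: row_continuous_at => i.
rewrite (_ : (fun _ => _) = fun c : 'rV[R]_n.+1 => \sum_j c 0 j * realv R (v j) 0 i); last first.
  by apply/funext => d; rewrite /bary summxE; apply: eq_bigr => j _; rewrite mxE.
apply: (continuous_bigsum (f := fun j (c : 'rV[R]_n.+1) => c 0 j * realv R (v j) 0 i)) => j d.
exact: (cvgM (@coord_continuous R 1 _ 0 j d) (cvg_cst _)).
Qed.

Lemma dot_continuous (r : vec) : continuous (fun x : vec => dot x r).
Proof.
apply: (continuous_bigsum (f := fun j (x : vec) => x 0 j * r 0 j)) => j d.
exact: (cvgM (@coord_continuous R 1 _ 0 j d) (cvg_cst _)).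
Qed.

End Faces.

(** * Convexity of the potential along an orbit *)

Section PsiConvex.
Context {R : realType} {m : nat}.
Local Notation vec := 'rV[R]_m.
Variables (P : set vec) (h : toric_metric P).
Variables (c : vframe m) (Pc : is_vframe P c).
Local Notation G := (chart_potential h c).
Local Notation Ps := (Psi h c).
Local Notation dPs := (dPsi h c).
Local Notation ddPs := (ddPsi h c).

Lemma Psi_line (a v r : vec) (s : R) : is_derive s 1 (fun s : R => Ps a (s *: v + r)) (dPs a v (s *: v + r)).
Proof. by apply: is_derive_shift_line; exact: is_derive_Psi. Qed.

Lemma dPsi_line (a v r : vec) (s : R) :
  is_derive s 1 (fun s : R => dPs a v (s *: v + r)) (ddPs a v v (s *: v + r)).
Proof. by apply: is_derive_shift_line; exact: is_derive_dPsi. Qed.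

Lemma ddPsi_gt0 (a v r : vec) : (exists i, v 0 i * expscale a r 0 i != 0) -> 0 < ddPs a v v r.
Proof.
move=> [i vi]; rewrite /ddPsi pmulr_rgt0//.
pose u : vec := \row_l (v 0 l * expscale a r 0 l).
have u0 : u != 0.
  apply: contraNneq vi => u0; have : u 0 i = 0 by rewrite u0 mxE.
  by rewrite [LHS]mxE => ->.
have := hessM_pos h Pc (expscale a r) u0.
under eq_bigr do under eq_bigr do rewrite [u 0 _]mxE [u 0 _]mxE.
by [].
Qed.

Lemma ddPsi_ge0 (a v r : vec) : 0 <= ddPs a v v r.
Proof.
have [/ddPsi_gt0/ltW//|H] := pselect (exists i, v 0 i * expscale a r 0 i != 0).
rewrite /ddPsi big1 ?mulr0// => l _; rewrite big1// => i _.
have [->|vi] := eqVneq (v 0 i * expscale a r 0 i) 0; first by rewrite mulr0 mul0r.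
by case: H; exists i.
Qed.

Lemma Psi_tangent (a v r : vec) (s t : R) :
  Ps a (s *: v + r) + dPs a v (s *: v + r) * (t - s) <= Ps a (t *: v + r).
Proof.
apply: (convex_tangent (k := fun s : R => Ps a (s *: v + r)) (Psi_line a v r)
  (dPsi_line a v r)) => s'.
exact: ddPsi_ge0.
Qed.

(* Psi is convex along lines and converges when the coordinates outside S
   tend to -oo, hence it is monotone in these coordinates. *)
Lemma Psi_mono (S : pred 'I_m) (r : vec) :
  let chi : vec := \row_i (S i)%:R in
  Ps chi r <= Ps (const_mx 1) r /\
  forall e, 0 < e -> exists r' : vec, (forall i, S i -> r' 0 i = r 0 i) /\
    Ps (const_mx 1) r' <= Ps chi r + e.
Proof.
move=> chi; pose v : vec := \row_i (~~ S i)%:R.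
have conv e : 0 < e -> exists2 s1 : R, s1 <= 0 & forall s, s <= s1 ->
    `|Ps (const_mx 1) (s *: v + r) - Ps chi r| <= e.
  move=> e0; have /cvgrPdist_le /(_ _ e0) := G0_cont (h := h) Pc (x := expscale chi r).
  move=> /nbhs_ballP[d /= d0 dP].
  pose A := \sum_i expR (r 0 i / 2) + 1.
  have A0 : 0 < A by rewrite ltr_wpDl// sumr_ge0// => i _; exact: expR_ge0.
  have d2 : 0 < d / 2 by rewrite divr_gt0.
  (* For s <= s1 the switched-off moduli are at most d/2, since A dominates every e^(r_i/2). *)
  pose s1 := Num.min 0 (2 * ln (d / 2 / A)).
  exists s1; first by rewrite ge_min lexx.
  move=> s ss; rewrite distrC; apply: dP; rewrite -ball_normE /=.
  apply: le_lt_trans (_ : d / 2 < d); last by rewrite ltr_pdivrMr// ltr_pMr// ltr1n.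
  rewrite [leLHS]/Num.Def.normr/= mx_normrE (bigmax_le _ (ltW d2))// => -[i j] _ /=.
  rewrite !mxE mul1r; case: (S j) => /=.
    by rewrite mulr0 add0r mul1r subrr normr0 ltW.
  rewrite mul0r sub0r normrN mulr1 mulrDl expRD ger0_norm ?mulr_ge0 ?expR_ge0//.
  apply: le_trans (_ : d / 2 / A * A <= _); last by rewrite divfK ?gt_eqF.
  apply: ler_pM; rewrite ?expR_ge0//.
    rewrite -[leRHS]lnK; last by rewrite posrE divr_gt0.
    rewrite ler_expR ler_pdivrMr// mulrC (le_trans ss)// ge_min.
    by rewrite lexx orbT.
  rewrite /A (bigD1 j)//= -addrA lerDl addr_ge0// sumr_ge0// => l _; exact: expR_ge0.
split.
  apply/ler_addgt0Pr => e e0; have [s1 s10 s1P] := conv e e0.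
  (* With a negative slope at s1 the tangent line would tend to +oo as s -> -oo, whereas the
     function above it converges. *)
  have dge : 0 <= dPs (const_mx 1) v (s1 *: v + r).
    rewrite -oppr_le0.
    apply: (@lin_bound_le0 _ (Ps (const_mx 1) (s1 *: v + r)) _ (Ps chi r + e) 0) => t t0.
    apply: le_trans (_ : Ps (const_mx 1) ((s1 - t) *: v + r) <= _).
      apply: le_trans (Psi_tangent _ _ _ s1 (s1 - t)).
      by rewrite lerD2l addrAC subrr add0r mulrN mulrC mulrN.
    have := s1P (s1 - t); rewrite gerBl => /(_ t0).
    by rewrite ler_distl => /andP[_].
  have := Psi_tangent (const_mx 1) v r s1 0; rewrite scale0r !add0r => H.
  have := s1P s1 (lexx _); rewrite ler_distl => /andP[H2 _].
  have H3 : 0 <= dPs (const_mx 1) v (s1 *: v + r) * - s1 by rewrite mulr_ge0// oppr_ge0.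
  rewrite -lerBlDr; apply: le_trans H2 _; apply: le_trans H.
  by rewrite lerDl.
move=> e e0; have [s1 s10 s1P] := conv e e0; exists (s1 *: v + r); split.
  by move=> i Si; rewrite !mxE Si mulr0 add0r.
by have := s1P s1 (lexx _); rewrite ler_distl => /andP[_].
Qed.

Lemma Psi_cont (a : vec) : continuous (Ps a).
Proof.
move=> r; rewrite /Psi; apply: (@continuous_comp _ _ _ (expscale a) (fun x : vec => G (x, 0))); last first.
  exact: G0_cont.
apply: row_continuous_at => i.
rewrite (_ : (fun _ => _) = fun t : vec => a 0 i * expR (t 0 i / 2)); last first.
  by apply/funext => t; rewrite mxE.
have cE : {for r, continuous (fun t : vec => expR (t 0 i / 2))}.
  apply: (@continuous_comp _ _ _ (fun t : vec => t 0 i / 2) (@expR R)); last exact: continuous_expR.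
  exact: (cvgM (@coord_continuous R 1 m 0 i r) (cvg_cst _)).
exact: (cvgM (cvg_cst _) cE).
Qed.

Lemma lerD_slack (x y a b f : R) : x <= a - b - y -> f <= x -> b + y + f <= a.
Proof. by move=> *; lra. Qed.

(* Strict convexity on the unit sphere, propagated to infinity by convexity. *)
Lemma Psi_strict (S : pred 'I_m) (r : vec) :
  let chi : vec := \row_i (S i)%:R in
  exists2 d, 0 < d & forall (v : vec) s, (forall i, ~~ S i -> v 0 i = 0) -> `|v| = 1 -> 1 <= s ->
    Ps chi r + s * dPs chi v r + s * d <= Ps chi (s *: v + r).
Proof.
move=> chi; pose A : set vec := [set v : vec | `|v| = 1 /\ forall i, ~~ S i -> v 0 i = 0].
pose q (v : vec) := Ps chi (v + r) - Ps chi r - dPs chi v r.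
have qpos v : A v -> 0 < q v.
  move=> [v1 vS].
  have k0 s : 0 < ddPs chi v v (s *: v + r).
    apply: ddPsi_gt0; apply: contrapT => H.
    have : v = 0.
      apply/rowP => i; rewrite mxE; have [Si|nSi] := boolP (S i); last exact: vS.
      apply: contrapT => /eqP vi; apply: H; exists i.
      by rewrite mulf_neq0// mxE mxE Si mul1r gt_eqF ?expR_gt0.
    by move=> v0; move: v1; rewrite v0 normr0 => /esym/eqP; rewrite oner_eq0.
  have := convex_strict (k := fun s : R => Ps chi (s *: v + r)) (Psi_line chi v r) (dPsi_line chi v r) k0.
  by rewrite scale1r scale0r add0r.
(* The minimum of q over the compact sphere A. The sphere is empty when S selects no coordinate, as
   at a fixed point of the torus. *)
have [d d0 dq] : exists2 d, 0 < d & forall v, A v -> d <= q v.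
  have [A0|/nonemptyPn A0] := pselect (A !=set0); last first.
    by exists 1 => // v Av; rewrite A0 in Av.
  have cA : compact A.
    apply: bounded_closed_compact.
      exists 1; split; first exact: num_real.
      by move=> M M1 v [v1 _]; apply: le_trans (ltW M1); rewrite -v1.
    rewrite (_ : A = (fun v : vec => `|v|) @^-1` [set 1] `&` \bigcap_(i in [set i | ~~ S i]) ((fun v : vec => v 0 i) @^-1` [set 0])).
      apply: closedI.
        by apply: preimage_closed; [move=> v _; exact: norm_continuous|exact: closed_eq].
      apply: closed_bigI => i _.
      by apply: preimage_closed; [move=> v _; exact: coord_continuous|exact: closed_eq].
    by apply/seteqP; split=> v /=.
  have cq : {within A, continuous q}.
    have c1 : continuous (fun v : vec => Ps chi (v + r)).
      move=> v; apply: (@continuous_comp _ _ _ (fun v : vec => v + r) (Ps chi)); last exact: Psi_cont.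
      exact: (cvgD (@cvg_id _ _) (cvg_cst _)).
    have c2 : continuous (fun v : vec => dPs chi v r).
      rewrite (_ : (fun _ => _) = fun v : vec => dot v (\row_i (2^-1 * (expscale chi r 0 i * 'D_(dRe R i) G (expscale chi r, 0))))).
        exact: dot_continuous.
      apply/funext => w; rewrite /dPsi /dot mulr_sumr; apply: eq_bigr => i _.
      by rewrite [X in _ = _ * X]mxE [RHS]mulrCA -(mulrA (w 0 i)).
    apply: continuous_subspaceT => v.
    exact: (cvgB (cvgB (c1 v) (cvg_cst _)) (c2 v)).
  have [v vA vmin] := EVT_min_rV A0 cA cq.
  exists (q v); first by apply: qpos; rewrite inE in vA.
  by move=> v' Av'; apply: vmin; rewrite inE.
exists d => // v s vS v1 s1; have Av : A v by split.
have := convex_scale (k := fun s : R => Ps chi (s *: v + r)) (Psi_line chi v r) (dPsi_line chi v r)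
  (fun s => ddPsi_ge0 chi v (s *: v + r)) s1.
rewrite scale1r scale0r add0r => H.
have s0 : 0 <= s := le_trans ler01 s1.
exact: lerD_slack H (ler_wpM2l s0 (dq v Av)).
Qed.

End PsiConvex.

(** * The moment image of a point and its face *)

Section Point.
Context {R : realType} {m : nat}.
Local Notation vec := 'rV[R]_m.
Variables (P : set vec) (h : toric_metric P).
Hypothesis Pdel : delzant P.
Variable z : toric_point P.
Local Notation c := (pframe z).
Local Notation Pc := (pframeP z).
Local Notation eta := (pcoord z).
Local Notation G := (chart_potential h c).
Local Notation B := (realmx (fedge c) : 'M[R]_m).
Local Notation w := (realv R (fvert c)).

Definition active (i : 'I_m) : bool := eta 0 i != 0.
Definition chi : vec := \row_i (active i)%:R.
Definition logeta : vec := logabs2 eta.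
(** The gradient of [Psi chi] at [logeta], which [momentE] identifies with the edge coordinates of
    mu_0(z). The factor 1/2 comes from |eta_i| = e^(r_i/2). *)
Definition chart_moment : vec :=
  \row_i (2^-1 * (cabs eta 0 i * 'D_(dRe R i) G (cabs eta, 0))).

Lemma expscale_chi_logeta : expscale chi logeta = cabs eta.
Proof.
apply/rowP => i; rewrite !mxE; case: (boolP (active i)) => [ni|]; last first.
  by rewrite negbK => /eqP ->; rewrite mul0r (_ : abs2 0 = 0) ?sqrtr0//; apply/eqP; rewrite abs2_eq0.
have a0 : 0 < abs2 (eta 0 i) by rewrite abs2_gt0.
rewrite mul1r; apply/eqP; rewrite -(@eqrXn2 _ 2)// ?expR_ge0 ?sqrtr_ge0//.
by rewrite sqr_sqrtr ?abs2_ge0// -expRM_natl mulrC divfK// lnK.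
Qed.

Lemma dPsi_chart_moment v : dPsi h c chi v logeta = dot v chart_moment.
Proof.
rewrite /dPsi expscale_chi_logeta /dot mulr_sumr; apply: eq_bigr => i _.
by rewrite [X in _ = _ * X]mxE [RHS]mulrCA -(mulrA (v 0 i)).
Qed.

Lemma chart_moment0 i : ~~ active i -> chart_moment 0 i = 0.
Proof.
by move=> ni; rewrite mxE -expscale_chi_logeta mxE mxE (negbTE ni) mul0r mul0r mulr0.
Qed.

Definition faceS : set vec := [set y | P y /\ forall i, ~~ active i -> edge_coord c y 0 i = 0].

Let Plat : lattice_polytope P. Proof. by case: Pdel. Qed.

Lemma Pconvex x y (s : R) : P x -> P y -> 0 <= s -> s <= 1 -> P ((1 - s) *: x + s *: y).
Proof. by move: Plat => [n [v ->]]; exact: polytope_convex. Qed.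

Lemma faceS_face : face P faceS.
Proof.
split.
- exists w; split; first exact: vertex_in Pc.
  by move=> i _; rewrite /edge_coord subrr mul0mx mxE.
- by move=> y [].
- move=> x y [Px xS] [Py yS] _ [s /= /andP[s0 s1] <-]; split; first exact: Pconvex.
  by move=> i ni; rewrite edge_coord_comb mxE [X in X + _]mxE [X in _ + X]mxE xS// yS// !mulr0 addr0.
- move=> x y s Px Py s0 s1 [_ H].
  have s1' : 0 < 1 - s by rewrite subr_gt0.
  have key i : ~~ active i -> edge_coord c x 0 i = 0 /\ edge_coord c y 0 i = 0.
    move=> ni; have := H i ni; rewrite edge_coord_comb mxE [X in X + _]mxE [X in _ + X]mxE => /eqP.
    have x0 := edge_coord_ge0 Plat Pc Px i; have y0 := edge_coord_ge0 Plat Pc Py i.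
    rewrite paddr_eq0 ?mulr_ge0 ?(ltW s0) ?(ltW s1')// !mulf_eq0 (gt_eqF s0) (gt_eqF s1') /=.
    by move=> /andP[/eqP -> /eqP ->].
  by split; split=> // i ni; case: (key i ni).
Qed.

Lemma edge_coord_continuous : continuous (edge_coord c : vec -> vec).
Proof.
move=> y; apply: row_continuous_at => i.
rewrite (_ : (fun _ => _) = fun y : vec => dot (y - w) (\row_j (realmx (invmx (fedge c)) j i))); last first.
  by apply/funext => t; rewrite /edge_coord mxE /dot; apply: eq_bigr => j _; rewrite [in RHS]mxE.
have H1 : {for y, continuous (fun y : vec => y - w)}.
  exact: (cvgB (@cvg_id _ _) (cvg_cst _)).
exact: (@continuous_comp _ _ _ (fun y : vec => y - w) _ y H1 (dot_continuous (x := y - w))).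
Qed.

Lemma edge_coord_bounded (r : vec) : exists C, forall y, P y -> dot (edge_coord c y) r <= C.
Proof.
have cP := polytope_compact Plat.
have cf : {within P, continuous (fun y => dot (edge_coord c y) r)}.
  apply: continuous_subspaceT => y.
  exact: (@continuous_comp _ _ _ (edge_coord c : vec -> vec) _ y
    (edge_coord_continuous (x := y)) (dot_continuous (x := edge_coord c y))).
have [y0 _ y0P] := EVT_max_rV (ex_intro _ _ (vertex_in Pc)) cP cf.
by exists (dot (edge_coord c y0) r) => y Py; apply: y0P; rewrite inE.
Qed.

Lemma dotDr (x y r : vec) : dot r (x + y) = dot r x + dot r y.
Proof. by rewrite dotC dotD !(dotC _ r). Qed.

Lemma dotZr (a : R) (x r : vec) : dot r (a *: x) = a * dot r x.
Proof. by rewrite dotC dotZ dotC. Qed.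

Lemma dotBr (x y r : vec) : dot r (x - y) = dot r x - dot r y.
Proof. by rewrite dotC dotB !(dotC _ r). Qed.

Lemma dot_ge0 (x : vec) : 0 <= dot x x.
Proof. by apply: sumr_ge0 => i _; rewrite -expr2 sqr_ge0. Qed.

Lemma dot_eq0 (x : vec) : dot x x = 0 -> x = 0.
Proof.
move=> /psumr_eq0P H; apply/rowP => i; rewrite mxE; apply/eqP.
rewrite -sqrf_eq0 expr2; apply/eqP/H => // j _; rewrite -expr2 sqr_ge0//.
Qed.

Lemma dot_sqB (v d : vec) t :
  dot (v - t *: d) (v - t *: d) = dot v v - 2 * t * dot v d + t ^+ 2 * dot d d.
Proof. by rewrite dotB !dotBr !dotZ !dotZr (dotC d v); ring. Qed.

(** p minimizes the distance to x in edge coordinates. If some y violated the inequality, moving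
    from p towards y by the small amount t would bring the point closer to x. *)
Lemma nearest (x : vec) : exists2 p, P p & forall y, P y ->
  dot (x - edge_coord c p) (edge_coord c y) <= dot (x - edge_coord c p) (edge_coord c p).
Proof.
have cP := polytope_compact Plat.
pose f (y : vec) := dot (x - edge_coord c y) (x - edge_coord c y).
have cf : {within P, continuous f}.
  apply: continuous_subspaceT.
  apply: (continuous_bigsum (f := fun i (y : vec) => (x - edge_coord c y) 0 i * (x - edge_coord c y) 0 i)) => i y.
  have H : {for y, continuous (fun y : vec => (x - edge_coord c y) 0 i)}.
    have H1 : {for y, continuous (fun y : vec => x - edge_coord c y)}.
      exact: (cvgB (cvg_cst _) (edge_coord_continuous (x := y))).
    exact: (@continuous_comp _ _ _ (fun y : vec => x - edge_coord c y) (fun v : vec => v 0 i) y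
      H1 (@coord_continuous R 1 m 0 i _)).
  exact: (cvgM H H).
have [p pP pmin] := EVT_min_rV (ex_intro _ _ (vertex_in Pc)) cP cf.
rewrite inE in pP; exists p => // y Py.
set v := x - edge_coord c p; pose d := edge_coord c y - edge_coord c p.
rewrite -subr_le0 -dotBr -/d leNgt; apply/negP => vd.
pose t := Num.min 1 (dot v d / (dot d d + 1)).
have dd : 0 < dot d d + 1 by rewrite ltr_wpDl// dot_ge0.
have t0 : 0 < t by rewrite lt_min ltr01 divr_gt0.
have t1 : t <= 1 by rewrite ge_min lexx.
have := pmin ((1 - t) *: p + t *: y); rewrite inE => /(_ (Pconvex pP Py (ltW t0) t1)).
rewrite /f edge_coord_comb -/v.
have -> : x - ((1 - t) *: edge_coord c p + t *: edge_coord c y) = v - t *: d.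
  by apply/rowP => i; rewrite /v /d !mxE; ring.
rewrite dot_sqB.
have : t * (dot d d + 1) <= dot v d by rewrite -ler_pdivlMr// ge_min lexx orbT.
move: (dot v v) (dot v d) (dot d d) (dot_ge0 d) vd => a b e e0 b0.
nra.
Qed.

Lemma dot_le_norm (x y : vec) : dot x y <= `|x| * \sum_i `|y 0 i|.
Proof.
rewrite /dot mulr_sumr; apply: ler_sum => i _.
rewrite (le_trans (ler_norm _))// normrM ler_wpM2r//; exact: norm_row_ge.
Qed.

Lemma lerD_cancel (a b e f g C1 C : R) : f <= C1 -> e <= g ->
  a + b <= b + (e + f) + C -> a <= C1 + C + g.
Proof. by move=> *; lra. Qed.

(* Supporting-hyperplane argument: a point near the gradient but outside P
   would be separated by some v along which Psi grows faster than the
   support function of P. *)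
Lemma chart_moment_interior : exists2 d, 0 < d & forall x : vec, (forall i, ~~ active i -> x 0 i = 0) ->
  (forall i, `|x 0 i - chart_moment 0 i| <= d) -> P (w + x *m B).
Proof.
have [d d0 dP] : exists2 d, 0 < d & forall (v : vec) s, (forall i, ~~ active i -> v 0 i = 0) ->
    `|v| = 1 -> 1 <= s ->
    Psi h c chi logeta + s * dPsi h c chi v logeta + s * d <= Psi h c chi (s *: v + logeta).
  by have := Psi_strict h Pc active logeta.
(* An error d' in each of m coordinates, paired with a vector of sup norm n, costs at most n d /
   2. *)
pose d' := d / (2 * (m%:R + 1)).
have m1 : 0 < 2 * (m%:R + 1) :> R by rewrite mulr_gt0// ltr_wpDl.
exists d'; first by rewrite divr_gt0.
move=> x xS xg; have [p Pp pmax] := nearest x.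
set v := x - edge_coord c p in pmax.
have [v0|v0] := eqVneq v 0.
  have -> : x = edge_coord c p by apply/eqP; rewrite -subr_eq0 -/v v0.
  by rewrite (edge_coordK p Pc).
have vv : 0 < dot v v.
  by rewrite lt_neqAle dot_ge0 andbT eq_sym; apply: contraNneq v0 => /dot_eq0/eqP.
have pE : dot v (edge_coord c p) = dot v x - dot v v.
  rewrite -dotBr; congr (dot v _); rewrite /v.
  by rewrite opprB addrC subrK.
have wp : 0 <= dot v (edge_coord c p).
  have := pmax _ (vertex_in Pc); rewrite [X in dot v X](_ : _ = 0) ?(dotC v 0) ?dot0//.
  by rewrite /edge_coord subrr mul0mx.
(* [Psi chi] sees only the active coordinates, and x is supported on them as well, so v may be
   truncated in both places. *)
pose vS : vec := \row_i (v 0 i * (active i)%:R).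
have vSx : dot v x = dot vS x.
  apply: eq_bigr => i _; rewrite [vS 0 i]mxE; case: (boolP (active i)) => ni; first by rewrite mulr1.
  by rewrite (xS i ni) !mulr0.
have [vS0|vS0] := eqVneq vS 0.
  by move: wp; rewrite pE vSx vS0 dot0 sub0r oppr_ge0 leNgt vv.
exfalso.
pose n := `|vS|; have n0 : 0 < n by rewrite normr_gt0.
have [C _ [_ grow]] := phi_growth h Pdel.
have [C1 C1P] := edge_coord_bounded logeta.
(* Along v the potential grows no faster than the support function of P, which in this direction is
   attained at p. *)
have ub t : 0 <= t -> Psi h c chi (t *: v + logeta) <= C1 + C + t * dot v (edge_coord c p).
  move=> t0; apply: le_trans (Psi_mono h Pc active (t *: v + logeta)).1 _.
  pose rho := (t *: v + logeta) *m (realmx (invmx (fedge c)))^T.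
  have [y Py] := grow rho.
  rewrite (phi_Psi h Pc rho) (dot_edge y rho Pc) (r_rho Pc) => H.
  have h1 := C1P y Py; have h2 := ler_wpM2l t0 (pmax y Py).
  move: H; rewrite dotDr dotZr (dotC (edge_coord c y) v).
  exact: lerD_cancel h1 h2.
have lb t : n^-1 <= t -> Psi h c chi logeta + t * (dot vS chart_moment + n * d) <= Psi h c chi (t *: v + logeta).
  move=> tn.
  have u1 : `|n^-1 *: vS| = 1 by rewrite normrZ gtr0_norm ?invr_gt0// mulVf// gt_eqF.
  have h1 i : ~~ active i -> (n^-1 *: vS) 0 i = 0 by move=> ni; rewrite !mxE (negbTE ni) !mulr0.
  have h2 : 1 <= t * n by rewrite -ler_pdivrMr// div1r.
  have := dP (n^-1 *: vS) (t * n) h1 u1 h2.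
  have -> : dPsi h c chi (n^-1 *: vS) logeta = n^-1 * dot vS chart_moment by rewrite dPsi_chart_moment dotZ.
  have -> : t * n *: (n^-1 *: vS) = t *: vS by rewrite scalerA mulfK ?gt_eqF.
  have -> : Psi h c chi (t *: vS + logeta) = Psi h c chi (t *: v + logeta).
    rewrite /Psi; congr (G (_, 0)); apply/rowP => i; rewrite !mxE.
    by case: (active i); rewrite ?mul0r ?mulr1.
  have -> : t * n * (n^-1 * dot vS chart_moment) = t * dot vS chart_moment by rewrite mulrA mulfK ?gt_eqF.
  by rewrite mulrDr mulrA addrA.
(* Comparison of the slopes of [lb] and [ub] for large t. As <v, p> = <vS, x> - |v|^2 and x is close
   to the gradient, the left side is in fact positive. *)
have : dot vS chart_moment + n * d - dot v (edge_coord c p) <= 0.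
  apply: (@lin_bound_le0 _ (Psi h c chi logeta) _ (C1 + C) n^-1) => t tn.
  have t0 : 0 <= t by rewrite (le_trans _ tn)// invr_ge0 ltW.
  have := le_trans (lb t tn) (ub t t0).
  by rewrite mulrBr addrA lerBlDr.
rewrite pE vSx => H.
have : dot vS (x - chart_moment) <= n * (d / 2).
  apply: le_trans (dot_le_norm _ _) _; rewrite -/n ler_wpM2l ?(ltW n0)//.
  apply: le_trans (_ : \sum_(i < m) d' <= _).
    by apply: ler_sum => i _; rewrite !mxE; have := xg i; rewrite !mxE.
  rewrite sumr_const card_ord -[leLHS]mulr_natr /d'.
  have mR : 0 < m%:R + 1 :> R by rewrite ltr_wpDl.
  have -> : d / (2 * (m%:R + 1)) * m%:R = d / 2 * (m%:R / (m%:R + 1)).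
    by field; rewrite gt_eqF.
  rewrite ler_piMr ?divr_ge0 ?(ltW d0)//.
  by rewrite ler_pdivrMr// mul1r lerDl.
rewrite dotBr; have := mulr_gt0 n0 d0; lra.
Qed.

End Point.

(** * The rate function *)

Section Rate.
Context {R : realType} {m : nat}.
Local Notation vec := 'rV[R]_m.
Variables (P : set vec) (h : toric_metric P).
Hypothesis Pdel : delzant P.
Variable z : toric_point P.
Local Notation c := (pframe z).
Local Notation Pc := (pframeP z).
Local Notation eta := (pcoord z).
Local Notation G := (chart_potential h c).
Local Notation B := (realmx (fedge c) : 'M[R]_m).
Local Notation w := (realv R (fvert c)).

Definition gradc (x : vec) : vec := \row_i (2^-1 * (x 0 i * 'D_(dRe R i) G (x, 0))).

Lemma grad_phiE (rho : vec) : grad (phi h) rho = w + gradc (exph (rho *m B^T)) *m B.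
Proof.
apply/rowP => j; rewrite [LHS]mxE [RHS]mxE.
have D := is_derive_phi h Pc rho (delta_mx 0 j).
rewrite (@derive_val _ _ _ _ _ _ _ D) /dphi [LHS]addrC; congr (_ + _).
  rewrite /dot (bigD1 j)//= [X in _ * X + _]mxE !eqxx mulr1 big1 ?addr0// => i ij.
  by rewrite [X in _ * X]mxE (negbTE ij) andbF mulr0.
rewrite /dPsi expscale1 [RHS]mxE mulr_sumr; apply: eq_bigr => i _.
have -> : (delta_mx 0 j *m B^T : vec) 0 i = B i j by rewrite -rowE mxE mxE.
rewrite [gradc _ 0 i]mxE; move: (exph _) => E; move: ('D_(dRe R i) G (E, 0)) => D'.
by move: (B i j) (E 0 i) => b e; ring.
Qed.

Lemma cabs_cvec_continuous : continuous (fun q : vec * vec => cabs (cvec q)).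
Proof.
move=> q; apply: row_continuous_at => i.
rewrite (_ : (fun _ => _) = fun q : vec * vec => Num.sqrt (q.1 0 i ^+ 2 + q.2 0 i ^+ 2)); last first.
  by apply/funext => t; rewrite !mxE.
have c1 : {for q, continuous (fun q : vec * vec => q.1 0 i)}.
  exact: (@continuous_comp _ _ _ (fun q : vec * vec => q.1) (fun x : vec => x 0 i) q
    (@cvg_fst _ _ _ _ _) (@coord_continuous R 1 m 0 i _)).
have c2 : {for q, continuous (fun q : vec * vec => q.2 0 i)}.
  exact: (@continuous_comp _ _ _ (fun q : vec * vec => q.2) (fun x : vec => x 0 i) q
    (@cvg_snd _ _ _ _ _) (@coord_continuous R 1 m 0 i _)).
have c3 : {for q, continuous (fun q : vec * vec => q.1 0 i ^+ 2 + q.2 0 i ^+ 2)}.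
  exact: (cvgD (cvgM c1 c1) (cvgM c2 c2)).
exact: (@continuous_comp _ _ _ _ (@Num.sqrt R) q c3 (@sqrt_continuous R _)).
Qed.

Lemma cvec_rvec (x : 'rV[R[i]]_m) : cvec (rvec x) = x.
Proof. by apply/rowP => i; rewrite !mxE; case: (x 0 i). Qed.

Lemma gradc_continuous : continuous gradc.
Proof.
move=> x; apply: row_continuous_at => i.
rewrite (_ : (fun _ => _) = fun x : vec => 2^-1 * (x 0 i * 'D_(dRe R i) G (x, 0))); last first.
  by apply/funext => t; rewrite mxE.
have cD : {for x, continuous (fun x : vec => 'D_(dRe R i) G (x, 0))}.
  exact: (continuous_pair0 (f := 'D_(dRe R i) G) (G_C1 h Pc (dRe R i)).2 (x := x)).
exact: (cvgM (cvg_cst _) (cvgM (@coord_continuous R 1 m 0 i x) cD)).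
Qed.

Lemma open_coord_r (x : 'rV[R[i]]_m) : in_torus x ->
  logabs2 (open_coord c x) *m B^T = logabs2 x.
Proof.
by move=> tx; rewrite /open_coord (logabs2_mon_map _ tx); exact: (r_rho Pc (logabs2 x)).
Qed.

Lemma rowBE (x y : vec) i : (x - y) 0 i = x 0 i - y 0 i.
Proof. by rewrite !mxE. Qed.

(** On the torus the gradient of [phi] coincides with an expression Phi that is continuous on the
    whole chart, so the limit is the value of Phi. *)
Lemma momentE : moment h z = w + chart_moment h z *m B.
Proof.
pose Phi (q : vec * vec) : vec := w + gradc (cabs (cvec q)) *m B.
have cPhi : continuous Phi.
  move=> q; apply: row_continuous_at => j.
  rewrite (_ : (fun _ => _) = fun q : vec * vec => w 0 j + dot (gradc (cabs (cvec q))) (\row_i B i j)); last first.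
    apply/funext => t; rewrite mxE; congr (_ + _); rewrite mxE.
    by apply: eq_bigr => i _; rewrite [(\row__ _) _ _]mxE.
  have c1 := @continuous_comp _ _ _ _ gradc q (cabs_cvec_continuous (x := q)) (gradc_continuous (x := _)).
  have c2 := @continuous_comp _ _ _ _ (fun x : vec => dot x (\row_i B i j)) q c1 (dot_continuous (x := _)).
  exact: (cvgD (cvg_cst _) c2).
(* Density of the torus makes the filter of the limit proper; zero coordinates are replaced by
   e/2. *)
have clos : closure [set q : vec * vec | in_torus (cvec q)] (rvec eta).
  move=> A /nbhs_ballP[e /= e0 eA].
  pose q : vec * vec := (\row_i (if eta 0 i == 0 then e / 2 else complex.Re (eta 0 i)), (rvec eta).2).
  exists q; split.
    move=> i; rewrite !mxE; case: ifPn => [_|].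
      by rewrite eq_complex /= negb_and gt_eqF// divr_gt0.
    by case: (eta 0 i).
  apply: eA; rewrite -ball_normE /=.
  rewrite prod_normE/= gt_max; apply/andP; split; last by rewrite subrr normr0.
  apply: le_lt_trans (_ : e / 2 < e); last by rewrite ltr_pdivrMr// ltr_pMr// ltr1n.
  have e2 : 0 <= e / 2 by rewrite divr_ge0// ltW.
  rewrite [leLHS]/Num.Def.normr/= mx_normrE (bigmax_le _ e2)// => -[i j] _ /=.
  rewrite !mxE; case: ifPn => [/eqP->|_] /=.
    by rewrite sub0r normrN ger0_norm.
  by rewrite subrr normr0.
have pf := within_nbhs_proper clos.
have PhiE : Phi (rvec eta) = w + chart_moment h z *m B by rewrite /Phi cvec_rvec.
rewrite -PhiE /moment; apply: cvg_lim; first exact: norm_hausdorff.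
apply: (@cvg_trans _ (Phi @ within [set q : vec * vec | in_torus (cvec q)] (nbhs (rvec eta)))).
  apply: near_eq_cvg; apply: filterS (withinT _ _) => q /= tq.
  rewrite grad_phiE /Phi; congr (_ + gradc _ *m B).
  by rewrite (open_coord_r tq) cabs_torus.
exact: cvg_within_filter (cPhi (rvec eta)).
Qed.

Lemma affine_hull_faceS y : affine_hull (faceS z) y ->
  forall i, ~~ active z i -> edge_coord c y 0 i = 0.
Proof.
move=> [n [a [p [pS a1 ->]]]] i ni.
rewrite edge_coord_sum// summxE big1// => j _; rewrite mxE.
by have [_ ->] := pS j; rewrite ?mulr0.
Qed.

(** On the affine hull of the face the inactive edge coordinates vanish, which is the condition
    under which [chart_moment_interior] provides a neighborhood inside P. *)
Lemma relint_faceS : relint (faceS z) (moment h z).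
Proof.
have [d d0 dP] := chart_moment_interior h Pdel z.
have ecm : edge_coord c (moment h z) = chart_moment h z by rewrite momentE (edge_coord_add _ Pc).
have inP y : (forall i, ~~ active z i -> edge_coord c y 0 i = 0) ->
    (forall i, `|edge_coord c y 0 i - chart_moment h z 0 i| <= d) -> faceS z y.
  move=> yS yd; split=> //.
  by rewrite -(edge_coordK y Pc); exact: dP.
split.
  apply: inP => i; rewrite ecm; first exact: chart_moment0.
  by rewrite subrr normr0 ltW.
have := edge_coord_continuous (z := z) (x := moment h z) => /cvgrPdist_le /(_ _ d0).
apply: filterS => y yd /affine_hull_faceS yS; apply: inP => // i.
rewrite -ecm distrC; apply: le_trans yd; have := norm_row_ge (edge_coord c (moment h z) - edge_coord c y) i.
by rewrite rowBE.
Qed.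

Lemma face_atE x : face_at h z x <-> faceS z x.
Proof.
split=> [[F [fF rF Fx]]|Sx].
  apply: (face_relint_sub fF (faceS_face Pdel z) rF) Fx.
  by case: relint_faceS.
by exists (faceS z); split=> //; [exact: faceS_face|exact: relint_faceS].
Qed.

Lemma tangentE i : tangent h z i = active z i.
Proof.
apply/asboolP/idP => [[x [y [s [/face_atE [_ xS] /face_atE [_ yS] s0 E]]]]|ni].
  apply: contraT => ni; have : edge_coord c y 0 i - edge_coord c x 0 i = s.
    have -> : y = x + s *: realv R (row i (fedge c)) by rewrite -E addrC subrK.
    rewrite /edge_coord realv_row addrAC mulmxDl [X in X - _]mxE addrAC subrr add0r.
    rewrite -scalemxAl -row_mul (realmxV Pc) mxE row1 mxE !eqxx mulr1.
    by [].
  by rewrite xS// yS// subrr => s00; rewrite -s00 eqxx in s0.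
have [l l0 Pl] := edge_in i Pc.
exists w, (w + l *: realv R (row i (fedge c))), l; split.
- apply/face_atE; split; first exact: vertex_in Pc.
  by move=> j _; rewrite /edge_coord subrr mul0mx mxE.
- apply/face_atE; split=> // j nj.
  rewrite realv_row rowE scalemxAl (edge_coord_add _ Pc) !mxE eqxx/=.
  by case: eqP nj => [->|_ _]; [rewrite ni|rewrite mulr0].
- by rewrite gt_eqF.
- by rewrite addrC addKr.
Qed.

Definition log_section (y : vec) : R := dot (edge_coord c y) (logeta z) + ln (norm_v h c eta).

Lemma phiFE r : phiF h z r = Psi h c (chi z) r.
Proof.
rewrite /phiF /Psi /chart_potential; congr (- ln _); apply: norm_v_abs; first exact: Pc.
move=> i; rewrite !mxE tangentE; case: (active z i); rewrite ?mul1r ?mul0r//.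
Qed.

Lemma phiF_logeta : phiF h z (logeta z) = - ln (norm_v h c eta).
Proof. by rewrite phiFE /Psi expscale_chi_logeta /chart_potential -norm_v_cabs//; exact: Pc. Qed.

Lemma dotFE (x r : vec) : (forall i, ~~ active z i -> x 0 i = 0) -> dotF h z x r = dot x r.
Proof.
move=> x0; rewrite /dotF /dot big_mkcond; apply: eq_bigr => i _.
by rewrite tangentE; case: ifPn => // ni; rewrite x0// mul0r.
Qed.

Lemma dot_phi_edge y rho : dot y rho - phi h rho =
  dot (edge_coord c y) (rho *m B^T) - Psi h c (const_mx 1) (rho *m B^T).
Proof. by rewrite (dot_sub_phi h Pc) /Psi expscale1. Qed.

Lemma lerB_slackD (a b u k e : R) : a - b <= u -> b <= k + e -> a - k <= u + e.
Proof. by move=> *; lra. Qed.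

(** The two halves of [Psi_mono]: inactive coordinates of r can be lowered until the two potentials
    agree up to e, without changing the pairing with y; conversely [Psi chi] is below the potential
    of the open orbit. *)
Lemma uFE y : faceS z y -> uF h z y = (u0R h y)%:E.
Proof.
move=> [Py yS]; apply/eqP; rewrite eq_le; apply/andP; split.
  apply: ge_ereal_sup => _ [r _ <-]; rewrite lee_fin dotFE// phiFE.
  apply/ler_addgt0Pr => e e0.
  have [r' [r'S r'P]] := (Psi_mono h Pc (active z) r).2 e e0.
  have := u0R_ub h Pdel (r' *m (realmx (invmx (fedge c)))^T) Py.
  rewrite dot_phi_edge (r_rho Pc) => H.
  have -> : dot (edge_coord c y) r = dot (edge_coord c y) r'.
    apply: eq_bigr => i _; case: (boolP (active z i)) => ni; first by rewrite r'S.
    by rewrite yS// !mul0r.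
  move: H r'P; rewrite -/(chi z); exact: lerB_slackD.
rewrite -(u0E h Pdel Py); apply: ge_ereal_sup => _ [rho _ <-].
rewrite dot_phi_edge; apply: le_trans (ereal_sup_ubound _); last first.
  by exists (rho *m B^T).
rewrite lee_fin dotFE// phiFE lerD2l lerN2.
exact: (Psi_mono h Pc (active z) _).1.
Qed.

Lemma torus_active : in_torus eta -> forall i, active z i.
Proof. by []. Qed.

Lemma EFin_subD (a b k : R) : (a%:E - b%:E + k%:E)%E = (a - b + k)%:E.
Proof. by []. Qed.

Lemma rateE y : P y -> rate h z y =
  if `[< forall i, ~~ active z i -> edge_coord c y 0 i = 0 >] then (u0R h y - log_section y)%:E else +oo%E.
Proof.
move=> Py; rewrite /rate; case: asboolP => [tor|ntor].
  rewrite asboolT; last by move=> i; rewrite torus_active.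
  rewrite (u0E h Pdel Py) EFin_subD; congr EFin.
  rewrite -addrA [X in _ + X]addrC -opprB dot_phi_edge (open_coord_r tor).
  rewrite /log_section; congr (_ - (_ + _)).
  by rewrite /Psi expscale1 -cabs_torus// /chart_potential opprK -(norm_v_cabs h eta Pc).
case: asboolP => [/face_atE Sy|nS].
  rewrite asboolT; last by case: Sy.
  rewrite (uFE Sy) phiF_logeta dotFE; last by case: Sy.
  by rewrite EFin_subD /log_section opprD addrA.
rewrite asboolF// => yS; apply: nS; apply/face_atE; by split.
Qed.

End Rate.

(** * The large deviation upper bound *)

Section Sections.
Context {R : realType} {m : nat}.
Local Notation vec := 'rV[R]_m.
Variables (P : set vec) (h : toric_metric P).
Hypothesis Pdel : delzant P.

(** The exponent of eta_i in the chart is k times the i-th edge coordinate of y. A vanishing eta_i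
    kills the section unless this exponent is 0, in which case it contributes 0^0 = 1. *)
Lemma sect2E (z : toric_point P) k (a : 'rV[int]_m) y : (0 < k)%N -> P y ->
  realv R a = k%:R *: y ->
  sect2 h k a z = if `[< forall i, ~~ active z i -> edge_coord (pframe z) y 0 i = 0 >]
    then expR (k%:R * log_section h z y) else 0.
Proof.
move=> k0 Py aE; rewrite /sect2 abs2_monom.
set c := pframe z; set n := (a - _) *m _; have Pc : is_vframe P c := pframeP z.
have nE i : (n 0 i)%:~R = k%:R * edge_coord c y 0 i.
  have : realv R n = k%:R *: edge_coord c y.
    rewrite /realv /n map_mxM raddfB/= raddfMn/= -/(realv R a) aE /edge_coord scalemxAl.
    by rewrite scalerBr -[map_mx _ _ *+ k]scaler_nat.
  by move/(congr1 (fun x : vec => x 0 i)); rewrite [LHS]mxE [RHS]mxE.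
have kR : k%:R != 0 :> R by rewrite pnatr_eq0 -lt0n.
case: asboolP => [yS|nS].
  rewrite (eq_bigr (fun i => expR (k%:R * (edge_coord c y 0 i * logeta z 0 i)))); last first.
    move=> i _; case: (boolP (active z i)) => ni.
      by rewrite mulrA -nE expR_intM /logeta [logabs2 _ 0 i]mxE lnK// posrE abs2_gt0.
    have n0 : n 0 i = 0 by apply/eqP; rewrite -(intr_eq0 R) nE (yS i ni) mulr0.
    by rewrite n0 expr0z (yS i ni) mul0r mulr0 expR0.
  rewrite -expR_sum -mulr_sumr /log_section mulrDr expRD; congr (_ * _).
  by rewrite expRM_natl lnK// posrE norm_pos.
have [i ni yi] : exists2 i, ~~ active z i & edge_coord c y 0 i != 0.
  apply: contrapT => H; apply: nS => i ni; apply: contrapT => /eqP yi.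
  by apply: H; exists i.
have n0 : n 0 i != 0 by rewrite -(intr_eq0 R) nE mulf_neq0.
have nge : 0 <= n 0 i.
  rewrite -(ler0z R) nE mulr_ge0// (edge_coord_ge0 _ Pc Py)//; by case: Pdel.
rewrite (bigD1 i)//= (_ : abs2 _ = 0); last first.
  by apply/eqP; rewrite abs2_eq0; rewrite negbK in ni.
by rewrite exp0rz (negbTE n0) !mul0r.
Qed.

Lemma scaledE k (a : 'rV[int]_m) y : (0 < k)%N -> realv R a = k%:R *: y -> scaled R k a = y.
Proof.
by move=> k0 aE; rewrite /scaled aE scalerA mulVf ?scale1r// pnatr_eq0 -lt0n.
Qed.

(** kP lies in the cube with entries between -Ak and Ak, which contains (2Ak + 1)^m integer
    points. *)
Lemma lattice_count : exists A : nat, forall k, finite_set (lattice_pts P k) /\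
  forall (F : 'rV[int]_m -> R) (b : R), 0 <= b ->
   (forall a, lattice_pts P k a -> F a <= b) ->
   \sum_(a \in lattice_pts P k) F a <= ((2 * A * k).+1 ^ m)%:R * b.
Proof.
have [A AP] := polytope_bounded (proj1 Pdel); exists A => k.
pose T := {ffun 'I_m -> 'I_(2 * A * k).+1}.
pose phi (f : T) : 'rV[int]_m := \row_i ((f i)%:Z - (A * k)%:Z).
pose s := [seq phi f | f <- enum T].
have sub a : lattice_pts P k a -> a \in s.
  move=> [x Px aE].
  have ab i : `|a 0 i| <= (A * k)%:Z.
    rewrite -(ler_int R) intr_norm.
    have -> : (a 0 i)%:~R = k%:R * x 0 i :> R.
      by have := congr1 (fun v : vec => v 0 i) aE; rewrite !mxE.
    by rewrite normrM ger0_norm// -pmulrn natrM mulrC ler_wpM2r// AP.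
  apply/mapP; exists [ffun i => inord (absz (a 0 i + (A * k)%:Z))]; first by rewrite mem_enum.
  apply/rowP => i; rewrite mxE ffunE.
  have := ab i; rewrite ler_norml => /andP[h1 h2].
  have h0 : 0 <= a 0 i + (A * k)%:Z by rewrite -lerBlDr sub0r.
  rewrite inordK; first by rewrite gez0_abs// addrK.
  rewrite ltnS -lez_nat gez0_abs// -mulnA mul2n -addnn PoszD lerD2r//.
have fin : finite_set (lattice_pts P k).
  by apply: (@sub_finite_set _ _ [set` s]) (finite_seq s) => a; exact: sub.
split=> // F b b0 Fb; rewrite fsbig_finite//=.
have H : \sum_(a <- fset_set (lattice_pts P k)) F a <= \sum_(a <- fset_set (lattice_pts P k)) b.
  by rewrite !big_seq; apply: ler_sum => a; rewrite in_fset_set// => /set_mem; exact: Fb.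
apply: (le_trans H).
rewrite big_const_seq count_predT iter_addr addr0 -[leLHS]mulr_natl ler_wpM2r// ler_nat.
have := @uniq_leq_size _ (fset_set (lattice_pts P k)) s (fset_uniq _).
rewrite size_map -cardE card_ffun !card_ord; apply.
by move=> a; rewrite in_fset_set// => /set_mem; exact: sub.
Qed.

Lemma fsbig_ge1 k (F : 'rV[int]_m -> R) a : finite_set (lattice_pts P k) ->
  (forall a, lattice_pts P k a -> 0 <= F a) -> lattice_pts P k a ->
  F a <= \sum_(a \in lattice_pts P k) F a.
Proof.
move=> fin F0 Da; rewrite fsbig_finite//= (bigD1_seq a)//=; last 2 first.
- by rewrite in_fset_set//; exact: mem_set.
- exact: fset_uniq.
rewrite lerDl big_seq_cond; apply: sumr_ge0 => b /andP[+ _].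
by rewrite in_fset_set// => /set_mem Db; exact: F0.
Qed.

(** With q = e / (m + 1), exp(ke) is the (m + 1)-st power of exp(kq) >= kq, and k^(m+1) beats a
    multiple of k^m. *)
Lemma poly_le_exp (A : nat) (e : R) : 0 < e -> exists k1 : nat, forall k, (k1 <= k)%N -> (0 < k)%N ->
  ((2 * A * k).+1 ^ m)%:R <= expR (k%:R * e).
Proof.
move=> e0; pose q := e / m.+1%:R; have q0 : 0 < q by rewrite divr_gt0.
pose M : R := ((2 * A).+1 ^ m)%:R.
exists (Num.truncn (M / q ^+ m.+1)).+1 => k kk k0.
have kR : 0 < k%:R :> R by rewrite ltr0n.
have kM : M <= k%:R * q ^+ m.+1.
  rewrite -ler_pdivrMr ?exprn_gt0//; apply: le_trans (ltW (truncnS_gt _)) _.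
  by rewrite ler_nat.
apply: le_trans (_ : M * k%:R ^+ m <= _).
  rewrite /M -natrX -natrM ler_nat -expnMn; case: (m) => [|m']; first by rewrite !expn0.
  by rewrite leq_exp2r// mulSn -addn1 addnC leq_add2r.
apply: le_trans (_ : (k%:R * q) ^+ m.+1 <= _).
  rewrite exprMn exprSr mulrC -mulrA ler_wpM2l// exprn_ge0//.
have -> : k%:R * e = m.+1%:R * (k%:R * q).
  by rewrite /q mulrCA [m.+1%:R * _]mulrC divfK ?pnatr_eq0.
rewrite expRM_natl; apply: lerXn2r.
- by rewrite nnegrE mulr_ge0// ltW.
- by rewrite nnegrE expR_ge0.
- by apply: le_trans (expR_ge1Dx _); rewrite lerDr.
Qed.

Lemma max_affine_lip (p : nat) (lam : 'I_p.+1 -> 'rV[rat]_m * rat) :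
  exists2 L : R, 0 < L & forall (x y : vec) d, 0 <= d ->
    (forall i, `|x 0 i - y 0 i| <= d) ->
    max_affine lam x <= max_affine lam y + L * d.
Proof.
pose L : R := \sum_j \sum_i `|ratr ((lam j).1 0 i)| + 1.
have L0 : 0 < L by rewrite ltr_wpDl// sumr_ge0// => j _; exact: sumr_ge0.
exists L => // x y d d0 xy.
have aff j : affine_rat (lam j) x <= max_affine lam y + L * d.
  apply: le_trans (_ : affine_rat (lam j) y + L * d <= _); last first.
    by rewrite lerD2r; exact: le_bigmax_cond.
  rewrite /affine_rat addrAC lerD2r -lerBlDl -sumrB.
  apply: le_trans (_ : \sum_i `|ratr ((lam j).1 0 i)| * d <= _).
    apply: ler_sum => i _; rewrite -mulrBr (le_trans (ler_norm _))// normrM ler_wpM2l//.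
  rewrite -mulr_suml ler_wpM2r// /L (bigD1 j)//= -addrA lerDl addr_ge0// sumr_ge0// => l _.
  exact: sumr_ge0.
by apply: bigmax_le => [|j _]; exact: aff.
Qed.

End Sections.

(** * Combination of the estimates *)

Section Final.
Context {R : realType} {m : nat}.
Local Notation vec := 'rV[R]_m.
Variables (P : set vec) (h : toric_metric P).
Hypothesis Pdel : delzant P.

(* Everything that depends on z and t enters through the last hypothesis, so
   applying this for each large k gives an error uniform in z and t. *)
Lemma ldp_upper_bound (Ft : vec -> R) (K : set vec) (z : toric_point P) (k : nat)
    (C q N e : R) : (0 < k)%N -> 0 < C -> 0 < q -> 0 < e ->
  ln C <= k%:R * e -> - ln q <= k%:R * e -> 0 <= N -> N <= expR (k%:R * e) ->
  finite_set (lattice_pts P k) ->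
  (forall (F : 'rV[int]_m -> R) (b : R), 0 <= b ->
     (forall a, lattice_pts P k a -> F a <= b) -> \sum_(a \in lattice_pts P k) F a <= N * b) ->
  (forall (a : 'rV[int]_m) y, P y -> realv R a = k%:R *: y ->
     q * expR (k%:R * (u0R h y - e)) <= Qnorm h k a /\ Qnorm h k a <= C * expR (k%:R * u0R h y)) ->
  (forall y, faceS z y -> exists a y', [/\ faceS z y', realv R a = k%:R *: y',
     u0R h y' <= u0R h y + e, Ft y - e <= Ft y' & log_section h z y <= log_section h z y']) ->
  ((k%:R^-1)%:E * lne (mu h Ft k z K)%:E
       <= - ereal_inf [set tilted_rate h Ft z x | x in K] + (6 * e)%:E)%E.
Proof.
move=> k0 C0 q0 e0 lC lq N0 Ne fin cnt Qb apx.
have kR : 0 < k%:R :> R by rewrite ltr0n.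
(* If K has no mass, its logarithm is -oo and the inequality is trivial. *)
have [mu0|mu0] := leP (mu h Ft k z K) 0.
  rewrite le0_lneNy ?lee_fin// gt0_muleNy ?lte_fin ?invr_gt0//; exact: leNye.
pose W := weight h Ft k z.
have pt a : lattice_pts P k a -> exists2 y, P y & realv R a = k%:R *: y by move=> [y Py ya]; exists y.
have Qpos a y : P y -> realv R a = k%:R *: y -> 0 < Qnorm h k a.
  move=> Py aE; apply: lt_le_trans (Qb a y Py aE).1.
  by rewrite mulr_gt0// expR_gt0.
have WE a y : P y -> realv R a = k%:R *: y -> W a = expR (k%:R * Ft y) *
   ((if `[< forall i, ~~ active z i -> edge_coord (pframe z) y 0 i = 0 >]
    then expR (k%:R * log_section h z y) else 0) / Qnorm h k a).
  by move=> Py aE; rewrite /W /weight (scaledE k0 aE) (sect2E h Pdel z k0 Py aE).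
have W0 a : lattice_pts P k a -> 0 <= W a.
  move=> /pt[y Py aE]; rewrite (WE a y Py aE) mulr_ge0 ?expR_ge0// divr_ge0//.
    by case: ifP => // _; exact: expR_ge0.
  exact: ltW (Qpos a y Py aE).
pose Z := partition_fun h Ft k z.
pose S := \sum_(a \in lattice_pts P k) weight h Ft k z a * \1_K (scaled R k a).
have muE : mu h Ft k z K = Z^-1 * S by [].
have Z0 : 0 < Z.
  rewrite lt_neqAle; apply/andP; split.
    by apply/eqP => Z00; move: mu0; rewrite muE -Z00 invr0 mul0r ltxx.
  rewrite /Z /partition_fun fsbig_finite//= big_seq; apply: sumr_ge0 => a.
  by rewrite in_fset_set// => /set_mem; exact: W0.
have S0 : 0 < S by move: mu0; rewrite muE pmulr_rgt0// invr_gt0.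
pose zeta := ln Z / k%:R.
have Zexp : Z = expR (k%:R * zeta).
  by rewrite /zeta mulrCA divff ?gt_eqF// mulr1 lnK.
(* The three errors come from u_0 and F_t at the approximating point and from the constant C in the
   bound on Q. *)
have Zlow y : faceS z y -> Ft y - (u0R h y - log_section h z y) <= zeta + 3 * e.
  move=> Sy; have [a [y' [[Py' yS'] aE u' F' L']]] := apx y Sy.
  have Da : lattice_pts P k a by exists y'.
  have := fsbig_ge1 fin W0 Da; rewrite -/Z (WE a y' Py' aE) asboolT// => WZ.
  have [_ Qle] := Qb a y' Py' aE.
  have : expR (k%:R * (Ft y' + log_section h z y' - u0R h y') - ln C) <= expR (k%:R * zeta).
    rewrite -Zexp; apply: le_trans WZ.
    rewrite mulrA -expRD ler_pdivlMr ?(Qpos a y')//.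
    apply: le_trans (ler_wpM2l (expR_ge0 _) Qle) _.
    have CE : C = expR (ln C) by rewrite lnK.
    rewrite [X in _ * (X * _)]CE -!expRD ler_expR.
    by rewrite le_eqVlt; apply/orP; left; apply/eqP; ring.
  rewrite ler_expR => H.
  have : k%:R * (Ft y' + log_section h z y' - u0R h y') <= k%:R * (zeta + e).
    by rewrite [leRHS]mulrDr; move: H; rewrite lerBlDr => /le_trans; apply; rewrite lerD2l.
  rewrite ler_pM2l// => {}H; lra.
have supE : (ereal_sup [set (Ft y)%:E - rate h z y | y in P] <= (zeta + 3 * e)%:E)%E.
  apply: ge_ereal_sup => _ [y Py <-]; rewrite (rateE h Pdel z Py).
  case: asboolP => [yS|_]; last by rewrite leNye.
  by rewrite -EFinB lee_fin; apply: Zlow; split.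
set J := ereal_inf _.
have tl y : K y -> faceS z y -> (J <= (u0R h y - log_section h z y - Ft y + (zeta + 3 * e))%:E)%E.
  move=> Ky [Py yS]; apply: (@le_trans _ _ (tilted_rate h Ft z y)).
    by apply: ereal_inf_lbound; exists y.
  rewrite /tilted_rate (rateE h Pdel z Py) asboolT// -EFinB [leRHS]EFinD.
  by apply: leeD.
have term a : lattice_pts P k a -> weight h Ft k z a * \1_K (scaled R k a) <= 0 \/
    exists y, [/\ K y, faceS z y, realv R a = k%:R *: y &
      weight h Ft k z a * \1_K (scaled R k a) = W a].
  move=> /pt[y Py aE]; rewrite (scaledE k0 aE) indicE.
  case: (boolP (y \in K)) => [/set_mem Ky|_]; last by left; rewrite mulr0.
  rewrite mulr1 -/W (WE a y Py aE); case: asboolP => [yS|_].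
    by right; exists y; split.
  by left; rewrite mul0r mulr0.
(* J is not +oo: as S > 0, some point of K lies on the face of z, where the tilted rate is bounded
   by [tl]. If J = -oo, the right side is +oo. *)
have [JE|[j JE]] : J = -oo%E \/ exists j, J = j%:E.
- have [y Ky Sy] : exists2 y, K y & faceS z y.
    apply: contrapT => H; move: S0; rewrite ltNge => /negP; apply.
    rewrite -(mulr0 N); apply: cnt => // a /term[//|[y [Ky Sy _ _]]].
    by exfalso; apply: H; exists y.
  by have := tl y Ky Sy; case: J {tl} => [j| |] //; [right; exists j|left].
- by rewrite JE /= leey.
rewrite JE -EFinN -EFinD lne_EFin// -EFinM lee_fin.
(* A bound for every weight located in K. On top of the 3e from [Zlow] come the e in the lower bound
   on Q and, below, one e each for 1/q and for N. *)
pose b := q^-1 * expR (k%:R * (- (j - zeta - 3 * e) + e)).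
have b0 : 0 <= b by rewrite mulr_ge0 ?expR_ge0// invr_ge0 ltW.
have Sb : S <= N * b.
  apply: cnt => // a Da; have [/le_trans->//|[y [Ky [Py yS] aE ->]]] := term a Da.
  rewrite (WE a y Py aE) asboolT// mulrA -expRD ler_pdivrMr ?(Qpos a y)//.
  apply: le_trans (ler_wpM2l b0 (Qb a y Py aE).1).
  rewrite /b mulrACA mulVf ?gt_eqF// mul1r -expRD ler_expR -!mulrDr ler_pM2l//.
  have := tl y Ky (conj Py yS); rewrite JE lee_fin; lra.
rewrite ler_pdivrMl//.
have : mu h Ft k z K <= expR (k%:R * (- j + 6 * e)).
  rewrite muE Zexp -expRN; apply: le_trans (ler_wpM2l (expR_ge0 _) Sb) _.
  apply: (@le_trans _ _ (expR (- (k%:R * zeta)) * (expR (k%:R * e) * (expR (k%:R * e) *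
     expR (k%:R * (- (j - zeta - 3 * e) + e)))))).
    rewrite ler_wpM2l ?expR_ge0//; apply: ler_pM => //.
    rewrite /b ler_wpM2r ?expR_ge0// -[leLHS]lnK ?posrE ?invr_gt0//.
    by rewrite ler_expR lnV.
  rewrite -!expRD ler_expR le_eqVlt; apply/orP; left; apply/eqP; ring.
by move=> muj; rewrite -ler_expR lnK.
Qed.

End Final.

Theorem proposition8p1 (R : realType) (m : nat) (P : set 'rV[R]_m)
    (P_delzant : delzant P) (P0 : P 0)
    (P_ge0 : forall x : 'rV[R]_m, P x -> forall i, 0 <= x 0 i)
    (h0 : toric_metric P)
    (p : nat) (lam : 'I_p.+1 -> 'rV[rat]_m * rat) (Rc : int)
    (f_le : forall x : 'rV[R]_m, P x -> max_affine lam x <= Rc%:~R)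
    (T : R) (T_gt0 : 0 < T)
    (K : set 'rV[R]_m) (K_compact : compact K) (K_sub : K `<=` P) :
  let F (t : R) (x : 'rV[R]_m) : R := t * (Rc%:~R - max_affine lam x) in
  forall e : R, 0 < e ->
  \forall k \near \oo, forall (z : toric_point P) (t : R), 0 <= t -> t <= T ->
    ((k%:R^-1)%:E * lne (mu h0 (F t) k z K)%:E
       <= - ereal_inf [set tilted_rate h0 (F t) z x | x in K] + e%:E)%E.
Proof.
move=> F e e0; have [[n [v PE]] _] := P_delzant.
pose d := e / 6; have d0 : 0 < d by rewrite divr_gt0.
have [C C0 HC] := Qnorm_upper h0 P_delzant.
have [q q0 Hq] := Qnorm_lower h0 P_delzant d0.
have [L L0 HL] := max_affine_lip (R := R) lam.
(* F_t has Lipschitz constant at most T L for all t in [0, T], so points at distance s change it by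
   at most d. *)
pose s := Num.min d (d / (T * L)).
have s0 : 0 < s by rewrite lt_min d0 divr_gt0// mulr_gt0.
have [k0 Hk0] := lattice_approx h0 P_delzant PE s0.
have [A HA] := lattice_count P_delzant.
have [k1 Hk1] := poly_le_exp (m := m) A d0.
have big x (k : nat) : ((Num.truncn (x / d)).+1 <= k)%N -> x <= k%:R * d.
  move=> xk; rewrite -ler_pdivrMr//; apply: le_trans (ltW (truncnS_gt _)) _.
  by rewrite ler_nat.
exists (maxn 1 (maxn (maxn k0 k1) (maxn (Num.truncn (ln C / d)).+1 (Num.truncn (- ln q / d)).+1))) => // k /=.
rewrite !geq_max => /and3P[k_gt0 /andP[k0k k1k] /andP[kC kq]] z t t0 tT.
have -> : e = 6 * d by rewrite /d; field.
have [fin cnt] := HA k.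
apply: (@ldp_upper_bound _ _ _ _ P_delzant _ _ _ _ C q ((2 * A * k).+1 ^ m)%:R) => //.
- exact: big.
- exact: big.
- exact: Hk1.
- by move=> a y Py aE; split; [exact: Hq|exact: HC].
move=> y [Py yS].
have [a [y' [Py' aE u' [ys L'] y'S]]] := Hk0 k k0k k_gt0 y (pframe z) (logeta z) Py (pframeP z).
exists a, y'; split => //.
- by split=> // i iz; rewrite y'S// yS.
- by apply: le_trans u' _; rewrite lerD2l ge_min lexx.
- have Ls : t * (L * s) <= d.
    apply: (@le_trans _ _ (T * L * s)); first by rewrite mulrA !ler_wpM2r// ltW.
    by rewrite mulrC -ler_pdivlMr ?mulr_gt0// ge_min lexx orbT.
  have := ler_wpM2l t0 (HL y' y s (ltW s0) ys).
  by rewrite /F mulrDr !mulrBr; lra.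
- by rewrite /log_section lerD2r.
Qed.
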